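(* Let $\Phi=\{\varphi_a:a\in\mathbf A\}$ be a non-trivial uniformly contracting $C^2$ iterated function system on $I=[0,1]$ satisfying the UNI condition, let $(p_a)_{a\in\mathbf A}$ be a probability vector with $0<p_a<1$, and for $s\in\mathbb C$ let $$\mathcal L_s f(x)=\sum_{a\in\mathbf A}p_a|\varphi_a'(x)|^s f(\varphi_a(x)),\qquad f\in C^1(I),\ x\in I.$$ Then there exists $0<\rho_0<1$ such that for all $s=r+ib\in\mathbb C$ with $|r|$ sufficiently small and $|b|$ sufficiently large, for all $n\in\mathbb N$ and all $f\in C^1(I)$, $$\|\mathcal L_s^n f\|_b\lesssim \rho_0^{\,n}|b|^{1/2}\|f\|_b ,$$ where the implied constant is independent of $n$, $f$ and $s$. Thus there exists $0<\delta<1$ such that for all $|r|$ sufficiently small and $|b|$ sufficiently large the spectral radius of $\mathcal L_s$ satisfies $\rho(\mathcal L_s)\le 1-\delta$.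
   Context: $I=[0,1]$, $\mathbf A$ is a finite set, and $\Phi=\{\varphi_a:I\to I\}_{a\in\mathbf A}$ consists of $C^2$ maps. For $\mathbf a=(a_1,\dots,a_n)\in\mathbf A^n$ write $\varphi_{\mathbf a}=\varphi_{a_1}\circ\cdots\circ\varphi_{a_n}$. Let $K$ be the attractor: the unique non-empty compact set with $K=\bigcup_{a\in\mathbf A}\varphi_a(K)$. Standing properties of the IFS: - Uniform contraction: there are $1<\gamma<\gamma_1$ such that $\gamma_1^{-n}\lesssim|\varphi_{\mathbf a}'(x)|\lesssim\gamma^{-n}$ for all $x\in I$, $n\in\mathbb N$, $\mathbf a\in\mathbf A^n$ (implied constants independent of $x,n,\mathbf a$). - Bounded distortions: there is $B>0$ with $|\varphi_a'(x)|/|\varphi_a'(y)|\le B$ for all $x,y\in I$, $a\in\mathbf A$. - Non-trivial: $K$ is not a singleton. - UNI (Uniform Non-Integrability): there exist $c_1,c_2>0$ such that for all $n$ sufficiently large there exist $\mathbf a,\mathbf b\in\mathbf A^n$ with $c_1\le\left|\frac{\varphi_{\mathbf a}''(x)}{\varphi_{\mathbf a}'(x)}-\frac{\varphi_{\mathbf b}''(x)}{\varphi_{\mathbf b}'(x)}\right|\le c_2$ for all $x\in K$. No separation is assumed (arbitrary overlaps). $C^1(I)$ denotes complex-valued $C^1$ functions, with norm $\|f\|_b:=\|f\|_\infty+|b|^{-1}\|f'\|_\infty$ for $b\neq0$. The spectral radius is that of $\mathcal L_s$ acting on the Banach space $(C^1(I),\|\cdot\|_b)$. $f\lesssim g$ means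 $f\le cg$ for a constant $c>0$. *)

(* Defs.v *)
From mathcomp Require Import all_boot.
From Stdlib Require Import Reals Lra FunctionalExtensionality ProofIrrelevance.
From Coquelicot Require Import Coquelicot.

Set Implicit Arguments.
Unset Strict Implicit.
Unset Printing Implicit Defensive.

Local Open Scope R_scope.

Record I01 := mkI01 { ival :> R; ivalP : 0 <= ival <= 1 }.

Lemma ival_inj (x y : I01) : ival x = ival y -> x = y.
Proof.
case: x => x hx; case: y => y hy /= e; subst y.
by rewrite (proof_irrelevance _ hx hy).
Qed.

Lemma I01_0P : 0 <= 0 <= 1. Proof. lra. Qed.
Definition I01_0 := mkI01 I01_0P.

Definition I01_ball (x : I01) (e : R) (y : I01) : Prop := ball (ival x) e (ival y).

Definition I01_UniformSpace_mixin : UniformSpace.mixin_of I01 :=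
  @UniformSpace.Mixin I01 I01_0 I01_ball
    (fun x e => ball_center (ival x) e)
    (fun x y e => @ball_sym _ (ival x) (ival y) e)
    (fun x y z e1 e2 => @ball_triangle _ (ival x) (ival y) (ival z) e1 e2).

Canonical I01_UniformSpace : UniformSpace :=
  UniformSpace.Pack I01 I01_UniformSpace_mixin I01.

(* As [y] ranges over [0,1], the derivative is one-sided at the endpoints. *)
Definition is_derive01 {V : NormedModule R_AbsRing} (f : I01 -> V) (x : I01) (l : V)
  : Prop :=
  filterlim (fun y : I01 => scal (/ (y - x)) (minus (f y) (f x)))
    (locally' x) (locally l).

(* Meaningful only at points where [f] is differentiable. *)
Definition deriv01 {V : CompleteNormedModule R_AbsRing} (f : I01 -> V) (x : I01) : V :=
  iota (is_derive01 f x).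

Definition is_C1 {V : CompleteNormedModule R_AbsRing} (f : I01 -> V) : Prop :=
  (forall x, exists l, is_derive01 f x l) /\ (forall x, continuous (deriv01 f) x).

Definition is_C2 {V : CompleteNormedModule R_AbsRing} (f : I01 -> V) : Prop :=
  is_C1 f /\ is_C1 (deriv01 f).

Global Instance locally'_I01_proper (x : I01) : ProperFilter (locally' x).
Proof.
constructor; last by apply: within_filter; exact: locally_filter.
move=> P [e He].
have He0 := cond_pos e.
have hx := ivalP x.
set d := Rmin (e / 2) (1 / 2).
have hd : 0 < d by apply: Rmin_pos; lra.
have hde : d <= e / 2 by exact: Rmin_l.
have hd2 : d <= 1 / 2 by exact: Rmin_r.
have [h|h] := Rle_dec x (1 / 2).
- have hy : 0 <= x + d <= 1 by lra.
  exists (mkI01 hy); apply: He.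
  + rewrite /ball /= /I01_ball /ball /= /AbsRing_ball /abs /minus /plus /opp /=.
    by rewrite Rabs_pos_eq; lra.
  + by move/(f_equal ival) => /=; lra.
- have hy : 0 <= x - d <= 1 by lra.
  exists (mkI01 hy); apply: He.
  + rewrite /ball /= /I01_ball /ball /= /AbsRing_ball /abs /minus /plus /opp /=.
    by rewrite Rabs_left; lra.
  + by move/(f_equal ival) => /=; lra.
Qed.

Lemma continuous_ival (x : I01) : continuous ival x.
Proof. by apply/filterlim_locally => e; exists e. Qed.

Lemma continuous_to_I01 (T : UniformSpace) (g : T -> I01) x :
  continuous (fun y => ival (g y)) x -> continuous g x.
Proof.
move=> /filterlim_locally h; apply/filterlim_locally => e; exact: h.
Qed.

Lemma is_derive01_carath {V : NormedModule R_AbsRing} (f : I01 -> V) x l :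
  is_derive01 f x l <->
  exists q : I01 -> V, [/\ continuous q x, q x = l &
    forall y, f y = plus (f x) (scal (y - x) (q y))].
Proof.
split.
- move=> h.
  exists (fun y : I01 => if Req_EM_T y x then l else scal (/ (y - x)) (minus (f y) (f x))).
  have e1 : (if Req_EM_T x x then l else scal (/ (x - x)) (minus (f x) (f x))) = l.
    by case: Req_EM_T.
  split => //.
  + rewrite /continuous e1; apply/filterlim_locally => e.
    move/filterlim_locally: h => /(_ e) [d Hd].
    exists d => y hy; case: Req_EM_T => e2; first exact: ball_center.
    by apply: Hd => // e3; apply: e2; rewrite e3.
  + move=> y; case: Req_EM_T => e2 /=.
      have -> : y = x by exact: ival_inj.
      by rewrite Rminus_diag (scal_zero_l (K:=R_Ring)) plus_zero_r.
    rewrite scal_assoc /mult /= Rinv_r; last lra.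
    by rewrite (scal_one (K:=R_Ring)) /minus plus_comm -plus_assoc plus_opp_l plus_zero_r.
- move=> [q [hq <- hf]].
  apply: (filterlim_within_ext (fun y => y <> x) q).
    move=> y hy; rewrite hf /minus (plus_comm (f x)) -plus_assoc plus_opp_r plus_zero_r.
    rewrite scal_assoc /mult /= Rinv_l ?(scal_one (K:=R_Ring)) //.
    by move=> e; apply: hy; apply: ival_inj; lra.
  apply: filterlim_filter_le_1 hq => P; rewrite /locally' /within.
  by apply: filter_imp.
Qed.

Lemma is_derive01_unique {V : CompleteNormedModule R_AbsRing} (f : I01 -> V) x l :
  is_derive01 f x l -> deriv01 f x = l.
Proof.
move=> h; apply: iota_unique => // y hy.
exact: (filterlim_locally_unique (F := locally' x)) hy h.
Qed.

Lemma deriv01_correct {V : CompleteNormedModule R_AbsRing} (f : I01 -> V) x :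
  (exists l, is_derive01 f x l) -> is_derive01 f x (deriv01 f x).
Proof. by move=> [l hl]; rewrite (is_derive01_unique hl). Qed.

Lemma is_derive01_continuous {V : NormedModule R_AbsRing} (f : I01 -> V) x l :
  is_derive01 f x l -> continuous f x.
Proof.
move/is_derive01_carath => [q [hq _ hf]].
apply: (continuous_ext (fun y : I01 => plus (f x) (scal (minus (ival y) (ival x)) (q y)))).
  by move=> y; rewrite [in RHS]hf.
apply: continuous_plus; first exact: continuous_const.
apply: continuous_scal => //.
apply: continuous_minus; [exact: continuous_ival | exact: continuous_const].
Qed.

Lemma is_C1_intro {V : CompleteNormedModule R_AbsRing} (f df : I01 -> V) :
  (forall x, is_derive01 f x (df x)) -> (forall x, continuous df x) -> is_C1 f.
Proof.
move=> h c; split=> x; first by exists (df x).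
apply: continuous_ext (c x) => y; exact/esym/is_derive01_unique.
Qed.

Lemma is_derive01_plus {V : NormedModule R_AbsRing} (f g : I01 -> V) x l m :
  is_derive01 f x l -> is_derive01 g x m ->
  is_derive01 (fun y => plus (f y) (g y)) x (plus l m).
Proof.
move=> /is_derive01_carath [q [hq <- hf]] /is_derive01_carath [r [hr <- hg]].
apply/is_derive01_carath; exists (fun y => plus (q y) (r y)); split=> //.
  exact: continuous_plus.
move=> y; rewrite hf hg (scal_distr_l (K:=R_Ring)) -!plus_assoc; congr plus.
by rewrite !plus_assoc; congr plus; rewrite plus_comm.
Qed.

Lemma is_derive01_const {V : NormedModule R_AbsRing} (v : V) x :
  is_derive01 (fun=> v) x zero.
Proof.
apply/is_derive01_carath; exists (fun=> zero); split => //.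
  exact: continuous_const.
by move=> y; rewrite (scal_zero_r (K:=R_Ring)) plus_zero_r.
Qed.

Lemma is_derive01_mult (f g : I01 -> R) x l m :
  is_derive01 (V := R_NormedModule) f x l -> is_derive01 (V := R_NormedModule) g x m ->
  is_derive01 (V := R_NormedModule) (fun y => f y * g y) x (l * g x + f x * m).
Proof.
move=> df dg; have cg := is_derive01_continuous dg.
move: df dg.
move=> /is_derive01_carath [q [hq <- hf]] /is_derive01_carath [r [hr <- hg]].
apply/is_derive01_carath; exists (fun y => q y * g y + f x * r y); split=> //.
  apply: (continuous_plus (V := R_NormedModule)).
    exact: (continuous_mult (K := R_AbsRing)).
  apply: (continuous_mult (K := R_AbsRing)) => //; exact: continuous_const.
move=> y; rewrite hf hg /plus /scal /= /mult /=; ring.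
Qed.

Lemma is_derive01_compI {V : NormedModule R_AbsRing} (f : I01 -> V) (g : I01 -> I01) x l m :
  is_derive01 f (g x) l -> is_derive01 (V := R_NormedModule) (fun y => ival (g y)) x m ->
  is_derive01 (fun y => f (g y)) x (scal m l).
Proof.
move=> df dg; have cg : continuous g x.
  by apply: continuous_to_I01; exact: is_derive01_continuous dg.
move: df dg.
move=> /is_derive01_carath [q [hq <- hf]] /is_derive01_carath [r [hr <- hg]].
apply/is_derive01_carath; exists (fun y => scal (r y) (q (g y))); split=> //.
  apply: continuous_scal => //; exact: continuous_comp.
move=> y; rewrite hf hg scal_assoc; congr plus; congr scal.
rewrite /plus /scal /= /mult /=; ring.
Qed.

Lemma is_derive01_compR (h : R -> R) (f : I01 -> R) x k l :
  is_derive h (f x) k -> is_derive01 (V := R_NormedModule) f x l ->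
  is_derive01 (V := R_NormedModule) (fun y => h (f y)) x (l * k).
Proof.
move=> dh df; have cf := is_derive01_continuous df.
move/is_derive01_carath: df => [q [hq <- hf]].
pose u t := if Req_EM_T t (f x) then k else (h t - h (f x)) / (t - f x).
have u0 : u (f x) = k by rewrite /u; case: Req_EM_T.
have cu : continuous u (f x).
  rewrite /continuous u0; apply/filterlim_locally => e.
  move/is_derive_Reals: dh => /(_ e (cond_pos e)) [d Hd].
  exists d => t ht; rewrite /u; case: Req_EM_T => e2; first exact: ball_center.
  have := Hd (t - f x) _ ht; rewrite (_ : f x + (t - f x) = t); last ring.
  by apply; lra.
apply/is_derive01_carath; exists (fun y => q y * u (f y)); split=> //.
- apply: (continuous_mult (K := R_AbsRing)) => //; exact: continuous_comp.
- by rewrite u0.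
- move=> y; have e : h (f y) = h (f x) + (f y - f x) * u (f y).
    rewrite /u; case: Req_EM_T => ne /=; first by rewrite ne; ring.
    by field; lra.
  have d : f y - f x = (y - x) * q y.
    rewrite [in LHS]hf /plus /scal /= /mult /=; ring.
  rewrite e d /plus /scal /= /mult /=; ring.
Qed.

Lemma continuous_C (T : UniformSpace) (f : T -> C) x :
  continuous (U := C_UniformSpace) f x <->
  continuous (fun y => Re (f y)) x /\ continuous (fun y => Im (f y)) x.
Proof.
split.
  move=> h; split; move/filterlim_locally: h => h; apply/filterlim_locally => e;
  by apply: filter_imp (h e) => y [].
move=> [/filterlim_locally h1 /filterlim_locally h2]; apply/filterlim_locally => e.
by apply: filter_imp (filter_and _ _ (h1 e) (h2 e)) => y [].
Qed.

Lemma is_derive01_C (f : I01 -> C) x (l : C) :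
  is_derive01 (V := C_R_NormedModule) f x l <->
  is_derive01 (V := R_NormedModule) (fun y => Re (f y)) x (Re l) /\
  is_derive01 (V := R_NormedModule) (fun y => Im (f y)) x (Im l).
Proof.
split.
  move=> /is_derive01_carath [q [/continuous_C [h1 h2] <- hf]].
  split; apply/is_derive01_carath.
    exists (fun y => Re (q y)); split => // y; by rewrite hf.
  exists (fun y => Im (q y)); split => // y; by rewrite hf.
move=> [/is_derive01_carath [q [hq q0 hf]] /is_derive01_carath [r [hr r0 hg]]].
apply/is_derive01_carath; exists (fun y => (q y, r y) : C); split.
- exact/continuous_C.
- by rewrite q0 r0; case: (l).
- by move=> y; apply: injective_projections; [exact: hf | exact: hg].
Qed.

Notation is_C1R := (is_C1 (V := R_CompleteNormedModule)).
Notation is_C1C := (is_C1 (V := C_R_CompleteNormedModule)).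
Notation is_C2R := (is_C2 (V := R_CompleteNormedModule)).
Notation derivR := (deriv01 (V := R_CompleteNormedModule)).
Notation derivC := (deriv01 (V := C_R_CompleteNormedModule)).

Lemma is_C1_continuous {V : CompleteNormedModule R_AbsRing} (f : I01 -> V) x :
  is_C1 f -> continuous f x.
Proof. by move=> [/(_ x) [l hl] _]; exact: is_derive01_continuous hl. Qed.

Lemma is_C1C_split (f : I01 -> C) :
  is_C1C f <-> is_C1R (fun y => Re (f y)) /\ is_C1R (fun y => Im (f y)).
Proof.
split.
  move=> [h1 h2]; have h x := proj1 (is_derive01_C f x _) (deriv01_correct (h1 x)).
  split.
    apply: (@is_C1_intro _ _ (fun x => Re (derivC f x))) => x; first by have [] := h x.
    by have [] := proj1 (continuous_C _ _) (h2 x).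
  apply: (@is_C1_intro _ _ (fun x => Im (derivC f x))) => x; first by have [] := h x.
  by have [] := proj1 (continuous_C _ _) (h2 x).
move=> [[h1 h2] [h3 h4]].
apply: (@is_C1_intro C_R_CompleteNormedModule _
  (fun x => (derivR (fun y => Re (f y)) x, derivR (fun y => Im (f y)) x) : C)) => x.
  by apply/is_derive01_C; split; exact: deriv01_correct.
exact/continuous_C.
Qed.

Lemma is_C1_plus {V : CompleteNormedModule R_AbsRing} (f g : I01 -> V) :
  is_C1 f -> is_C1 g -> is_C1 (fun x => plus (f x) (g x)).
Proof.
move=> [f1 f2] [g1 g2].
apply: (@is_C1_intro _ _ (fun x => plus (deriv01 f x) (deriv01 g x))) => x.
  by apply: is_derive01_plus; exact: deriv01_correct.
exact: continuous_plus.
Qed.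

Lemma is_C1_const {V : CompleteNormedModule R_AbsRing} (v : V) : is_C1 (fun=> v).
Proof.
apply: (@is_C1_intro _ _ (fun=> zero)) => x; first exact: is_derive01_const.
exact: continuous_const.
Qed.

Lemma is_C1R_mult (f g : I01 -> R) :
  is_C1R f -> is_C1R g -> is_C1R (fun x => f x * g x).
Proof.
move=> hf hg; have [f1 f2] := hf; have [g1 g2] := hg.
apply: (@is_C1_intro R_CompleteNormedModule _
  (fun x => derivR f x * g x + f x * derivR g x)) => x.
  by apply: is_derive01_mult; exact: deriv01_correct.
apply: (continuous_plus (V := R_NormedModule));
  by apply: (continuous_mult (K := R_AbsRing)) => //;
     exact: (is_C1_continuous (V := R_CompleteNormedModule)).
Qed.

Lemma is_C1_compI {V : CompleteNormedModule R_AbsRing} (f : I01 -> V) (g : I01 -> I01) :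
  is_C1 f -> is_C1R (fun x => ival (g x)) -> is_C1 (fun x => f (g x)).
Proof.
move=> [f1 f2] hg; have [g1 g2] := hg.
apply: (@is_C1_intro _ _
  (fun x => scal (derivR (fun y => ival (g y)) x) (deriv01 f (g x)))) => x.
  by apply: is_derive01_compI; exact: deriv01_correct.
apply: continuous_scal; first exact: g2.
apply: continuous_comp => //; apply: continuous_to_I01.
exact: (is_C1_continuous (V := R_CompleteNormedModule)).
Qed.

Lemma is_C1R_compR (h dh : R -> R) (f : I01 -> R) :
  (forall x, is_derive h (f x) (dh (f x))) -> (forall x, continuous dh (f x)) ->
  is_C1R f -> is_C1R (fun x => h (f x)).
Proof.
move=> h1 h2 hf; have [f1 f2] := hf.
apply: (@is_C1_intro R_CompleteNormedModule _ (fun x => derivR f x * dh (f x))) => x.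
  apply: is_derive01_compR; [exact: h1 | exact: deriv01_correct].
apply: (continuous_mult (K := R_AbsRing)) => //.
apply: continuous_comp => //.
exact: (is_C1_continuous (V := R_CompleteNormedModule)).
Qed.

Lemma is_C1C_mult (f g : I01 -> C) :
  is_C1C f -> is_C1C g -> is_C1C (fun x => Cmult (f x) (g x)).
Proof.
move=> /is_C1C_split [f1 f2] /is_C1C_split [g1 g2]; apply/is_C1C_split; split=> /=.
  apply: (is_C1_plus (V := R_CompleteNormedModule)); first exact: is_C1R_mult.
  apply: (@is_C1R_compR Ropp (fun=> -1)); last exact: is_C1R_mult.
    by move=> x; auto_derive => //; ring.
  by move=> x; exact: continuous_const.
by apply: (is_C1_plus (V := R_CompleteNormedModule)); exact: is_C1R_mult.
Qed.

Record C1fun := mkC1fun { c1val :> I01 -> C; c1valP : is_C1C c1val }.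

Lemma c1fun_eq (f g : C1fun) : (forall x, f x = g x) -> f = g.
Proof.
case: f => f hf; case: g => g hg /= e.
have e' : f = g by exact: functional_extensionality.
by subst g; rewrite (proof_irrelevance _ hf hg).
Qed.

Definition C1plus (f g : C1fun) : C1fun :=
  mkC1fun (is_C1_plus (c1valP f) (c1valP g)).
Definition C1zero : C1fun :=
  mkC1fun (is_C1_const (V := C_R_CompleteNormedModule) (RtoC 0)).
Definition C1scal (z : C) (f : C1fun) : C1fun :=
  mkC1fun (is_C1C_mult (is_C1_const (V := C_R_CompleteNormedModule) z) (c1valP f)).
Definition C1opp (f : C1fun) : C1fun := C1scal (RtoC (-1)) f.

(* The supremum is taken in the extended reals; it is finite for continuous functions. *)
Definition sup_norm (f : I01 -> C) : R :=
  real (Lub_Rbar (fun t => exists x, t = Cmod (f x))).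

Definition norm_b (b : R) (f : C1fun) : R :=
  sup_norm f + / Rabs b * sup_norm (derivC f).
Lemma continuous_Cmod (x : C) : continuous (T := C_UniformSpace) Cmod x.
Proof. exact: (filterlim_norm (K := C_AbsRing) (V := C_NormedModule)). Qed.

Lemma sup_norm_lub (f : I01 -> C) :
  (forall x, continuous (U := C_UniformSpace) f x) ->
  is_lub_Rbar (fun t => exists x, t = Cmod (f x)) (sup_norm f).
Proof.
move=> cf.
have clampP t : 0 <= Rmax 0 (Rmin 1 t) <= 1.
  split; first exact: Rmax_l.
  by apply: Rmax_lub; [lra | exact: Rmin_l].
pose F (t : R) : C := f (mkI01 (clampP t)).
have [M HM] : {M | forall t, 0 <= t <= 1 -> norm (V := C_NormedModule) (F t) < M}.
  apply: bounded_continuity => t ht.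
  apply: (continuous_comp (fun t => mkI01 (clampP t)) f t) => //.
  apply: continuous_to_I01 => /=.
  apply: (continuous_comp (fun t => Rmin 1 t) (fun t => Rmax 0 t)).
    apply: (continuous_ext (fun t => 1 / 2 * (1 + t - Rabs (t - 1)))).
      by move=> u; rewrite /Rmin /Rabs; case: Rle_dec; case: Rcase_abs; lra.
    apply/continuity_pt_filterlim; reg.
  apply: (continuous_ext (fun t => 1 / 2 * (t + Rabs t))).
    by move=> u; rewrite /Rmax /Rabs; case: Rle_dec; case: Rcase_abs; lra.
  apply/continuity_pt_filterlim; reg.
have bd x : Cmod (f x) <= M.
  have e : mkI01 (clampP (ival x)) = x.
    apply: ival_inj => /=; have := ivalP x.
    by rewrite /Rmin /Rmax; case: Rle_dec; case: Rle_dec; lra.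
  have := HM (ival x) (ivalP x); rewrite /F e => h; exact: Rlt_le h.
have := Lub_Rbar_correct (fun t => exists x, t = Cmod (f x)).
rewrite /sup_norm; case: (Lub_Rbar _) => [r|[h1 h2]|[h1 h2]] //=.
  by have := h2 (Finite M) => /=; case=> t [x ->]; exact: bd.
by have := h1 _ (ex_intro _ I01_0 erefl).
Qed.

Lemma sup_norm_ub (f : I01 -> C) x :
  (forall x, continuous (U := C_UniformSpace) f x) -> Cmod (f x) <= sup_norm f.
Proof. by move=> /sup_norm_lub [h _]; apply: h; exists x. Qed.

Lemma sup_norm_le (f : I01 -> C) M :
  (forall x, continuous (U := C_UniformSpace) f x) ->
  (forall x, Cmod (f x) <= M) -> sup_norm f <= M.
Proof. by move=> /sup_norm_lub [_ h] hM; apply: (h (Finite M)) => t [x ->]; exact: hM. Qed.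

Lemma c1fun_continuous (f : C1fun) x : continuous (U := C_UniformSpace) f x.
Proof. exact: (is_C1_continuous (V := C_R_CompleteNormedModule)) (c1valP f). Qed.

Lemma c1fun_deriv_continuous (f : C1fun) x : continuous (U := C_UniformSpace) (derivC f) x.
Proof. exact: (proj2 (c1valP f)). Qed.

Lemma c1fun_deriv (f : C1fun) x : is_derive01 (V := C_R_NormedModule) f x (derivC f x).
Proof.
exact: (deriv01_correct (V := C_R_CompleteNormedModule)) (proj1 (c1valP f) x).
Qed.

Arguments c1fun_continuous f x : clear implicits.
Arguments c1fun_deriv_continuous f x : clear implicits.
Arguments c1fun_deriv f x : clear implicits.

Lemma is_derive01_Cscal (z : C) (f : I01 -> C) x (l : C) :
  is_derive01 (V := C_R_NormedModule) f x l ->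
  is_derive01 (V := C_R_NormedModule) (fun y => Cmult z (f y)) x (Cmult z l).
Proof.
move=> /is_derive01_carath [q [hq <- hf]].
apply/is_derive01_carath; exists (fun y => Cmult z (q y)); split=> //.
- move/continuous_C: hq => [h1 h2]; apply/continuous_C; split.
    apply: (continuous_minus (V := R_NormedModule));
      apply: (continuous_mult (K := R_AbsRing)) => //; exact: continuous_const.
  apply: (continuous_plus (V := R_NormedModule));
    apply: (continuous_mult (K := R_AbsRing)) => //; exact: continuous_const.
- move=> y; rewrite hf; apply: injective_projections;
    rewrite /plus /scal /= /prod_plus /prod_scal /plus /scal /= /mult /=; ring.
Qed.

Lemma derivC_plus (f g : C1fun) x :
  derivC (C1plus f g) x = Cplus (derivC f x) (derivC g x).
Proof.
apply: (is_derive01_unique (V := C_R_CompleteNormedModule)).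
exact: (is_derive01_plus (V := C_R_NormedModule) (c1fun_deriv f x) (c1fun_deriv g x)).
Qed.

Lemma derivC_scal z (f : C1fun) x : derivC (C1scal z f) x = Cmult z (derivC f x).
Proof.
apply: (is_derive01_unique (V := C_R_CompleteNormedModule)).
exact: (@is_derive01_Cscal z f x _ (c1fun_deriv f x)).
Qed.

Lemma Rinv_abs_ge0 b : 0 <= / Rabs b.
Proof.
have [->|nb] := Req_EM_T b 0; first by rewrite Rabs_R0 Rinv_0; lra.
by left; apply: Rinv_0_lt_compat; exact: Rabs_pos_lt.
Qed.

Lemma norm_b_triangle b (f g : C1fun) : norm_b b (C1plus f g) <= norm_b b f + norm_b b g.
Proof.
rewrite /norm_b.
have h0 : sup_norm (C1plus f g) <= sup_norm f + sup_norm g.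
  apply: sup_norm_le; first exact: c1fun_continuous.
  move=> x; apply: Rle_trans (Cmod_triangle _ _) _.
  by apply: Rplus_le_compat; apply: sup_norm_ub; exact: c1fun_continuous.
have h1 : sup_norm (derivC (C1plus f g)) <= sup_norm (derivC f) + sup_norm (derivC g).
  apply: sup_norm_le; first exact: c1fun_deriv_continuous.
  move=> x; rewrite derivC_plus; apply: Rle_trans (Cmod_triangle _ _) _.
  by apply: Rplus_le_compat; apply: sup_norm_ub; exact: c1fun_deriv_continuous.
have := Rmult_le_compat_l _ _ _ (Rinv_abs_ge0 b) h1; lra.
Qed.

Lemma norm_b_scal b z (f : C1fun) : norm_b b (C1scal z f) <= Cmod z * norm_b b f.
Proof.
rewrite /norm_b.
have h0 : sup_norm (C1scal z f) <= Cmod z * sup_norm f.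
  apply: sup_norm_le; first exact: c1fun_continuous.
  move=> x; rewrite Cmod_mult; apply: Rmult_le_compat_l; first exact: Cmod_ge_0.
  by apply: sup_norm_ub; exact: c1fun_continuous.
have h1 : sup_norm (derivC (C1scal z f)) <= Cmod z * sup_norm (derivC f).
  apply: sup_norm_le; first exact: c1fun_deriv_continuous.
  move=> x; rewrite derivC_scal Cmod_mult; apply: Rmult_le_compat_l; first exact: Cmod_ge_0.
  by apply: sup_norm_ub; exact: c1fun_deriv_continuous.
have := Rmult_le_compat_l _ _ _ (Rinv_abs_ge0 b) h1; lra.
Qed.

Lemma norm_b_eq0 b (f : C1fun) : norm_b b f = 0 -> f = C1zero.
Proof.
rewrite /norm_b => h.
have h0 : 0 <= sup_norm (derivC f).
  apply: Rle_trans (Cmod_ge_0 (derivC f I01_0)) _.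
  by apply: sup_norm_ub; exact: c1fun_deriv_continuous.
have h1 := Rmult_le_pos _ _ (Rinv_abs_ge0 b) h0.
apply: c1fun_eq => x; apply: Cmod_eq_0.
have := sup_norm_ub x (c1fun_continuous f); have := Cmod_ge_0 (f x); lra.
Qed.

Definition C1_AbelianMonoid_mixin : AbelianMonoid.mixin_of C1fun.
Proof.
apply: (@AbelianMonoid.Mixin C1fun C1plus C1zero).
- by move=> f g; apply: c1fun_eq => x; exact: Cplus_comm.
- by move=> f g h; apply: c1fun_eq => x; exact: Cplus_assoc.
- by move=> f; apply: c1fun_eq => x; exact: Cplus_0_r.
Defined.

Canonical C1_AbelianMonoid := AbelianMonoid.Pack C1fun C1_AbelianMonoid_mixin C1fun.

Definition C1_AbelianGroup_mixin : AbelianGroup.mixin_of C1_AbelianMonoid.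
Proof.
apply: (@AbelianGroup.Mixin C1_AbelianMonoid C1opp).
move=> f; apply: c1fun_eq => x /=; apply: injective_projections => /=;
  rewrite /plus /=; ring.
Defined.

Canonical C1_AbelianGroup :=
  AbelianGroup.Pack C1fun (AbelianGroup.Class C1fun _ C1_AbelianGroup_mixin) C1fun.

Definition C1_ModuleSpace_mixin : ModuleSpace.mixin_of C_Ring C1_AbelianGroup.
Proof.
apply: (@ModuleSpace.Mixin C_Ring C1_AbelianGroup C1scal).
- by move=> x y f; apply: c1fun_eq => t; exact: Cmult_assoc.
- by move=> f; apply: c1fun_eq => t; exact: Cmult_1_l.
- by move=> x f g; apply: c1fun_eq => t; exact: Cmult_plus_distr_l.
- by move=> x y f; apply: c1fun_eq => t; exact: Cmult_plus_distr_r.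
Defined.

Canonical C1_ModuleSpace :=
  ModuleSpace.Pack C_Ring C1fun (ModuleSpace.Class C_Ring C1fun _ C1_ModuleSpace_mixin) C1fun.

Section NormB.
Variable b : R.

Definition C1_ball (f : C1fun) (e : R) (g : C1fun) : Prop := norm_b b (minus g f) < e.

Lemma norm_b_zero : norm_b b C1zero = 0.
Proof.
have e : C1zero = C1scal 0 C1zero by apply: c1fun_eq => x /=; rewrite Cmult_0_l.
apply: Rle_antisym.
  by rewrite e; apply: Rle_trans (norm_b_scal _ _ _) _; rewrite Cmod_0; lra.
rewrite /norm_b; apply: Rplus_le_le_0_compat.
  by apply: Rle_trans (sup_norm_ub I01_0 (c1fun_continuous _)); exact: Cmod_ge_0.
apply: Rmult_le_pos; first exact: Rinv_abs_ge0.
by apply: Rle_trans (sup_norm_ub I01_0 (c1fun_deriv_continuous _)); exact: Cmod_ge_0.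
Qed.

Definition C1_UniformSpace_mixin : UniformSpace.mixin_of C1fun.
Proof.
apply: (@UniformSpace.Mixin C1fun C1zero C1_ball).
- by move=> f e; rewrite /C1_ball minus_eq_zero norm_b_zero; exact: cond_pos.
- move=> f g e; rewrite /C1_ball; apply: Rle_lt_trans.
  have -> : minus f g = C1scal (RtoC (-1)) (minus g f) by rewrite -opp_minus.
  apply: Rle_trans (norm_b_scal _ _ _) _.
  by rewrite Cmod_R Rabs_Ropp Rabs_R1; lra.
- move=> f g h e1 e2; rewrite /C1_ball => h1 h2.
  rewrite (minus_trans g); apply: Rle_lt_trans (norm_b_triangle _ _ _) _; lra.
Defined.

Definition C1_NormedModuleAux : NormedModuleAux C_AbsRing :=
  NormedModuleAux.Pack C_AbsRing C1fun
    (NormedModuleAux.Class C_AbsRing C1fun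
      (ModuleSpace.class C_Ring C1_ModuleSpace) C1_UniformSpace_mixin) C1fun.

Definition C1_NormedModule_mixin : NormedModule.mixin_of C_AbsRing C1_NormedModuleAux.
Proof.
apply: (@NormedModule.Mixin C_AbsRing C1_NormedModuleAux (norm_b b) 1).
- exact: norm_b_triangle.
- exact: norm_b_scal.
- by [].
- by move=> f g e; rewrite Rmult_1_l.
- exact: norm_b_eq0.
Defined.

(* The space (C^1([0,1]), ||.||_b) over the complex numbers; it is a Banach space
   for [b <> 0], while for [b = 0] the norm is the supremum norm, since [/ 0 = 0]. *)
Definition C1_NormedModule : NormedModule C_AbsRing :=
  NormedModule.Pack C_AbsRing C1fun
    (NormedModule.Class C_AbsRing C1fun
      (NormedModuleAux.class C_AbsRing C1_NormedModuleAux) C1_NormedModule_mixin) C1fun.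

End NormB.

(* [is_linear] includes boundedness. *)
Definition in_spectrum (V : NormedModule C_AbsRing) (T : V -> V) (z : C) : Prop :=
  ~ exists S : V -> V, [/\ is_linear S,
      forall v, S (minus (scal z v) (T v)) = v
    & forall v, minus (scal z (S v)) (T (S v)) = v].

Definition spectral_radius (V : NormedModule C_AbsRing) (T : V -> V) : Rbar :=
  Lub_Rbar (fun t => exists2 z, in_spectrum T z & t = Cmod z).

Definition word_map (A : Type) (phi : A -> I01 -> I01) (w : seq A) : I01 -> I01 :=
  foldr (fun a g => phi a \o g) (fun x => x) w.

Definition D1 (g : I01 -> I01) : I01 -> R := derivR (fun x => ival (g x)).
Definition D2 (g : I01 -> I01) : I01 -> R := derivR (D1 g).

Definition uniformly_contracting (A : Type) (phi : A -> I01 -> I01) : Prop :=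
  exists gamma gamma1 c c' : R, [/\ 1 < gamma, gamma < gamma1, 0 < c, 0 < c' &
    forall (n : nat) (w : n.-tuple A) (x : I01),
      c * / gamma1 ^ n <= Rabs (D1 (word_map phi w) x) <= c' * / gamma ^ n].

Definition bounded_distortions (A : Type) (phi : A -> I01 -> I01) : Prop :=
  exists2 B : R, 0 < B &
    forall (a : A) (x y : I01), Rabs (D1 (phi a) x) / Rabs (D1 (phi a) y) <= B.

Record contracting_ifs (A : finType) := ContractingIFS {
  ifs_map :> A -> I01 -> I01;
  ifs_C2 : forall a, is_C2R (fun x => ival (ifs_map a x));
  ifs_contracting : uniformly_contracting ifs_map;
  ifs_distortions : bounded_distortions ifs_map }.

Definition is_attractor (A : finType) (phi : A -> I01 -> I01) (K : I01 -> Prop) : Prop :=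
  [/\ exists x, K x,
      compact (fun t : R => exists2 x : I01, K x & ival x = t)
    & forall x, K x <-> exists a y, K y /\ phi a y = x].

Definition UNI (A : finType) (phi : A -> I01 -> I01) (K : I01 -> Prop) : Prop :=
  exists c1 c2 : R, [/\ 0 < c1, 0 < c2 &
    exists N : nat, forall n : nat, (N <= n)%nat ->
      exists u v : n.-tuple A, forall x, K x ->
        c1 <= Rabs (D2 (word_map phi u) x / D1 (word_map phi u) x
                    - D2 (word_map phi v) x / D1 (word_map phi v) x) <= c2].

(* [t ^ s = exp (s * ln t)] for [t > 0]. *)
Definition Rcpow (t : R) (s : C) : C :=
  Cmult (RtoC (Rpower t (Re s))) (cos (Im s * ln t), sin (Im s * ln t)).

Definition transfer_fun (A : finType) (phi : A -> I01 -> I01) (p : A -> R) (s : C)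
    (f : I01 -> C) (x : I01) : C :=
  \big[Cplus/RtoC 0]_(a : A)
     Cmult (Cmult (RtoC (p a)) (Rcpow (Rabs (D1 (phi a) x)) s)) (f (phi a x)).

Lemma is_derive_ln_abs t : t <> 0 -> is_derive (fun u => ln (Rabs u)) t (/ t).
Proof.
move=> nt; have [t0|t0] := Rlt_dec 0 t.
  apply: (is_derive_ext_loc ln).
    by apply: filter_imp (open_gt 0 t t0) => u hu; rewrite Rabs_pos_eq //; lra.
  exact: is_derive_ln.
have {}t0 : t < 0 by lra.
apply: (is_derive_ext_loc (fun u => ln (- u))).
  by apply: filter_imp (open_lt 0 t t0) => u hu; rewrite Rabs_left.
by auto_derive; [lra | field].
Qed.

Lemma is_C1C_Rcpow (u : I01 -> R) (s : C) :
  is_C1R u -> (forall x, u x <> 0) -> is_C1C (fun x => Rcpow (Rabs (u x)) s).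
Proof.
move=> hu nu.
have hl : is_C1R (fun x => ln (Rabs (u x))).
  apply: (@is_C1R_compR (fun t => ln (Rabs t)) Rinv) => // x.
    exact: is_derive_ln_abs.
  exact: continuous_Rinv.
apply: is_C1C_mult.
  apply/is_C1C_split; split => /=; last first.
    exact: (is_C1_const (V := R_CompleteNormedModule)).
  apply: (@is_C1R_compR (fun t => exp (Re s * t)) (fun t => Re s * exp (Re s * t))) => // x.
    by auto_derive => //; ring.
  by apply: (ex_derive_continuous (V := R_NormedModule)); auto_derive.
apply/is_C1C_split; split => /=.
  apply: (@is_C1R_compR (fun t => cos (Im s * t)) (fun t => - Im s * sin (Im s * t))) => // x.
    by auto_derive => //; ring.
  by apply: (ex_derive_continuous (V := R_NormedModule)); auto_derive.
apply: (@is_C1R_compR (fun t => sin (Im s * t)) (fun t => Im s * cos (Im s * t))) => // x.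
  by auto_derive => //; ring.
by apply: (ex_derive_continuous (V := R_NormedModule)); auto_derive.
Qed.

Lemma ifs_D1_neq0 (A : finType) (Phi : contracting_ifs A) a x : D1 (Phi a) x <> 0.
Proof.
have [g [g1 [c [c' [h1 h2 c0 _ h]]]]] := ifs_contracting Phi.
have [h3 _] := h 1%nat [tuple of [:: a]] x.
have e : word_map Phi [tuple of [:: a]] = Phi a by [].
move: h3; rewrite e => h3 h0; move: h3; rewrite h0 Rabs_R0.
have : 0 < c * / g1 ^ 1.
  by apply: Rmult_lt_0_compat => //; apply: Rinv_0_lt_compat; rewrite pow_1; lra.
lra.
Qed.

Lemma transfer_fun_C1 (A : finType) (Phi : contracting_ifs A) (p : A -> R) (s : C)
  (f : C1fun) : is_C1C (transfer_fun Phi p s f).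
Proof.
rewrite /transfer_fun; elim: (index_enum A) => [|a r IH].
  have -> : (fun x : I01 => \big[Cplus/RtoC 0]_(a <- [::])
     Cmult (Cmult (RtoC (p a)) (Rcpow (Rabs (D1 (Phi a) x)) s)) (f (Phi a x)))
     = fun=> RtoC 0 by apply: functional_extensionality => x; rewrite big_nil.
  exact: (is_C1_const (V := C_R_CompleteNormedModule)).
pose g x := Cmult (Cmult (RtoC (p a)) (Rcpow (Rabs (D1 (Phi a) x)) s)) (f (Phi a x)).
have -> : (fun x : I01 => \big[Cplus/RtoC 0]_(a <- a :: r)
   Cmult (Cmult (RtoC (p a)) (Rcpow (Rabs (D1 (Phi a) x)) s)) (f (Phi a x)))
   = fun x => Cplus (g x) (\big[Cplus/RtoC 0]_(a <- r)
   Cmult (Cmult (RtoC (p a)) (Rcpow (Rabs (D1 (Phi a) x)) s)) (f (Phi a x))).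
  by apply: functional_extensionality => x; rewrite big_cons.
apply: (is_C1_plus (V := C_R_CompleteNormedModule)) IH.
have [h1 h2] := ifs_C2 Phi a.
apply: is_C1C_mult.
  apply: is_C1C_mult; first exact: (is_C1_const (V := C_R_CompleteNormedModule)).
  by apply: is_C1C_Rcpow => // x; exact: ifs_D1_neq0.
exact: (is_C1_compI (V := C_R_CompleteNormedModule) (c1valP f)).
Qed.

Definition transfer (A : finType) (Phi : contracting_ifs A) (p : A -> R) (s : C)
  (f : C1fun) : C1fun := mkC1fun (transfer_fun_C1 Phi p s f).

(* Main.v *)
(* Dolgopyat's method. Write th_w = ln |phi_w'|, so that L_s^N f is a sum over words w of
   length N of p_w exp(s th_w) f o phi_w, and let P be the averaging operator L_0.
   A function f with |f'| of order |b| |f| is dominated by an envelope h that is log-Lipschitz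
   with constant of order |b|. By UNI the phases b th_u and b th_v of two suitable words rotate
   relative to each other at speed of order |b|, while f o phi_u and f o phi_v vary more slowly;
   so among any two points at distance of order 1/|b| near K the two branches cancel at one,
   and L_s^N f is dominated by an envelope h' with h'^2 <= P^N (h^2) everywhere and a definite
   loss near every such point (Cauchy-Schwarz).
   No stationary measure is needed. In P^j (h'^2)(x) = sum_w p_w h'^2(phi_w x) the words can be
   cut where |phi_w'| reaches 1/|b|; as K is not a point, each such cylinder has a subcylinder
   of comparable Bernoulli weight on which the loss occurs, whatever the overlaps. Hence
   P^j (h'^2) <= rho P^(j+N) (h^2) pointwise as soon as j is a large multiple of ln |b|.
   Iterating, |L_s^n f| <= P^j h <= (P^j h^2)^(1/2) decays geometrically, and the first
   ln |b| steps cost at most |b|^(1/2). The spectral bound is the Neumann series. *)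
Require Import Defs.
From mathcomp Require Import all_boot.
From Stdlib Require Import Reals.
From Coquelicot Require Import Coquelicot.
From HB Require Import structures.
From mathcomp Require Import zify.
From Stdlib Require Import Lra Lia FunctionalExtensionality Classical ClassicalEpsilon.
Local Open Scope R_scope.

(** * Calculus on the unit interval *)

(** Squares make the loss uniform. Cancellation removes only a fraction of the smaller of two
    branches, possibly a negligible part of P^N h. But shrinking one summand of weight at least q
    improves the constant in Cauchy-Schwarz by a fixed amount however h is distributed: when that
    summand is small compared with the others, the inequality is already far from sharp. The loss
    shows only after averaging for about ln |b| steps, and paying this at every application would
    ruin the rate. In P^j (h_(k+1)^2) <= rho P^(j+N) (h_k^2) the averaging exponent grows on the
    right, so all earlier applications find it large enough: the wait is paid once. The loss
    constants do not depend on N. Only afterwards is N taken so large that f o phi_u and f o phi_v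
    vary little against them, which is possible because the lower bound in UNI does not degrade with
    the length of the words. *)

Lemma clamp_subproof (t : R) : 0 <= Rmax 0 (Rmin 1 t) <= 1.
Proof.
split; first exact: Rmax_l.
by apply: Rmax_lub; [lra | exact: Rmin_l].
Qed.

(** Retraction of the line onto the interval: composing with it turns functions on [I01] into
    functions on the line, to which the mean value and Heine theorems apply. *)
Definition clamp (t : R) : I01 := mkI01 (clamp_subproof t).

Lemma clampE (t : R) : 0 <= t <= 1 -> ival (clamp t) = t.
Proof. by move=> ht; rewrite /clamp /= Rmin_right ?Rmax_right; lra. Qed.

Lemma clamp_ival (x : I01) : clamp x = x.
Proof. by apply: ival_inj; rewrite clampE //; exact: ivalP. Qed.

Lemma clamp_lipschitz (s t : R) : Rabs (clamp s - clamp t) <= Rabs (s - t).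
Proof.
rewrite /clamp /= /Rmin; do 2![case: Rle_dec => ?]; rewrite /Rmax.
all: by repeat case: Rle_dec => ?; rewrite /Rabs; repeat case: Rcase_abs => ?; lra.
Qed.

Lemma continuous_clamp (U : UniformSpace) (f : I01 -> U) (t : R) :
  (forall x, continuous f x) -> continuous (fun u => f (clamp u)) t.
Proof.
move=> cf; apply: (continuous_comp clamp f) => //.
apply: continuous_to_I01; apply/filterlim_locally => e; exists e => u hu.
exact: Rle_lt_trans (clamp_lipschitz _ _) hu.
Qed.

(** Interior points only: at 0 and 1 the extended function is constant on one side and may have no
    two-sided derivative. The mean value theorem asks for no more, given continuity. *)
Lemma is_derive01_clamp (f : I01 -> R) (x : I01) (l : R) : 0 < x < 1 ->
  is_derive01 (V := R_NormedModule) f x l -> is_derive (fun t => f (clamp t)) x l.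
Proof.
move=> hx hf.
apply/is_derive_Reals => e He.
have [d Hd] := proj1 (filterlim_locally _ _) hf (mkposreal e He).
have dP : 0 < Rmin d (Rmin x (1 - x)).
  by apply: Rmin_pos; [exact: cond_pos | apply: Rmin_pos; lra].
exists (mkposreal _ dP) => h h0 /= hh.
have h1 := Rlt_le_trans _ _ _ hh (Rmin_l _ _).
have h2 := Rlt_le_trans _ _ _ hh (Rle_trans _ _ _ (Rmin_r _ _) (Rmin_l _ _)).
have h3 := Rlt_le_trans _ _ _ hh (Rle_trans _ _ _ (Rmin_r _ _) (Rmin_r _ _)).
have hr : 0 <= x + h <= 1 by move: h2 h3; rewrite /Rabs; case: Rcase_abs => ? ? ?; lra.
have ec := clampE _ hr; rewrite clamp_ival.
have hb : ball x d (clamp (x + h)).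
  change (Rabs (clamp (x + h) - x) < d); rewrite ec.
  by have -> : x + h - x = h by ring.
have hn : clamp (x + h) <> x by move/(f_equal ival); rewrite ec => e3; apply: h0; lra.
have : Rabs (/ (clamp (x + h) - x) * (f (clamp (x + h)) - f x) - l) < e := Hd _ hb hn.
rewrite ec; have -> : x + h - x = h by ring.
by rewrite Rmult_comm.
Qed.

Lemma MVT01 (f df : I01 -> R) (x y : I01) :
  (forall z, is_derive01 (V := R_NormedModule) f z (df z)) ->
  exists2 z : I01, f y - f x = df z * (y - x) & Rmin x y <= z <= Rmax x y.
Proof.
move=> hf.
have hx := ivalP x; have hy := ivalP y.
have h01 t : Rmin x y <= t <= Rmax x y -> 0 <= t <= 1.
  by move: hx hy; rewrite /Rmin /Rmax; case: Rle_dec => ? ? ? ?; lra.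
have [|t _|c [hc e]] := MVT_gen (fun t => f (clamp t)) x y (fun t => df (clamp t)).
- move=> t ht; have ht' : 0 < t < 1.
    by move: ht hx hy; rewrite /Rmin /Rmax; case: Rle_dec => ? ? ? ?; lra.
  have {1}<- : ival (clamp t) = t by apply: clampE; lra.
  by apply: is_derive01_clamp; rewrite ?clampE //; lra.
- apply/continuity_pt_filterlim; apply: continuous_clamp => z.
  exact: is_derive01_continuous (hf z).
- by exists (clamp c); rewrite ?clampE; auto; rewrite -e !clamp_ival.
Qed.

Lemma is_derive01_scalR (a : R) (f : I01 -> R) (x : I01) (l : R) :
  is_derive01 (V := R_NormedModule) f x l ->
  is_derive01 (V := R_NormedModule) (fun y => a * f y) x (a * l).
Proof.
move=> hf; have := is_derive01_mult (is_derive01_const (V := R_NormedModule) a x) hf.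
by rewrite (_ : zero * f x + a * l = a * l) // /zero /=; ring.
Qed.

(** The mean value theorem fails for complex values, so it is applied to the component of [f] along
    the unit direction of [f x - f y], which sees the whole difference. *)
Lemma lipschitz_of_derivC (f : C1fun) (M : R) (x y : I01) :
  (forall z, Cmod (derivC f z) <= M) -> Cmod (f x - f y) <= M * Rabs (x - y).
Proof.
move=> hM.
set v := (f x - f y)%C.
have [->|v0] := Req_EM_T (Cmod v) 0.
  apply: Rmult_le_pos (Rabs_pos _).
  by apply: Rle_trans (hM I01_0); exact: Cmod_ge_0.
pose a := Re v / Cmod v; pose b := Im v / Cmod v.
have dg z : is_derive01 (V := R_NormedModule) (fun z => a * Re (f z) + b * Im (f z)) z
   (a * Re (derivC f z) + b * Im (derivC f z)).
  have [d1 d2] := proj1 (is_derive01_C _ _ _) (c1fun_deriv f z).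
  by apply: (is_derive01_plus (V := R_NormedModule)); exact: is_derive01_scalR.
have [z e _] := MVT01 _ _ y x dg.
have vP : 0 < Cmod v by have := Cmod_ge_0 v; lra.
have v2 : Cmod v * Cmod v = Re v * Re v + Im v * Im v.
  by rewrite /Cmod sqrt_sqrt /Re /Im; [ring | nra].
have e2 : Cmod v = a * Re (f x) + b * Im (f x) - (a * Re (f y) + b * Im (f y)).
  have -> : a * Re (f x) + b * Im (f x) - (a * Re (f y) + b * Im (f y))
    = (Re v * Re v + Im v * Im v) / Cmod v.
    rewrite /a /b /v /Re /Im /=; field; exact: v0.
  by rewrite -v2; field; lra.
rewrite e2 e.
apply: Rle_trans (Rle_abs _) _; rewrite Rabs_mult.
apply: Rmult_le_compat_r; first exact: Rabs_pos.
apply: Rle_trans (hM z).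
have ab : a * a + b * b = 1.
  rewrite /a /b; have -> : Re v / Cmod v * (Re v / Cmod v) + Im v / Cmod v * (Im v / Cmod v)
    = (Re v * Re v + Im v * Im v) / (Cmod v * Cmod v) by field; lra.
  by rewrite -v2; field; lra.
set p := Re _; set q := Im _.
rewrite -(sqrt_Rsqr_abs) /Cmod; apply: sqrt_le_1_alt.
rewrite -/(Re _) -/(Im _) -/p -/q /Rsqr.
have := Rle_0_sqr (a * q - b * p); rewrite /Rsqr; nra.
Qed.

(** Needed in local form because the modulus of continuity at hand is exponential, hence comparable
    to a linear one only at distances of order 1/|b|. *)
Lemma derivC_le_of_local_lipschitz (f : C1fun) (M d : R) (x : I01) : 0 < d ->
  (forall y : I01, Rabs (y - x) < d -> Cmod (f y - f x) <= M * Rabs (y - x)) ->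
  Cmod (derivC f x) <= M.
Proof.
move=> d0 hM.
have h := c1fun_deriv f x.
have h2 := filterlim_comp _ _ _ _ _ _ _ _ h (@continuous_Cmod (derivC f x)).
have := @filterlim_le _ (locally' x) _ _ (fun=> M) (Cmod (derivC f x)) M _ h2.
apply; last exact: filterlim_const.
  exists (mkposreal _ d0) => y hy ny.
  have nz : y - x <> 0 by move=> e; apply: ny; apply: ival_inj; lra.
  change (Cmod (scal (V := C_R_NormedModule) (/ (y - x)) (f y - f x)%C) <= M).
  have -> : scal (V := C_R_NormedModule) (/ (y - x)) (f y - f x)%C
     = (RtoC (/ (y - x)) * (f y - f x))%C.
    apply: injective_projections; rewrite /= /scal /= /mult /=; ring.
  rewrite Cmod_mult Cmod_R Rabs_inv.
  have hp := Rabs_pos_lt _ nz.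
  apply: (Rmult_le_reg_l (Rabs (y - x))) => //.
  rewrite -Rmult_assoc Rinv_r; last lra.
  by rewrite Rmult_1_l Rmult_comm; exact: hM.
Qed.

Lemma continuous01_bounded (g : I01 -> R) :
  (forall x, continuous g x) -> exists M : R, forall x, Rabs (g x) <= M.
Proof.
move=> cg; exists (sup_norm (fun x => RtoC (g x))) => x.
rewrite -Cmod_R; apply: (sup_norm_ub (f := fun x => RtoC (g x))) => y.
apply/continuous_C; split; [exact: cg | exact: continuous_const].
Qed.

Lemma continuous01_uniform (g : I01 -> R) (e : R) : 0 < e ->
  (forall x, continuous g x) ->
  exists2 d : R, 0 < d & forall x y : I01, Rabs (x - y) < d -> Rabs (g x - g y) < e.
Proof.
move=> e0 cg.
have [|d Hd] := @Heine_cor2 (fun t => g (clamp t)) 0 1 _ (mkposreal e e0).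
  by move=> t _; apply/continuity_pt_filterlim; exact: continuous_clamp.
exists d; first exact: cond_pos.
move=> x y hxy; have := Hd x y (ivalP x) (ivalP y) hxy; by rewrite !clamp_ival.
Qed.

Lemma finite_bound (A : finType) (F : A -> R -> Prop) :
  (forall a M M', M <= M' -> F a M -> F a M') -> (forall a, exists M, F a M) ->
  exists M, forall a, F a M.
Proof.
move=> mono hF.
have [M hM] : exists M, forall a, a \in enum A -> F a M.
  elim: (enum A) => [|a l [M IH]]; first by exists 0.
  have [M' hM'] := hF a; exists (Rmax M M') => b; rewrite inE => /orP [/eqP ->|hb].
    by apply: mono hM'; exact: Rmax_r.
  by apply: mono (IH b hb); exact: Rmax_l.
by exists M => a; apply: hM; rewrite mem_enum.
Qed.

(** [chi] is the minimum of 1 and [L] times the distance to the complement of [G]. Taking the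
    infimum over a set that contains 1 covers an empty complement as well. *)
Lemma lipschitz_cutoff (G : I01 -> Prop) (L : R) : 0 < L ->
  exists chi : I01 -> R,
    [/\ forall x, 0 <= chi x <= 1, forall x, ~ G x -> chi x = 0,
      forall x y : I01, chi x <= chi y + L * Rabs (x - y)
    & forall x : I01, (forall y : I01, L * Rabs (x - y) < 1 -> G y) -> chi x = 1].
Proof.
move=> L0.
pose S (x : I01) t := t = 1 \/ exists2 y : I01, ~ G y & t = L * Rabs (x - y).
have S0 x t : S x t -> 0 <= t.
  case=> [->|[y _ ->]]; first lra.
  by have := Rabs_pos (x - y); nra.
have [chi hchi] : exists chi : I01 -> R, forall x, is_glb_Rbar (S x) (chi x).
  exists (fun x => real (Glb_Rbar (S x))) => x.
  have := Glb_Rbar_correct (S x); case: (Glb_Rbar _) => [g|[h1 h2]|[h1 h2]] //.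
    by have := h1 1 (or_introl erefl).
  by have /= := h2 (Finite 0) (S0 x).
have lb x t : S x t -> chi x <= t by have [h _] := hchi x; exact: h.
have gt x m : (forall t, S x t -> m <= t) -> m <= chi x.
  by have [_ h] := hchi x => hm; exact: (h (Finite m)).
exists chi; split.
- by move=> x; split; [apply: gt; exact: S0 | apply: lb; left].
- move=> x nG; apply: Rle_antisym; last by apply: gt; exact: S0.
  by apply: lb; right; exists x => //; rewrite Rminus_diag Rabs_R0; ring.
- move=> x y; suff : chi x - L * Rabs (x - y) <= chi y by lra.
  have xy := Rabs_pos (x - y).
  apply: gt => t [->|[z hz ->]].
    by have := lb x 1 (or_introl erefl); nra.
  have := lb x _ (or_intror (ex_intro2 _ _ z hz erefl)).
  have : Rabs (x - z) <= Rabs (x - y) + Rabs (y - z).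
    by have := Rabs_triang (x - y) (y - z); have -> : x - y + (y - z) = x - z by ring.
  by nra.
- move=> x hG; apply: Rle_antisym; first by apply: lb; left.
  apply: gt => t [->|[y hy ->]]; first lra.
  by apply: Rnot_lt_le => /hG.
Qed.

(** * Cancellation of two complex numbers *)

Lemma exp_ge1 (x : R) : 0 <= x -> 1 <= exp x.
Proof. by move=> ?; have := exp_ineq1_le x; lra. Qed.

Lemma exp_le (x y : R) : x <= y -> exp x <= exp y.
Proof. by case=> [/exp_increasing|->]; lra. Qed.

(** Two moduli of continuity of the form exp (e t) - 1 merge into one whose exponents add, which is
    why differences are measured by such moduli. *)
Lemma expm1_plus (x y : R) : 0 <= x -> 0 <= y ->
  (exp x - 1) + (exp y - 1) <= exp (x + y) - 1.
Proof. move=> /exp_ge1 hx /exp_ge1 hy; rewrite exp_plus; nra. Qed.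

Lemma expm1_le2 (x : R) : 0 <= x <= 1 / 2 -> exp x - 1 <= 2 * x.
Proof.
move=> hx; have := exp_ineq1_le (- x); rewrite exp_Ropp => h.
have e0 := exp_pos x.
have : (1 - x) * exp x <= 1.
  have e1 : / exp x * exp x = 1 by field; lra.
  by rewrite -[X in _ <= X]e1; apply: Rmult_le_compat_r; lra.
move: (exp x) e0 {h} => E E0 h.
suff : 0 <= (1 + 2 * x - E) * (1 - x) by move=> ?; nra.
nra.
Qed.

Definition cis (t : R) : C := (cos t, sin t).

Lemma cis_plus (x y : R) : cis (x + y) = (cis x * cis y)%C.
Proof.
rewrite /cis cos_plus sin_plus.
by apply: injective_projections; rewrite /=; ring.
Qed.

Lemma Cmod_cis (t : R) : Cmod (cis t) = 1.
Proof.
rewrite /Cmod /cis /=; have := sin2_cos2 t; rewrite /Rsqr => h.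
have -> : cos t * (cos t * 1) + sin t * (sin t * 1) = 1 by lra.
exact: sqrt_1.
Qed.

Lemma Cmod_cis_sub1 (t : R) : Cmod (cis t - 1) = 2 * Rabs (sin (t / 2)).
Proof.
have [u ->] : exists u, t = 2 * u by exists (t / 2); field.
have -> : 2 * u / 2 = u by field.
rewrite /Cmod /cis /= cos_2a sin_2a.
have := sin2_cos2 u; rewrite /Rsqr; set c := cos _; set d := sin _ => h.
have -> : (c * c - d * d + - (1)) * ((c * c - d * d + - (1)) * 1) +
  (2 * d * c + -0) * ((2 * d * c + -0) * 1) = Rsqr (2 * d).
  rewrite /Rsqr; have -> : c * c = 1 - d * d by lra.
  have -> : (2 * d * c + - 0) * ((2 * d * c + -0) * 1) = 4 * (d * d) * (c * c) by ring.
  have -> : c * c = 1 - d * d by lra.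
  by ring.
by rewrite sqrt_Rsqr_abs Rabs_mult Rabs_pos_eq //; lra.
Qed.

Lemma Cmod_cis_sub1_le (t : R) : Cmod (cis t - 1) <= Rabs t.
Proof.
rewrite Cmod_cis_sub1.
have h : forall x, 0 <= x -> Rabs (sin x) <= x.
  move=> x hx.
  have [z [hz e]] := MVT_gen sin 0 x cos
    (fun x _ => is_derive_sin x) (fun x _ => continuity_sin x).
  move: e; rewrite sin_0 !Rminus_0_r => ->; rewrite Rabs_mult (Rabs_pos_eq x) //.
  have : Rabs (cos z) <= 1 by apply: Rabs_le; have := COS_bound z; lra.
  by move=> ?; nra.
have [t0|t0] := Rle_dec 0 t.
  by have := h (t / 2); rewrite (Rabs_pos_eq t) //; lra.
have -> : t / 2 = - (- t / 2) by field.
rewrite sin_neg Rabs_Ropp (Rabs_left t); last lra.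
by have := h (- t / 2); lra.
Qed.

Lemma Cmod_cis_sub1_ge (t : R) : Rabs t <= 1 -> Rabs t / 2 <= Cmod (cis t - 1).
Proof.
move=> ht; rewrite Cmod_cis_sub1.
have h : forall x, 0 <= x <= 1 / 2 -> x / 2 <= Rabs (sin x).
  move=> x hx.
  have [z [hz e]] := MVT_gen sin 0 x cos
    (fun x _ => is_derive_sin x) (fun x _ => continuity_sin x).
  move: e; rewrite sin_0 !Rminus_0_r => ->; rewrite Rabs_mult (Rabs_pos_eq x); last lra.
  have : 1 / 2 <= cos z.
    rewrite -cos_PI3; have h3 := PI2_3_2; apply: cos_decr_1.
    - by move: hz; rewrite Rmin_left; lra.
    - by move: hz; rewrite Rmax_right; lra.
    - lra.
    - lra.
    - by move: hz; rewrite Rmax_right; lra.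
  by move=> hc; have := Rle_abs (cos z); nra.
move: ht; have [t0|t0] := Rle_dec 0 t.
  by rewrite (Rabs_pos_eq t) // => ?; have := h (t / 2); lra.
have -> : t / 2 = - (- t / 2) by field.
rewrite sin_neg Rabs_Ropp (Rabs_left t); last lra.
by move=> ?; have := h (- t / 2); lra.
Qed.

(** This is exp (s t). At t = ln u it unfolds to [Rcpow u s], so powers of derivatives become
    characters of the additive cocycle [thword]. *)
Definition cpow (s : C) (t : R) : C := (RtoC (exp (Re s * t)) * cis (Im s * t))%C.

Lemma cpow_plus (s : C) (x y : R) : cpow s (x + y) = (cpow s x * cpow s y)%C.
Proof.
rewrite /cpow !Rmult_plus_distr_l exp_plus cis_plus RtoC_mult; ring.
Qed.

Lemma cpow0 (s : C) : cpow s 0 = 1.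
Proof.
by rewrite /cpow !Rmult_0_r exp_0 /cis cos_0 sin_0 Cmult_1_l.
Qed.

Lemma Cmod_cpow (s : C) (t : R) : Cmod (cpow s t) = exp (Re s * t).
Proof.
by rewrite Cmod_mult Cmod_cis Cmod_R Rmult_1_r Rabs_pos_eq //; left; exact: exp_pos.
Qed.

(** Modulus and phase vary at rates |Re s| and |Im s|; both are charged to |Im s|, whence the factor
    2. *)
Lemma Cmod_cpow_sub1 (s : C) (t : R) : Rabs (Re s) <= Rabs (Im s) ->
  Cmod (cpow s t - 1) <= exp (2 * Rabs (Im s) * Rabs t) - 1.
Proof.
move=> hs.
have -> : (cpow s t - 1)%C = (RtoC (exp (Re s * t) - 1) * cis (Im s * t)
    + (cis (Im s * t) - 1))%C by rewrite /cpow RtoC_minus; ring.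
apply: Rle_trans (Cmod_triangle _ _) _.
rewrite Cmod_mult Cmod_cis Rmult_1_r Cmod_R.
have h1 := Cmod_cis_sub1_le (Im s * t).
have h2 : Rabs (exp (Re s * t) - 1) <= exp (Rabs (Re s * t)) - 1.
  have p := Rle_abs (Re s * t); have q := exp_ineq1_le (Re s * t).
  have q' := exp_ineq1_le (Rabs (Re s * t)).
  have := exp_le _ _ p; rewrite /Rabs in q' *; move: q'; do 2![case: Rcase_abs => ?]; lra.
have h3 := exp_ineq1_le (Rabs (Im s * t)).
have h4 := expm1_plus _ _ (Rabs_pos (Re s * t)) (Rabs_pos (Im s * t)).
have : exp (Rabs (Re s * t) + Rabs (Im s * t)) <= exp (2 * Rabs (Im s) * Rabs t).
  by apply: exp_le; rewrite !Rabs_mult; have := Rabs_pos t; nra.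
lra.
Qed.

Definition dir (z : C) : C := (RtoC (/ Cmod z) * z)%C.

Lemma Cmod_dir (z : C) : 0 < Cmod z -> Cmod (dir z) = 1.
Proof.
move=> h; rewrite /dir Cmod_mult Cmod_R Rabs_inv Rabs_pos_eq; last lra.
by field; lra.
Qed.

Lemma dir_mul (r : R) (w z : C) : 0 < r -> Cmod w = 1 ->
  dir (RtoC r * w * z) = (w * dir z)%C.
Proof.
move=> r0 w1; rewrite /dir !Cmod_mult w1 Cmod_R Rabs_pos_eq ?Rmult_1_r; last lra.
rewrite Rinv_mult RtoC_mult.
have e : (RtoC (/ r) * RtoC r)%C = 1 by rewrite -RtoC_mult Rinv_l //; lra.
transitivity ((RtoC (/ r) * RtoC r) * (w * (RtoC (/ Cmod z) * z)))%C; first ring.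
by rewrite e Cmult_1_l.
Qed.

Lemma dir_dist (a c : C) : 0 < Cmod a -> 0 < Cmod c ->
  Cmod a * Cmod (dir a - dir c) <= 2 * Cmod (a - c).
Proof.
move=> a0 c0.
have -> : Cmod a * Cmod (dir a - dir c) = Cmod (RtoC (Cmod a) * (dir a - dir c)).
  by rewrite Cmod_mult Cmod_R Rabs_pos_eq //; lra.
have -> : (RtoC (Cmod a) * (dir a - dir c) = (a - c) + RtoC (1 - Cmod a / Cmod c) * c)%C.
  rewrite /dir RtoC_minus RtoC_mult.
  have e : (RtoC (Cmod a) * RtoC (/ Cmod a))%C = 1 by rewrite -RtoC_mult Rinv_r //; lra.
  transitivity ((RtoC (Cmod a) * RtoC (/ Cmod a)) * a -
     RtoC (Cmod a) * RtoC (/ Cmod c) * c)%C; first ring.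
  by rewrite e; ring.
apply: Rle_trans (Cmod_triangle _ _) _.
have -> : Cmod (RtoC (1 - Cmod a / Cmod c) * c) = Rabs (Cmod c - Cmod a).
  rewrite Cmod_mult Cmod_R -{2}(Rabs_pos_eq (Cmod c)); last lra.
  by rewrite -Rabs_mult; congr Rabs; field; lra.
have := Cmod_triangle (a - c) c; have := Cmod_triangle (c - a) a.
have -> : (a - c + c = a)%C by ring.
have -> : (c - a + a = c)%C by ring.
have -> : (c - a)%C = Copp (a - c)%C by ring.
rewrite Cmod_opp => h1 h2.
have : Rabs (Cmod c - Cmod a) <= Cmod (a - c) by apply: Rabs_le; lra.
lra.
Qed.

(** The law of cosines: the defect in the triangle inequality is governed by the angle between the
    two numbers. *)
Lemma Cmod_plus_dir (F G : C) : 0 < Cmod F -> 0 < Cmod G ->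
  (Cmod F + Cmod G) ^ 2 - Cmod (F + G) ^ 2
    = Cmod F * Cmod G * Cmod (dir F - dir G) ^ 2.
Proof.
move=> f0 g0.
have sq z : Cmod z ^ 2 = Re z * Re z + Im z * Im z.
  rewrite /Cmod -Rsqr_pow2 Rsqr_sqrt /Re /Im; [ring | nra].
have hF := sq F; have hG := sq G.
rewrite !sq /dir.
move: hF hG f0 g0; move: (Cmod F) (Cmod G) => x y; case: F => a b; case: G => c d.
rewrite /Re /Im /= => hx hy x0 y0.
have -> : x * y * ((/ x * a - 0 * b + - (/ y * c - 0 * d))
     * (/ x * a - 0 * b + - (/ y * c - 0 * d)) +
   (/ x * b + 0 * a + - (/ y * d + 0 * c)) * (/ x * b + 0 * a + - (/ y * d + 0 * c)))
  = y / x * (a * a + b * b) + x / y * (c * c + d * d) - 2 * (a * c + b * d).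
  by field; lra.
rewrite -hx -hy; field_simplify; [|lra..].
have -> : x ^ 2 = a * a + b * b by rewrite -hx; ring.
have -> : y ^ 2 = c * c + d * d by rewrite -hy; ring.
ring.
Qed.

(** A loss below [eta * Rmin P Q] leaves each number at least half of its own bound, and
    [Cmod_plus_dir] then bounds the angle. The minimum is the right unit, since a tiny branch cannot
    cancel more than its own size. *)
Lemma aligned_of_no_cancellation (F G : C) (P Q eta : R) : 0 < eta <= 1 / 2 ->
  Cmod F <= P -> Cmod G <= Q -> P + Q - eta * Rmin P Q < Cmod (F + G) ->
  [/\ 0 < P, 0 < Q, P / 2 <= Cmod F, Q / 2 <= Cmod G & Cmod (dir F - dir G) ^ 2 <= 8 * eta].
Proof.
move=> he hF hG h.
have tri := Cmod_triangle F G.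
have m1 := Rmin_l P Q; have m2 := Rmin_r P Q.
have f0 := Cmod_ge_0 F; have g0 := Cmod_ge_0 G.
have m0 : 0 <= Rmin P Q by apply: Rmin_glb; lra.
have P0 : 0 < P by case: (Req_dec (Rmin P Q) 0) => ?; nra.
have Q0 : 0 < Q by case: (Req_dec (Rmin P Q) 0) => ?; nra.
have hF2 : P / 2 <= Cmod F by nra.
have hG2 : Q / 2 <= Cmod G by nra.
have F0 : 0 < Cmod F by lra.
have G0 : 0 < Cmod G by lra.
split => //.
have e := Cmod_plus_dir F G F0 G0.
have FG := Rmult_lt_0_compat _ _ F0 G0.
apply: (Rmult_le_reg_l (Cmod F * Cmod G)) => //; rewrite -e.
move: F0 G0 FG tri h hF2 hG2 {e f0 g0}.
set x := Cmod F in hF *; set y := Cmod G in hG *; set z := Cmod (F + G).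
move=> x0 y0 xy tri h hx hy.
have d1 : 0 <= x + y - z <= eta * Rmin P Q by lra.
have mm : Rmin P Q * (x + y) <= 4 * (x * y).
  have [?|?] := Rle_dec x y; nra.
have : (x + y) ^ 2 - z ^ 2 <= (x + y - z) * (2 * (x + y)) by nra.
have : (x + y - z) * (2 * (x + y)) <= (eta * Rmin P Q) * (2 * (x + y)).
  by apply: Rmult_le_compat_r; lra.
nra.
Qed.

(** Only the relative phases matter, a common rotation being divisible out. Alignment at both points
    forces a change of relative phase to be compensated by the directions themselves. The bound 1
    excludes full turns, which would restore alignment. *)
Lemma phase_rotation_le (a1 a2 c1 c2 : C) (x1 x2 y1 y2 sg : R) :
  0 < Cmod a1 -> 0 < Cmod a2 -> 0 < Cmod c1 -> 0 < Cmod c2 ->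
  Cmod (cis x1 * dir a1 - cis y1 * dir c1) <= sg ->
  Cmod (cis x2 * dir a2 - cis y2 * dir c2) <= sg ->
  Rabs ((x1 - y1) - (x2 - y2)) <= 1 ->
  Rabs ((x1 - y1) - (x2 - y2)) / 2
    <= 2 * sg + Cmod (dir a1 - dir a2) + Cmod (dir c1 - dir c2).
Proof.
move=> a10 a20 c10 c20 h1 h2 /Cmod_cis_sub1_ge h; apply: Rle_trans h _.
have rot x y u v : Cmod (cis x * u - cis y * v) = Cmod (cis (x - y) * u - v).
  have -> : (cis x * u - cis y * v = cis y * (cis (x - y) * u - v))%C.
    have {1}-> : x = y + (x - y) by ring.
    by rewrite cis_plus; ring.
  by rewrite Cmod_mult Cmod_cis Rmult_1_l.
move: h1 h2; rewrite !rot; set p := x1 - y1; set q := x2 - y2 => h1 h2.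
have -> : Cmod (cis (p - q) - 1) = Cmod ((cis p - cis q) * dir a1).
  have -> : ((cis p - cis q) * dir a1 = (cis q * dir a1) * (cis (p - q) - 1))%C.
    have {1}-> : p = q + (p - q) by ring.
    by rewrite cis_plus; ring.
  by rewrite Cmod_mult (Cmod_mult (cis q)) Cmod_cis Cmod_dir // !Rmult_1_l.
have -> : ((cis p - cis q) * dir a1 = (cis p * dir a1 - dir c1) + (dir c1 - dir c2)
   + (dir c2 - cis q * dir a2) + cis q * (dir a2 - dir a1))%C by ring.
have -> : (dir c2 - cis q * dir a2)%C = Copp (cis q * dir a2 - dir c2)%C by ring.
have -> : (dir a2 - dir a1)%C = Copp (dir a1 - dir a2)%C by ring.
set X := (cis p * dir a1 - dir c1)%C; set Y := (dir c1 - dir c2)%C.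
set Z := Copp (cis q * dir a2 - dir c2)%C; set T := (cis q * _)%C.
have t1 := Cmod_triangle (X + Y + Z) T; have t2 := Cmod_triangle (X + Y) Z.
have t3 := Cmod_triangle X Y.
have e1 : Cmod T = Cmod (dir a1 - dir a2) by rewrite Cmod_mult Cmod_cis Cmod_opp Rmult_1_l.
have e2 : Cmod Z = Cmod (cis q * dir a2 - dir c2) by rewrite Cmod_opp.
by rewrite -/X in h1; lra.
Qed.

(** * Words and the averaging operator *)

Lemma RplusA : associative Rplus. Proof. by move=> x y z; ring. Qed.
HB.instance Definition _ := Monoid.isComLaw.Build R 0 Rplus RplusA Rplus_comm Rplus_0_l.
HB.instance Definition _ := Monoid.isMulLaw.Build R 0 Rmult Rmult_0_l Rmult_0_r.
HB.instance Definition _ := Monoid.isAddLaw.Build R Rmult Rplus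
  Rmult_plus_distr_r Rmult_plus_distr_l.
HB.instance Definition _ :=
  Monoid.isComLaw.Build C (RtoC 0) Cplus Cplus_assoc Cplus_comm Cplus_0_l.
HB.instance Definition _ := Monoid.isMulLaw.Build C (RtoC 0) Cmult Cmult_0_l Cmult_0_r.
HB.instance Definition _ := Monoid.isAddLaw.Build C Cmult Cplus
  Cmult_plus_distr_r Cmult_plus_distr_l.

Notation "'\sumR_' ( i <- r ) F" := (\big[Rplus/0]_(i <- r) F)
  (at level 41, F at level 41, i, r at level 50).

Lemma sumR_le (I : eqType) (r : seq I) (F G : I -> R) :
  {in r, forall i, F i <= G i} -> \sumR_(i <- r) F i <= \sumR_(i <- r) G i.
Proof.
elim: r => [|i r IH] h; rewrite ?big_nil ?big_cons; first lra.
apply: Rplus_le_compat; first by apply: h; rewrite inE eqxx.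
by apply: IH => j hj; apply: h; rewrite inE hj orbT.
Qed.

Lemma sumR_ge0 (I : eqType) (r : seq I) (F : I -> R) :
  {in r, forall i, 0 <= F i} -> 0 <= \sumR_(i <- r) F i.
Proof.
by move=> h; have := sumR_le _ r (fun=> 0) F h; rewrite big1_eq.
Qed.

Lemma Cmod_sum_le (I : eqType) (r : seq I) (F : I -> C) (G : I -> R) :
  {in r, forall i, Cmod (F i) <= G i} ->
  Cmod (\big[Cplus/RtoC 0]_(i <- r) F i) <= \sumR_(i <- r) G i.
Proof.
elim: r => [|i r IH] h; rewrite ?big_nil ?big_cons; first by rewrite Cmod_0; lra.
apply: Rle_trans (Cmod_triangle _ _) _.
apply: Rplus_le_compat; first by apply: h; rewrite inE eqxx.
by apply: IH => j hj; apply: h; rewrite inE hj orbT.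
Qed.

Lemma csum_sub (I : Type) (r : seq I) (F G : I -> C) :
  (\big[Cplus/RtoC 0]_(i <- r) F i - \big[Cplus/RtoC 0]_(i <- r) G i)%C
   = \big[Cplus/RtoC 0]_(i <- r) (F i - G i)%C.
Proof. by elim: r => [|i r IH]; rewrite ?big_nil ?big_cons -?IH; ring. Qed.

(** Inductive step of the weighted Cauchy-Schwarz inequality with a coefficient [b] on the new term:
    [b] = 1 gives the usual inequality, [b] < 1 records the gain from shrinking one summand. *)
Lemma cauchy_schwarz_step (X S V q a b : R) : 0 <= S -> 0 <= V -> 0 <= q ->
  X ^ 2 <= S * V -> (X + q * b * a) ^ 2 <= (S + q * (b * b)) * (V + q * (a * a)).
Proof.
move=> s0 v0 q0 h.
have h1 : 2 * X * (b * a) <= S * (a * a) + (b * b) * V.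
  have [e|ne] := Req_dec S 0.
    have X0 : X = 0 by have : X ^ 2 <= 0 by [rewrite e in h; lra]; nra.
    by rewrite e X0; nra.
  have sP : 0 < S by lra.
  apply: (Rmult_le_reg_l S) => //.
  have := Rle_0_sqr (S * a - b * X); rewrite /Rsqr => h2.
  have := Rmult_le_compat_l _ _ _ (Rle_0_sqr b) h; rewrite /Rsqr => h3.
  nra.
have := Rmult_le_compat_l _ _ _ q0 h1; nra.
Qed.

Lemma sumR_sqr_le (I : eqType) (r : seq I) (p g : I -> R) : {in r, forall i, 0 <= p i} ->
  (\sumR_(i <- r) (p i * g i)) ^ 2
    <= (\sumR_(i <- r) p i) * \sumR_(i <- r) (p i * (g i * g i)).
Proof.
elim: r => [|i r IH] h; rewrite ?big_nil ?big_cons; first lra.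
have hp : 0 <= p i by apply: h; rewrite inE eqxx.
have h' : {in r, forall i, 0 <= p i} by move=> j hj; apply: h; rewrite inE hj orbT.
have v0 : 0 <= \sumR_(i <- r) (p i * (g i * g i)).
  by apply: sumR_ge0 => j hj; have := h' j hj; nra.
have := cauchy_schwarz_step _ _ _ _ (g i) 1 (sumR_ge0 _ r p h') v0 hp (IH h').
by rewrite !Rmult_1_r !(Rplus_comm (p i)) !(Rplus_comm (p i * _)).
Qed.

Section Words.
Variables (A : finType) (phi : A -> I01 -> I01) (p : A -> R) (th : A -> I01 -> R).

Fixpoint words (n : nat) : seq (seq A) :=
  if n is n'.+1 then [seq a :: w | a <- index_enum A, w <- words n'] else [:: [::]].

Definition pword (w : seq A) : R := foldr (fun a => Rmult (p a)) 1 w.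

Fixpoint thword (w : seq A) (x : I01) : R :=
  if w is a :: w' then th a (word_map phi w' x) + thword w' x else 0.

Definition markov (g : I01 -> R) (x : I01) : R :=
  \sumR_(a <- index_enum A) (p a * g (phi a x)).

Definition weighted (s : C) (f : I01 -> C) (x : I01) : C :=
  \big[Cplus/RtoC 0]_(a <- index_enum A) (RtoC (p a) * cpow s (th a x) * f (phi a x))%C.

Lemma mem_words (n : nat) (w : seq A) : (w \in words n) = (size w == n).
Proof.
elim: n w => [|n IH] w /=; first by rewrite inE; case: w.
case: w => [|a w] /=.
  by apply/negP => /allpairsP [[a w] [_ _]].
apply/allpairsP/eqP.
  by move=> [[b v] [_ /= hv [_ ->]]]; move: hv; rewrite IH => /eqP ->.
by move=> [hw]; exists (a, w); split => //=; rewrite ?mem_index_enum // IH hw.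
Qed.

Lemma word_map_cat (u v : seq A) (x : I01) :
  word_map phi (u ++ v) x = word_map phi u (word_map phi v x).
Proof. by elim: u => //= a u ->. Qed.

Lemma thword_cat (u v : seq A) (x : I01) :
  thword (u ++ v) x = thword u (word_map phi v x) + thword v x.
Proof. by elim: u => [|a u /= ->]; rewrite ?word_map_cat /=; ring. Qed.

Lemma iter_markov (n : nat) (g : I01 -> R) (x : I01) :
  iter n markov g x = \sumR_(w <- words n) (pword w * g (word_map phi w x)).
Proof.
elim: n g x => [|n IH] g x; first by rewrite big_seq1 /=; ring.
rewrite iterSr IH /= big_allpairs_dep exchange_big /=.
apply: eq_bigr => w _; rewrite /markov big_distrr /=.
by apply: eq_bigr => a _; ring.
Qed.

Lemma iter_weighted (s : C) (n : nat) (f : I01 -> C) (x : I01) :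
  iter n (weighted s) f x = \big[Cplus/RtoC 0]_(w <- words n)
     (RtoC (pword w) * cpow s (thword w x) * f (word_map phi w x))%C.
Proof.
elim: n f x => [|n IH] f x; first by rewrite big_seq1 /= cpow0; ring.
rewrite iterSr IH /= big_allpairs_dep exchange_big /=.
apply: eq_bigr => w _; rewrite /weighted big_distrr /=.
by apply: eq_bigr => a _; rewrite cpow_plus RtoC_mult; ring.
Qed.

(** Splits the cylinder of [w] into those of its one-letter extensions, the recursion along which
    words are later cut. *)
Lemma iter_markov_comp (n : nat) (g : I01 -> R) (w : seq A) (x : I01) :
  iter n.+1 markov (fun y => g (word_map phi w y)) x =
  \sumR_(a <- index_enum A)
     (p a * iter n markov (fun y => g (word_map phi (rcons w a) y)) x).
Proof.
rewrite iterSr iter_markov.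
transitivity (\sumR_(v <- words n) \sumR_(a <- index_enum A)
   (p a * (pword v * g (word_map phi (rcons w a) (word_map phi v x))))).
  apply: eq_bigr => v _; rewrite /markov big_distrr /=.
  by apply: eq_bigr => a _; rewrite -cats1 word_map_cat /=; ring.
rewrite exchange_big /=; apply: eq_bigr => a _.
by rewrite iter_markov big_distrr.
Qed.

Hypothesis p_pos : forall a, 0 < p a.
Hypothesis p_sum : \sumR_(a <- index_enum A) p a = 1.

Lemma pword_gt0 (w : seq A) : 0 < pword w.
Proof. by elim: w => [|a w IH] /=; [lra | apply: Rmult_lt_0_compat]. Qed.

Lemma sum_pword (n : nat) : \sumR_(w <- words n) pword w = 1.
Proof.
elim: n => [|n IH]; first by rewrite big_seq1.
rewrite /= big_allpairs_dep /= -[RHS]p_sum; apply: eq_bigr => a _.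
by rewrite -big_distrr /= IH; ring.
Qed.

Lemma pword_lower : exists2 q : R, 0 < q <= 1 & forall w, q ^ size w <= pword w.
Proof.
have [M hM] : exists M : R, forall a, 1 / p a <= M.
  apply: finite_bound; first by move=> a M M' h1 h2; lra.
  by move=> a; exists (1 / p a); lra.
exists (/ Rmax M 1).
  have := Rmax_r M 1 => h; split; first by apply: Rinv_0_lt_compat; lra.
  by rewrite -[X in _ <= X]Rinv_1; apply: Rinv_le_contravar; lra.
have h1 : forall a, 0 <= / Rmax M 1 <= p a.
  move=> a; have h := Rmax_r M 1; have h2 := Rle_trans _ _ _ (hM a) (Rmax_l M 1).
  split; first by left; apply: Rinv_0_lt_compat; lra.
  have pa := p_pos a.
  rewrite -(Rinv_inv (p a)); apply: Rinv_le_contravar; last lra.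
  exact: Rinv_0_lt_compat.
elim=> [|a w IH] /=; first lra.
apply: Rmult_le_compat => //; [exact: proj1 (h1 a) | | exact: proj2 (h1 a)].
exact: pow_le (proj1 (h1 a)).
Qed.

Lemma iter_markov_le (n : nat) (g g' : I01 -> R) (x : I01) :
  (forall y, g y <= g' y) -> iter n markov g x <= iter n markov g' x.
Proof.
move=> h; rewrite !iter_markov; apply: sumR_le => w _.
by apply: Rmult_le_compat_l => //; left; exact: pword_gt0.
Qed.

Lemma iter_markov_ge0 (n : nat) (g : I01 -> R) (x : I01) :
  (forall y, 0 <= g y) -> 0 <= iter n markov g x.
Proof.
move=> h; rewrite iter_markov; apply: sumR_ge0 => w _.
by apply: Rmult_le_pos => //; left; exact: pword_gt0.
Qed.

Lemma iter_markov_const (n : nat) (c : R) (x : I01) : iter n markov (fun=> c) x = c.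
Proof. by rewrite iter_markov -big_distrl /= sum_pword; ring. Qed.

Lemma iter_markov_scal (n : nat) (c : R) (g : I01 -> R) (x : I01) :
  iter n markov (fun y => c * g y) x = c * iter n markov g x.
Proof.
by rewrite !iter_markov big_distrr /=; apply: eq_bigr => w _; ring.
Qed.

Lemma iter_markov_plus (n : nat) (g h : I01 -> R) (x : I01) :
  iter n markov (fun y => g y + h y) x = iter n markov g x + iter n markov h x.
Proof.
by rewrite !iter_markov -big_split /=; apply: eq_bigr => w _; ring.
Qed.

Lemma iter_markov_sqr (n : nat) (g : I01 -> R) (x : I01) :
  iter n markov g x ^ 2 <= iter n markov (fun y => g y * g y) x.
Proof.
rewrite !iter_markov; apply: Rle_trans (sumR_sqr_le _ _ _ _ _) _.
  by move=> w _; left; exact: pword_gt0.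
by rewrite sum_pword Rmult_1_l; right.
Qed.

End Words.

(** * Contraction of envelopes *)

(* Integrating |f'| <= e h against [dom_log_lipschitz] gives [dom_sub], which makes sense
   without derivatives and is what the argument uses. *)
Record dominated (e : R) (f : I01 -> C) (h : I01 -> R) : Prop := Dominated {
  dom_ge0 : forall x, 0 <= h x;
  dom_le : forall x, Cmod (f x) <= h x;
  dom_log_lipschitz : forall x y : I01, h x <= exp (e * Rabs (x - y)) * h y;
  dom_sub : forall x y : I01, Cmod (f x - f y) <= h x * (exp (e * Rabs (x - y)) - 1) }.

Section System.
Variables (A : finType) (phi : A -> I01 -> I01) (p : A -> R) (th : A -> I01 -> R).
Hypothesis p_pos : forall a, 0 < p a.
Hypothesis p_sum : \sumR_(a <- index_enum A) p a = 1.
Variables (D kap c gam : R).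
Hypothesis D_ge1 : 1 <= D.
Hypothesis kap_gt0 : 0 < kap.
Hypothesis c_gt0 : 0 < c.
Hypothesis gam_gt1 : 1 < gam.
Hypothesis th_bound : forall a x, Rabs (th a x) <= kap.

Notation "'phiw'" := (word_map phi).
Notation "'thw'" := (thword A phi th).
Notation "'pw'" := (pword A p).
Notation "'M'" := (markov A phi p).
Notation "'T'" := (weighted A phi p th).

(** Bounded distortion, the mean value theorem and contraction for word maps: these replace
    differentiability of the system throughout the section. *)
Hypothesis thw_lipschitz : forall w (x y : I01), Rabs (thw w x - thw w y) <= D * Rabs (x - y).
Hypothesis phiw_mvt : forall w (x y : I01),
  exists z : I01, Rabs (phiw w x - phiw w y) = exp (thw w z) * Rabs (x - y).
Hypothesis thw_contracting : forall w x, exp (thw w x) <= c * / gam ^ size w.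

(** The size of the cylinder of [w] up to a factor exp D, by bounded distortion; the base point is
    arbitrary. *)
Definition scale (w : seq A) : R := exp (thw w I01_0).

Lemma I01_dist (x y : I01) : Rabs (x - y) <= 1.
Proof. by have := ivalP x; have := ivalP y => ? ?; apply: Rabs_le; lra. Qed.

Lemma scale_gt0 (w : seq A) : 0 < scale w.
Proof. exact: exp_pos. Qed.

Lemma exp_thw_scale (w : seq A) (x : I01) :
  exp (- D) * scale w <= exp (thw w x) <= exp D * scale w.
Proof.
have := thw_lipschitz w x I01_0; have := I01_dist x I01_0.
have := Rabs_pos (x - I01_0) => h0 h1 h2.
have : Rabs (thw w x - thw w I01_0) <= D by nra.
move/Rabs_le_between => h.
by rewrite /scale -!exp_plus; split; apply: exp_le; lra.
Qed.

Lemma phiw_contr (w : seq A) (x y : I01) :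
  Rabs (phiw w x - phiw w y) <= c * / gam ^ size w * Rabs (x - y).
Proof.
have [z ->] := phiw_mvt w x y; apply: Rmult_le_compat_r; first exact: Rabs_pos.
exact: thw_contracting.
Qed.

Lemma phiw_dist (w : seq A) (x y : I01) :
  exp (- D) * scale w * Rabs (x - y) <= Rabs (phiw w x - phiw w y)
    <= exp D * scale w * Rabs (x - y).
Proof.
have [z ->] := phiw_mvt w x y; have [h1 h2] := exp_thw_scale w z.
by split; apply: Rmult_le_compat_r => //; exact: Rabs_pos.
Qed.

(** One more letter shrinks a cylinder by at most a fixed factor, so the first prefix whose scale
    drops below a threshold is still comparable with it. *)
Lemma scale_rcons (w : seq A) (a : A) :
  exp (- (D + kap)) * scale w <= scale (rcons w a).
Proof.
rewrite /scale -cats1 thword_cat /= -exp_plus; apply: exp_le.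
have := thw_lipschitz w (phi a I01_0) I01_0; have := I01_dist (phi a I01_0) I01_0.
have := Rabs_pos (phi a I01_0 - I01_0) => h0 h1 h2.
have : Rabs (thw w (phi a I01_0) - thw w I01_0) <= D by nra.
move/Rabs_le_between; have /Rabs_le_between := th_bound a I01_0; lra.
Qed.

(** * Cancellation and one block of steps for a fixed exponent *)

Section FixedExponent.
Variables (s : C) (r : R).
Hypothesis Re_le : Rabs (Re s) <= r.
Hypothesis Re_Im : Rabs (Re s) <= Rabs (Im s).

(** Bounds the factor |phi_a'|^(Re s) contributed by one letter. It tends to 1 with [r], so a small
    [r] cannot spoil a fixed gain. *)
Definition growth : R := exp (r * kap).

Lemma thw_bound (w : seq A) (x : I01) : exp (Re s * thw w x) <= growth ^ size w.
Proof.
elim: w => [|a w IH] /=; first by rewrite Rmult_0_r exp_0; lra.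
rewrite Rmult_plus_distr_l exp_plus.
apply: Rmult_le_compat; try (by left; exact: exp_pos); last exact: IH.
apply: exp_le; apply: Rle_trans (Rle_abs _) _; rewrite Rabs_mult.
by apply: Rmult_le_compat => //; exact: Rabs_pos.
Qed.

Lemma iter_weighted_le (n : nat) (e : R) (f : I01 -> C) (h : I01 -> R) (x : I01) :
  dominated e f h -> Cmod (iter n (T s) f x) <= growth ^ n * iter n M h x.
Proof.
move=> hd; rewrite iter_weighted iter_markov big_distrr /=.
apply: Cmod_sum_le => w; rewrite mem_words => /eqP hw.
rewrite 2!Cmod_mult Cmod_R Cmod_cpow Rabs_pos_eq; last by left; exact: pword_gt0.
have pP := pword_gt0 A p p_pos w.
have -> : growth ^ n * (pw w * h (phiw w x)) = pw w * growth ^ n * h (phiw w x) by ring.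
apply: Rmult_le_compat; [|exact: Cmod_ge_0| |exact: dom_le hd _].
  by apply: Rmult_le_pos; left => //; exact: exp_pos.
by apply: Rmult_le_compat_l; [lra | rewrite -hw; exact: thw_bound].
Qed.

(** A Lasota-Yorke inequality in difference form: the weights contribute 2 D |Im s| to the exponent,
    and [f] its own [e] damped by the contraction [lam]. A small [lam] lets [e] reproduce itself. *)
Lemma iter_weighted_sub (n : nat) (lam e : R) (f : I01 -> C) (h : I01 -> R) (x y : I01) :
  (forall w, size w = n -> forall x y : I01,
     Rabs (phiw w x - phiw w y) <= lam * Rabs (x - y)) ->
  0 <= lam -> 0 <= e -> dominated e f h ->
  Cmod (iter n (T s) f x - iter n (T s) f y)
    <= growth ^ n * iter n M h x
       * (exp ((2 * D * Rabs (Im s) + e * lam) * Rabs (x - y)) - 1).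
Proof.
move=> hlam lam0 e0 hd; rewrite !iter_weighted iter_markov csum_sub.
set X := exp _ - 1.
rewrite Rmult_assoc big_distrl big_distrr /=.
apply: Cmod_sum_le => w; rewrite mem_words => /eqP hw.
have pP := pword_gt0 A p p_pos w.
set u := phiw w x; set v := phiw w y.
have -> : (RtoC (pw w) * cpow s (thw w x) * f u - RtoC (pw w) * cpow s (thw w y) * f v
   = RtoC (pw w) * cpow s (thw w y)
      * ((cpow s (thw w x - thw w y) - 1) * f u + (f u - f v)))%C.
  have {1}-> : thw w x = thw w y + (thw w x - thw w y) by ring.
  by rewrite cpow_plus; ring.
rewrite 2!Cmod_mult Cmod_R Cmod_cpow Rabs_pos_eq; last lra.
have -> : growth ^ n * (pw w * h u * X) = pw w * growth ^ n * (h u * X) by ring.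
have b0 := Rabs_pos (Im s); have t0 := Rabs_pos (x - y).
apply: Rmult_le_compat; [|exact: Cmod_ge_0| |].
- by apply: Rmult_le_pos; left => //; exact: exp_pos.
- by apply: Rmult_le_compat_l; [lra | rewrite -hw; exact: thw_bound].
apply: Rle_trans (Cmod_triangle _ _) _; rewrite Cmod_mult.
have h1 := Cmod_cpow_sub1 s (thw w x - thw w y) Re_Im.
have h2 := dom_sub _ _ _ hd u v; have h3 := dom_le _ _ _ hd u.
have h4 : exp (2 * Rabs (Im s) * Rabs (thw w x - thw w y))
   <= exp (2 * D * Rabs (Im s) * Rabs (x - y)).
  by apply: exp_le; have := thw_lipschitz w x y; nra.
have h5 : exp (e * Rabs (u - v)) <= exp (e * lam * Rabs (x - y)).
  by apply: exp_le; rewrite Rmult_assoc; apply: Rmult_le_compat_l => //; exact: hlam.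
have h6 : (exp (2 * D * Rabs (Im s) * Rabs (x - y)) - 1)
    + (exp (e * lam * Rabs (x - y)) - 1) <= X.
  rewrite /X Rmult_plus_distr_r; apply: expm1_plus; repeat apply: Rmult_le_pos => //; lra.
have hu := dom_ge0 _ _ _ hd u; have fu := Cmod_ge_0 (f u).
have c0 := Cmod_ge_0 (cpow s (thw w x - thw w y) - 1).
nra.
Qed.

Definition branch (f : I01 -> C) (w : seq A) (x : I01) : C :=
  (RtoC (pw w) * cpow s (thw w x) * f (phiw w x))%C.

Definition mass (h : I01 -> R) (w : seq A) (x : I01) : R := pw w * h (phiw w x).

(** Cancellation is relative to the envelope rather than to |f|: a branch far below its envelope
    already counts. *)
Definition cancels (f : I01 -> C) (h : I01 -> R) (eta : R) (u v : seq A) (x : I01) : Prop :=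
  Cmod (branch f u x + branch f v x) <= growth ^ size u
    * (mass h u x + mass h v x - eta * Rmin (mass h u x) (mass h v x)).

Lemma Cmod_branch_le (e : R) (f : I01 -> C) (h : I01 -> R) (w : seq A) (x : I01) :
  dominated e f h -> Cmod (branch f w x) <= growth ^ size w * mass h w x.
Proof.
move=> hd; have pP := pword_gt0 A p p_pos w.
rewrite /branch /mass 2!Cmod_mult Cmod_R Cmod_cpow Rabs_pos_eq; last lra.
have -> : growth ^ size w * (pw w * h (phiw w x))
  = pw w * growth ^ size w * h (phiw w x) by ring.
apply: Rmult_le_compat; [|exact: Cmod_ge_0| |exact: dom_le hd _].
  by apply: Rmult_le_pos; left => //; exact: exp_pos.
by apply: Rmult_le_compat_l; [lra | exact: thw_bound].
Qed.

Lemma not_cancels_dir (e eta : R) (f : I01 -> C) (h : I01 -> R) (u v : seq A) (x : I01) :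
  dominated e f h -> size u = size v -> 0 < eta <= 1 / 2 -> ~ cancels f h eta u v x ->
  [/\ 0 < h (phiw u x), 0 < h (phiw v x), h (phiw u x) / 2 <= Cmod (f (phiw u x)),
      h (phiw v x) / 2 <= Cmod (f (phiw v x))
    & Cmod (cis (Im s * thw u x) * dir (f (phiw u x))
            - cis (Im s * thw v x) * dir (f (phiw v x))) ^ 2 <= 8 * eta].
Proof.
move=> hd huv he /Rnot_le_lt.
have g0 : 0 < growth ^ size u by apply: pow_lt; exact: exp_pos.
have -> : growth ^ size u * (mass h u x + mass h v x - eta * Rmin (mass h u x) (mass h v x))
  = growth ^ size u * mass h u x + growth ^ size u * mass h v x
    - eta * Rmin (growth ^ size u * mass h u x) (growth ^ size u * mass h v x).
  by rewrite -Rmult_min_distr_l; [ring | lra].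
have hF := Cmod_branch_le e f h u x hd.
have := Cmod_branch_le e f h v x hd; rewrite -huv => hG hlt.
have [P0 Q0 h1 h2] := aligned_of_no_cancellation _ _ _ _ _ he hF hG hlt.
have low w : size w = size u -> growth ^ size u * mass h w x / 2 <= Cmod (branch f w x) ->
   h (phiw w x) / 2 <= Cmod (f (phiw w x)).
  move=> hw; rewrite /branch /mass 2!Cmod_mult Cmod_R Cmod_cpow.
  have pP := pword_gt0 A p p_pos w; rewrite Rabs_pos_eq; last lra.
  move=> h3; apply: (Rmult_le_reg_l (pw w * growth ^ size u)); first exact: Rmult_lt_0_compat.
  apply: (Rle_trans _ (growth ^ size u * (pw w * h (phiw w x)) / 2)); first by right; field.
  apply: Rle_trans h3 _; apply: Rmult_le_compat_r; first exact: Cmod_ge_0.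
  by apply: Rmult_le_compat_l; [lra | rewrite -hw; exact: thw_bound].
have pos w : 0 < growth ^ size u * mass h w x -> 0 < h (phiw w x).
  move=> h3; apply: Rnot_le_lt => h4; have pP := pword_gt0 A p p_pos w.
  have : mass h w x <= 0 by rewrite /mass; nra.
  by nra.
have dirE w : dir (branch f w x) = (cis (Im s * thw w x) * dir (f (phiw w x)))%C.
  have -> : branch f w x
    = (RtoC (pw w * exp (Re s * thw w x)) * cis (Im s * thw w x) * f (phiw w x))%C.
    by rewrite /branch /cpow RtoC_mult; ring.
  apply: dir_mul; last exact: Cmod_cis.
  by apply: Rmult_lt_0_compat; [exact: pword_gt0 | exact: exp_pos].
by rewrite !dirE; split => //; [exact: pos | exact: pos | exact: low | exact: low].
Qed.

(** If both alternatives fail, the two branches are aligned at x and at y, and f fills half of its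
    envelope there. Between x and y the direction of f o phi_w moves by at most 8 zeta for each
    word, while the relative phase turns by [Delta], too much to be compensated. *)
Lemma cancels_or (e eta sg zeta lam : R) (f : I01 -> C) (h : I01 -> R) (u v : seq A)
  (x y : I01) :
  dominated e f h -> size u = size v -> 0 < eta <= 1 / 2 -> 8 * eta <= sg ^ 2 -> 0 <= sg ->
  0 <= e -> (forall w, w \in [:: u; v] -> Rabs (phiw w x - phiw w y) <= lam * Rabs (x - y)) ->
  e * (lam * Rabs (x - y)) <= zeta -> zeta <= 1 / 2 ->
  let Delta := Rabs (Im s) * Rabs ((thw u x - thw v x) - (thw u y - thw v y)) in
  Delta <= 1 -> 2 * sg + 16 * zeta < Delta / 2 ->
  cancels f h eta u v x \/ cancels f h eta u v y.
Proof.
move=> hd huv he hsg sg0 e0 hlam hz z1 Delta D1 D2.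
have [|nx] := classic (cancels f h eta u v x); first by left.
have [|ny] := classic (cancels f h eta u v y); first by right.
exfalso.
have [ux vx lux lvx dx] := not_cancels_dir _ _ _ _ _ _ _ hd huv he nx.
have [uy vy luy lvy dy] := not_cancels_dir _ _ _ _ _ _ _ hd huv he ny.
have sq z : 0 <= z -> z ^ 2 <= 8 * eta -> z <= sg.
  by move=> z0 hz2; apply: Rnot_lt_le => ?; nra.
(* [dir_dist] gives 2 h (exp zeta - 1) <= 4 h zeta, and dividing by |f| >= h / 2 yields 8 zeta. *)
have close w : w \in [:: u; v] -> 0 < h (phiw w x) ->
    h (phiw w x) / 2 <= Cmod (f (phiw w x)) -> 0 < Cmod (f (phiw w y)) ->
    Cmod (dir (f (phiw w x)) - dir (f (phiw w y))) <= 8 * zeta.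
  move=> hw hx lx ly; have fx : 0 < Cmod (f (phiw w x)) by lra.
  have h1 := dir_dist _ _ fx ly; have h2 := dom_sub _ _ _ hd (phiw w x) (phiw w y).
  have h3 := Rmult_le_compat_l _ _ _ e0 (hlam w hw).
  have h4 : 0 <= e * Rabs (phiw w x - phiw w y) by apply: Rmult_le_pos => //; exact: Rabs_pos.
  have h5 := expm1_le2 _ (conj h4 (Rle_trans _ _ _ h3 (Rle_trans _ _ _ hz z1))).
  apply: (Rmult_le_reg_l (Cmod (f (phiw w x)))) => //.
  have : 0 <= zeta by lra.
  nra.
have cu := close u (mem_head _ _) ux lux ltac:(lra).
have cv := close v ltac:(by rewrite !inE eqxx orbT) vx lvx ltac:(lra).
have e1 : (Im s * thw u x - Im s * thw v x) - (Im s * thw u y - Im s * thw v y)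
  = Im s * ((thw u x - thw v x) - (thw u y - thw v y)) by ring.
have := phase_rotation_le (f (phiw u x)) (f (phiw u y)) (f (phiw v x)) (f (phiw v y))
  _ _ _ _ sg ltac:(lra) ltac:(lra) ltac:(lra) ltac:(lra)
  (sq _ (Cmod_ge_0 _) dx) (sq _ (Cmod_ge_0 _) dy).
rewrite e1 Rabs_mult -/Delta => /(_ D1); lra.
Qed.

Lemma perm_words2 (N : nat) (u v : seq A) : size u = N -> size v = N -> u != v ->
  exists rest, perm_eq (words A N) (u :: v :: rest).
Proof.
move=> hu hv uv.
have mu : u \in words A N by rewrite mem_words hu.
have := perm_to_rem mu => pu.
have mv : v \in rem u (words A N).
  have : v \in words A N by rewrite mem_words hv.
  by rewrite (perm_mem pu) inE eq_sym (negbTE uv).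
exists (rem v (rem u (words A N))).
by apply: (perm_trans pu); rewrite perm_cons; exact: perm_to_rem.
Qed.

(** Cauchy-Schwarz with the term of [w] scaled by 1 - t: the constant drops below 1 by an amount
    that depends on the weight of [w] but not on the share of this term in the sum. *)
Lemma gain_sqr (N : nat) (h : I01 -> R) (x : I01) (w : seq A) (rest : seq (seq A)) (t : R) :
  perm_eq (words A N) (w :: rest) ->
  (iter N M h x - t * mass h w x) ^ 2
    <= (1 - pw w * (1 - (1 - t) * (1 - t))) * iter N M (fun y => h y * h y) x.
Proof.
move=> hp; rewrite !iter_markov.
have s1 := sum_pword A p p_sum N.
rewrite (perm_big _ hp) big_cons /= in s1.
rewrite !(perm_big _ hp) !big_cons /= /mass.
have p0 : {in rest, forall i, 0 <= pw i} by move=> i _; left; exact: pword_gt0.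
have := cauchy_schwarz_step _ _ _ (pw w) (h (phiw w x)) (1 - t) (sumR_ge0 _ rest _ p0) _
   _ (sumR_sqr_le _ rest (pword A p) (fun i => h (phiw i x)) p0).
have -> : \sumR_(i <- rest) pw i = 1 - pw w by lra.
set S1 := \sumR_(i <- rest) _; set S2 := \sumR_(i <- rest) _ => hh.
have -> : pw w * h (phiw w x) + S1 - t * (pw w * h (phiw w x))
   = S1 + pw w * (1 - t) * h (phiw w x) by ring.
have -> : 1 - pw w * (1 - (1 - t) * (1 - t)) = 1 - pw w + pw w * ((1 - t) * (1 - t)) by ring.
rewrite (Rplus_comm (pw w * _) S2); apply: hh; last by left; exact: pword_gt0.
apply: sumR_ge0 => i hi; apply: Rmult_le_pos; [exact: p0 | exact: Rle_0_sqr].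
Qed.

Lemma mass_ge0 (e : R) (f : I01 -> C) (h : I01 -> R) (w : seq A) (x : I01) :
  dominated e f h -> 0 <= mass h w x.
Proof.
by move=> hd; apply: Rmult_le_pos; [left; exact: pword_gt0 | exact: dom_ge0 hd _].
Qed.

(** The constant 8 D comes from here: with [lam] <= 1/4 one block turns the exponent e into at most
    e / 2. The other half pays for the slope of the cutoff and for the new envelope being possibly
    only half of the averaged one. *)
Lemma dominated_step (N : nat) (u v : seq A) (lam eta L e q : R)
  (f : I01 -> C) (h : I01 -> R) :
  size u = N -> size v = N -> u != v ->
  (forall w, size w = N -> forall x y : I01,
     Rabs (phiw w x - phiw w y) <= lam * Rabs (x - y)) ->
  0 <= lam <= 1 / 4 -> e = 8 * D * Rabs (Im s) -> dominated e f h ->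
  0 < eta <= 1 / 2 -> 0 < L -> 2 * eta * L <= e / 2 ->
  0 <= q -> q <= pw u -> q <= pw v ->
  exists h' : I01 -> R, [/\ dominated e (iter N (T s) f) h',
    forall x, h' x ^ 2 <= (growth ^ N) ^ 2 * iter N M (fun y => h y * h y) x
  & forall x : I01, (forall y : I01, L * Rabs (x - y) < 1 -> cancels f h eta u v y) ->
    h' x ^ 2 <= (growth ^ N) ^ 2 * ((1 - q * eta) * iter N M (fun y => h y * h y) x)].
Proof.
move=> hu hv uv hlam lam01 he hd heta L0 etaL q0 qu qv.
have [chi [c01 c0 clip c1]] := lipschitz_cutoff (cancels f h eta u v) L L0.
have b0 := Rabs_pos (Im s).
have e0 : 0 <= e by rewrite he; apply: Rmult_le_pos => //; lra.
have G0 : 0 < growth ^ N by apply: pow_lt; exact: exp_pos.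
pose m x := Rmin (mass h u x) (mass h v x).
pose h' x := growth ^ N * (iter N M h x - eta * chi x * m x).
have mass0 w x : 0 <= mass h w x by exact: mass_ge0 hd.
have m0 x : 0 <= m x by apply: Rmin_glb.
have [rest hp] := perm_words2 N u v hu hv uv.
have split3 x : iter N M h x
    = mass h u x + mass h v x + \sumR_(w <- rest) mass h w x.
  by rewrite iter_markov (perm_big _ hp) !big_cons /= /mass; ring.
have rest0 x : 0 <= \sumR_(w <- rest) mass h w x by apply: sumR_ge0.
have mle x : 2 * m x <= iter N M h x.
  rewrite split3; have := Rmin_l (mass h u x) (mass h v x).
  have := Rmin_r (mass h u x) (mass h v x); have := rest0 x; rewrite -/(m x); lra.
have half x : growth ^ N * iter N M h x <= 2 * h' x.
  rewrite /h'; have := c01 x; have := m0 x; have := mle x => h1 h2 h3.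
  have : eta * chi x * m x <= m x.
    by rewrite -[X in _ <= X]Rmult_1_l; apply: Rmult_le_compat_r => //; nra.
  by nra.
have pos x : 0 <= h' x.
  have h1 : 0 <= growth ^ N * iter N M h x.
    by apply: Rmult_le_pos; have := mle x; have := m0 x; lra.
  by have := half x; lra.
(* Whichever of [u] and [v] realizes the minimum, its weight is at least [q], so [gain_sqr] applies
   to it. *)
have sqr x t : 0 <= t <= 1 -> (iter N M h x - t * m x) ^ 2
    <= (1 - q * (1 - (1 - t) * (1 - t))) * iter N M (fun y => h y * h y) x.
  move=> ht; have V0 : 0 <= iter N M (fun y => h y * h y) x.
    by apply: (iter_markov_ge0 A phi p p_pos) => y; exact: Rle_0_sqr.
  have [w [-> [qw [r2 hw]]]] : exists w, m x = mass h w x /\ (q <= pw w /\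
      exists r, perm_eq (words A N) (w :: r)).
    rewrite /m; have [hm|hm] := Rle_dec (mass h u x) (mass h v x).
      by exists u; rewrite Rmin_left //; split => //; split => //; exists (v :: rest).
    exists v; rewrite Rmin_right; last lra; split => //; split => //.
    exists (u :: rest); apply: (perm_trans hp).
    by rewrite -[u :: v :: rest]/([:: u] ++ [:: v] ++ rest) perm_catCA.
  apply: Rle_trans (gain_sqr N h x w r2 t hw) _; apply: Rmult_le_compat_r => //.
  have hz : 0 <= 1 - (1 - t) * (1 - t) by nra.
  by nra.
exists h'; split; first split.
- exact: pos.
- move=> x; have [nz|z] := classic (cancels f h eta u v x); last first.
    rewrite /h' (c0 _ z) Rmult_0_r Rmult_0_l Rminus_0_r.
    exact: (iter_weighted_le N e).
  have -> : iter N (T s) f x = (branch f u x + branch f v x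
       + \big[Cplus/RtoC 0]_(w <- rest) branch f w x)%C.
    by rewrite iter_weighted (perm_big _ hp) !big_cons /= Cplus_assoc.
  apply: Rle_trans (Cmod_triangle _ _) _.
  rewrite /h' split3.
  have hr : Cmod (\big[Cplus/RtoC 0]_(w <- rest) branch f w x)
     <= \sumR_(w <- rest) (growth ^ N * mass h w x).
    apply: Cmod_sum_le => w hw.
    have <- : size w = N.
      apply/eqP; rewrite -(mem_words A) (perm_mem hp) !inE hw.
      by rewrite !orbT.
    exact: (Cmod_branch_le e).
  rewrite -big_distrr /= in hr.
  move: nz; rewrite /cancels hu -/(m x) => nz.
  have : eta * chi x * m x <= eta * m x.
    by have := c01 x; have := m0 x => h1 h2; apply: Rmult_le_compat_r => //; nra.
  by nra.
- have massL w (x y : I01) : size w = N -> mass h w x <= exp (e / 2 * Rabs (x - y)) * mass h w y.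
    move=> hw; rewrite /mass.
    have -> : exp (e / 2 * Rabs (x - y)) * (pw w * h (phiw w y))
      = pw w * (exp (e / 2 * Rabs (x - y)) * h (phiw w y)) by ring.
    apply: Rmult_le_compat_l; first by left; exact: pword_gt0.
    apply: Rle_trans (dom_log_lipschitz _ _ _ hd _ _) _.
    apply: Rmult_le_compat_r; first exact: dom_ge0 hd _.
    apply: exp_le; have h1 := hlam w hw x y; have h2 := Rabs_pos (x - y).
    rewrite /Rdiv Rmult_assoc; apply: Rmult_le_compat_l => //; nra.
  move=> x y; set t := Rabs (x - y).
  have t0 : 0 <= t by exact: Rabs_pos.
  have eE : exp (e * t) = exp (e / 2 * t) * exp (e / 2 * t).
    by rewrite -exp_plus; congr exp; field.
  set X := exp (e / 2 * t) in eE *.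
  have X1 : 1 <= X by apply: exp_ge1; apply: Rmult_le_pos => //; lra.
  (* A difference of log-Lipschitz functions need not be log-Lipschitz. Writing the two masses as
     maximum plus minimum exhibits [h'] as a sum of nonnegative log-Lipschitz terms, with the cutoff
     only on the minimum. *)
  pose B z := Rmax (mass h u z) (mass h v z) + \sumR_(w <- rest) mass h w z.
  have hE z : h' z = growth ^ N * (B z + (1 - eta * chi z) * m z).
    rewrite /h' split3 /B /m /Rmax /Rmin; case: Rle_dec => _; ring.
  have mL : m x <= X * m y.
    rewrite /m Rmult_min_distr_l; last lra.
    have := massL u x y hu; have := massL v x y hv.
    have := Rmin_l (mass h u x) (mass h v x); have := Rmin_r (mass h u x) (mass h v x).
    by move=> ? ? ? ?; apply: Rmin_glb; rewrite /X /t; lra.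
  have BL : B x <= X * B y.
    rewrite /B Rmult_plus_distr_l; apply: Rplus_le_compat.
      have := Rmax_l (mass h u y) (mass h v y); have := Rmax_r (mass h u y) (mass h v y).
      have h1 := massL u x y hu; have h2 := massL v x y hv.
      by move=> ? ?; apply: Rmax_lub; [apply: Rle_trans h1 _ | apply: Rle_trans h2 _];
        apply: Rmult_le_compat_l; rewrite -/X; lra.
    rewrite big_distrr /=; apply: sumR_le => w hw; apply: massL.
    by apply/eqP; rewrite -(mem_words A) (perm_mem hp) !inE hw !orbT.
  have B0 z : 0 <= B z.
    rewrite /B; have := rest0 z; have := Rmax_l (mass h u z) (mass h v z).
    by have := mass0 u z; lra.
  (* As 1 - eta chi is at least 1/2, its logarithm has slope at most 2 eta L <= e / 2, the half that
     [massL] left over. *)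
  have cL : 1 - eta * chi x <= X * (1 - eta * chi y).
    have h1 := clip y x; have h2 := c01 y; have h3 := c01 x.
    have h4 : 1 + e / 2 * t <= X by exact: exp_ineq1_le.
    have h5 : 2 * eta * L * t <= e / 2 * t by apply: Rmult_le_compat_r.
    have h6 : chi y <= chi x + L * t.
      by rewrite /t Rabs_minus_sym; exact: clip.
    have h7 : 1 / 2 <= 1 - eta * chi y by nra.
    have h8 : eta * chi y <= eta * chi x + eta * L * t by nra.
    have h9 : 0 <= eta * L * t by repeat apply: Rmult_le_pos => //; lra.
    have : (1 + 2 * eta * L * t) * (1 - eta * chi y) <= X * (1 - eta * chi y).
      by apply: Rmult_le_compat_r; lra.
    by nra.
  rewrite !hE eE.
  have P1 : (1 - eta * chi x) * m x <= (X * (1 - eta * chi y)) * (X * m y).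
    by apply: Rmult_le_compat => //; have := c01 x; nra.
  have P2 : B x <= X * X * B y.
    by apply: Rle_trans BL _; apply: Rmult_le_compat_r => //; nra.
  have -> : X * X * (growth ^ N * (B y + (1 - eta * chi y) * m y))
    = growth ^ N * (X * X * B y + X * (1 - eta * chi y) * (X * m y)) by ring.
  by apply: Rmult_le_compat_l; lra.
- move=> x y.
  have := iter_weighted_sub N lam e f h x y hlam (proj1 lam01) e0 hd.
  set t := Rabs (x - y); have t0 : 0 <= t by exact: Rabs_pos.
  (* Since k <= e / 2, superadditivity 2 (exp (k t) - 1) <= exp (e t) - 1 absorbs the factor 2 from
     [half]. *)
  set k := 2 * D * Rabs (Im s) + e * lam => h1; apply: Rle_trans h1 _.
  have k0 : 0 <= k.
    by rewrite /k; apply: Rplus_le_le_0_compat; repeat apply: Rmult_le_pos => //; lra.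
  have kt0 : 0 <= k * t by apply: Rmult_le_pos.
  have := expm1_plus _ _ kt0 kt0.
  have : exp (k * t + k * t) <= exp (e * t).
    apply: exp_le; have -> : k * t + k * t = (2 * k) * t by ring.
    apply: Rmult_le_compat_r => //; rewrite /k; have : e * lam <= e / 4 by nra.
    by rewrite he; lra.
  have := half x; have := exp_ge1 _ kt0.
  set E1 := exp (k * t); set E2 := exp (e * t); set H := growth ^ N * _ => g1 g2 g3 g4.
  have : H * (E1 - 1) <= 2 * h' x * (E1 - 1) by apply: Rmult_le_compat_r; lra.
  have := pos x.
  by nra.
- move=> x; rewrite /h' Rpow_mult_distr; apply: Rmult_le_compat_l; first exact: pow2_ge_0.
  have cx := c01 x; have tx : 0 <= eta * chi x <= 1 by nra.
  apply: Rle_trans (sqr x _ tx) _; rewrite -[X in _ <= X]Rmult_1_l.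
  apply: Rmult_le_compat_r.
    by apply: (iter_markov_ge0 A phi p p_pos) => y; exact: Rle_0_sqr.
  have hz : 0 <= 1 - (1 - eta * chi x) * (1 - eta * chi x) by nra.
  by nra.
- move=> x hx; rewrite /h' (c1 x hx) Rmult_1_r Rpow_mult_distr.
  apply: Rmult_le_compat_l; first exact: pow2_ge_0.
  apply: Rle_trans (sqr x eta _) _; first lra.
  apply: Rmult_le_compat_r.
    by apply: (iter_markov_ge0 A phi p p_pos) => y; exact: Rle_0_sqr.
  have hz : eta <= 1 - (1 - eta) * (1 - eta) by nra.
  by nra.
Qed.

End FixedExponent.

(** * Localization of the loss to small cylinders *)

Lemma contraction_small (t : R) : 0 < t ->
  exists n0 : nat, forall n : nat, (n0 <= n)%nat -> c * / gam ^ n <= t.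
Proof.
move=> t0.
have g0 : 0 < / gam by apply: Rinv_0_lt_compat; lra.
have g1 : Rabs (/ gam) < 1.
  rewrite Rabs_pos_eq; last lra.
  by rewrite -Rinv_1; apply: Rinv_lt_contravar; lra.
have [n0 hn] := pow_lt_1_zero _ g1 (t / c) (Rdiv_lt_0_compat _ _ t0 c_gt0).
exists n0 => n /leP hle; have := hn n hle.
rewrite pow_inv Rabs_pos_eq; last by left; apply: Rinv_0_lt_compat; apply: pow_lt; lra.
move=> h; have := Rmult_le_compat_l c _ _ (Rlt_le _ _ c_gt0) (Rlt_le _ _ h).
by have -> : c * (t / c) = t by field; lra.
Qed.

Lemma iter_markov_ge_term (v : seq A) (g : I01 -> R) (x : I01) : (forall y, 0 <= g y) ->
  pw v * g (phiw v x) <= iter (size v) M g x.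
Proof.
move=> g0; have mv : v \in words A (size v) by rewrite mem_words.
rewrite iter_markov (perm_big _ (perm_to_rem mv)) big_cons /=.
set S := bigop _ _ _; suff : 0 <= S by lra.
apply: sumR_ge0 => w _; apply: Rmult_le_pos => //; left; exact: pword_gt0.
Qed.

(* Every long word is cut at the first prefix whose scale drops below [eps]; the
   cylinders of these prefixes play the role of balls of radius [eps], and Bernoulli
   weights are doubling on them however much the images overlap. *)
Lemma markov_localize (q : R) (Q m : nat) (eps Kc : R) (Hf Hg : I01 -> R) :
  0 < q -> (forall w, q ^ size w <= pw w) -> 0 < Kc ->
  (forall x, 0 <= Hf x) -> (forall x, 0 <= Hg x) ->
  (forall w, (m <= size w)%nat -> scale w <= eps) ->
  (forall w, exp (- (D + kap)) * eps <= scale w <= eps ->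
     (forall x y, Hf (phiw w x) <= Kc * Hf (phiw w y)) /\
     exists2 v, size v = Q &
       forall x, Hf (phiw w (phiw v x)) <= Hg (phiw w (phiw v x))) ->
  forall (k : nat) (w : seq A), (size w <= m)%nat -> exp (- (D + kap)) * eps <= scale w ->
    (m + Q <= size w + k)%nat -> forall x,
    q ^ Q * iter k M (fun y => Hf (phiw w y)) x
      <= Kc * Kc * iter k M (fun y => Hg (phiw w y)) x.
Proof.
move=> q0 hq Kc0 Hf0 Hg0 hm hloc k; elim: k => [|k IH] w hw hs hk x;
  (have [small|big] := Rle_dec (scale w) eps; last
    have hwm : (size w < m)%nat by rewrite ltnNge; apply/negP => /hm).
- have [hK [v hv hg]] := hloc w (conj hs small).
  have Q0 : Q = 0%nat by lia.
  move: hv; rewrite Q0 => /size0nil ev; rewrite ev /= in hg.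
  rewrite /= Rmult_1_l; have h1 := hg x; have h2 := Hg0 (phiw w x).
  have h3 := hK x x; have h4 := Hf0 (phiw w x).
  have : Hf (phiw w x) <= Kc * Hg (phiw w x).
    by apply: Rle_trans h3 _; apply: Rmult_le_compat_l; lra.
  have [e|e] := Req_dec (Hg (phiw w x)) 0.
    by move=> ?; have -> : Hf (phiw w x) = 0 by [lra]; rewrite e; lra.
  (* Comparing a point with itself, [hK] gives [Kc] >= 1 unless [Hf] vanishes there. *)
  have K1 : Hf (phiw w x) = 0 \/ 1 <= Kc.
    have [z|z] := Req_dec (Hf (phiw w x)) 0; [by left | right].
    by apply: Rnot_lt_le => ?; nra.
  move=> h5; case: K1 => [->|K1]; first by repeat apply: Rmult_le_pos => //; lra.
  by nra.
- by exfalso; lia.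
- have [hK [v hv hg]] := hloc w (conj hs small).
  have -> : k.+1 = ((k.+1 - Q) + Q)%nat by lia.
  set n := (k.+1 - Q)%nat.
  have h1 : iter (n + Q) M (fun y => Hf (phiw w y)) x <= Kc * Hf (phiw w I01_0).
    rewrite -(iter_markov_const A phi p p_sum (n + Q) (Kc * Hf (phiw w I01_0)) x).
    apply: (iter_markov_le A phi p p_pos) => y; exact: hK.
  (* Of the [Q] letters following [w] only the word [v] is kept, at weight at least [q ^ Q]; the
     remaining [n] letters average a pointwise bound. *)
  have h2 : q ^ Q * Hf (phiw w I01_0) <= Kc * iter (n + Q) M (fun y => Hg (phiw w y)) x.
    rewrite -iter_markov_scal iterD.
    rewrite -(iter_markov_const A phi p p_sum n (q ^ Q * Hf (phiw w I01_0)) x).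
    apply: (iter_markov_le A phi p p_pos) => y.
    rewrite iter_markov_scal -{2}hv.
    have h3 := iter_markov_ge_term v (fun y => Hg (phiw w y)) y (fun y => Hg0 _).
    have h4 := hq v; rewrite hv in h4; have qQ : 0 < q ^ Q by exact: pow_lt.
    have h5 : q ^ Q * Hf (phiw w (phiw v y)) <= pw v * Hg (phiw w (phiw v y)).
      by apply: Rmult_le_compat; [lra | exact: Hf0 | exact: h4 | exact: hg].
    have h6 := Rmult_le_compat_l _ _ _ (Rlt_le _ _ qQ) (hK I01_0 (phiw v y)).
    apply: Rle_trans h6 _.
    rewrite -Rmult_assoc (Rmult_comm _ Kc) Rmult_assoc.
    by apply: Rmult_le_compat_l; lra.
  have qQ : 0 < q ^ Q by exact: pow_lt.
  apply: Rle_trans (Rmult_le_compat_l _ _ _ (Rlt_le _ _ qQ) h1) _.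
  rewrite -Rmult_assoc (Rmult_comm _ Kc) !Rmult_assoc.
  by apply: Rmult_le_compat_l; lra.
- rewrite !iter_markov_comp !big_distrr /=; apply: sumR_le => a _.
  have hr : size (rcons w a) = (size w).+1 by rewrite size_rcons.
  have h := IH (rcons w a) ltac:(by rewrite hr) _ ltac:(by rewrite hr addSnnS) x.
  have hs' : exp (- (D + kap)) * eps <= scale (rcons w a).
    apply: Rle_trans (scale_rcons w a); apply: Rmult_le_compat_l; last lra.
    by left; exact: exp_pos.
  have pa := p_pos a; have := Rmult_le_compat_l _ _ _ (Rlt_le _ _ pa) (h hs'); lra.
Qed.

(** * The attractor, UNI and the gain of one block *)

Variable K : I01 -> Prop.
Hypothesis K_code : forall x, K x -> exists a y, K y /\ phi a y = x.
Hypothesis K_maps : forall w x, K x -> K (phiw w x).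
Variables k1 k2 : I01.
Hypothesis K_k1 : K k1.
Hypothesis K_k2 : K k2.
Hypothesis k1_neq_k2 : k1 <> k2.

Lemma K_code_word (n : nat) (x : I01) : K x ->
  exists2 w, size w = n & exists y, phiw w y = x.
Proof.
suff h : K x -> exists2 w, size w = n & exists2 y, K y & phiw w y = x.
  by move=> /h [w hw [y _ hy]]; exists w => //; exists y.
elim: n x => [|n IH] x Kx; first by exists [::] => //; exists x.
have [a [y [Ky <-]]] := K_code x Kx.
have [w hw [z Kz <-]] := IH y Ky.
by exists (a :: w); [rewrite /= hw | exists z].
Qed.

(** Codes of two distinct points of [K], long enough that each image stays within a quarter of their
    distance from its point. Equal lengths let either word serve as the subcylinder of length Q. *)
Lemma separated_words : exists v1 v2 d, [/\ size v1 = size v2, 0 < d <= 1 &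
  forall x y, d <= Rabs (phiw v1 x - phiw v2 y)].
Proof.
set d := Rabs (k1 - k2).
have d0 : 0 < d by apply: Rabs_pos_lt => e; apply: k1_neq_k2; apply: ival_inj; lra.
have d1 : d <= 1 by exact: I01_dist.
have [n hn] := contraction_small (d / 4) ltac:(lra).
have [v1 s1 [x1 e1]] := K_code_word n k1 K_k1.
have [v2 s2 [x2 e2]] := K_code_word n k2 K_k2.
exists v1, v2, (d / 2); split; [by rewrite s1 s2 | lra |] => x y.
have hc := hn n (leqnn n).
have h1 := phiw_contr v1 x x1; have h2 := phiw_contr v2 x2 y.
rewrite s1 e1 in h1; rewrite s2 e2 in h2.
have := I01_dist x x1; have := I01_dist x2 y.
have := Rabs_pos (x - x1); have := Rabs_pos (x2 - y) => ? ? ? ?.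
have {}h1 : Rabs (phiw v1 x - k1) <= d / 4 by nra.
have {}h2 : Rabs (k2 - phiw v2 y) <= d / 4 by nra.
have : d <= Rabs (phiw v1 x - k1) + Rabs (phiw v1 x - phiw v2 y) + Rabs (k2 - phiw v2 y).
  have -> : d = Rabs (- (phiw v1 x - k1) + (phiw v1 x - phiw v2 y) + - (k2 - phiw v2 y)).
    by rewrite /d; congr Rabs; ring.
  have := Rabs_triang (- (phiw v1 x - k1) + (phiw v1 x - phiw v2 y)) (- (k2 - phiw v2 y)).
  have := Rabs_triang (- (phiw v1 x - k1)) (phiw v1 x - phiw v2 y).
  by rewrite !Rabs_Ropp; lra.
lra.
Qed.

Variables (c1 : R) (N0 : nat).
Hypothesis c1_gt0 : 0 < c1.
Hypothesis uni : forall N, (N0 <= N)%nat -> exists u v delta,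
  [/\ size u = N, size v = N, u != v, 0 < delta &
   forall k x y : I01, K k -> Rabs (x - k) <= delta -> Rabs (y - k) <= delta ->
     c1 * Rabs (x - y) <= Rabs ((thw u x - thw v x) - (thw u y - thw v y))].

Lemma I01_triangle (x y z : I01) : Rabs (x - z) <= Rabs (x - y) + Rabs (y - z).
Proof. by have := Rabs_triang (x - y) (y - z); have -> : x - y + (y - z) = x - z by ring. Qed.

(** The order of choices avoids circularity: the separation [al], tolerance [sg] and loss [eta]
    depend on [c1] but not on [N], and [N] is then chosen to make [lam] small against [sg]. *)
Lemma one_step_contraction :
  exists (N Q : nat) (theta L0 B0 : R), [/\ (0 < N)%nat, 0 < theta < 1, 0 < L0, 0 < B0 &
  forall (s : C) (r : R), Rabs (Re s) <= r -> Rabs (Re s) <= Rabs (Im s) ->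
    B0 <= Rabs (Im s) ->
  forall f h, dominated (8 * D * Rabs (Im s)) f h ->
  exists2 h', dominated (8 * D * Rabs (Im s)) (iter N (T s) f) h' &
  forall m j : nat, (forall w, (m <= size w)%nat -> scale w <= L0 / Rabs (Im s)) ->
    (m + Q <= j)%nat -> forall x,
    iter j M (fun y => h' y * h' y) x
      <= (growth r ^ N) ^ 2 * (1 - theta) * iter (j + N) M (fun y => h y * h y) x].
Proof.
have [v1 [v2 [d [v12 d01 sep]]]] := separated_words.
have [q q01 hq] := pword_lower A p p_pos.
have eD := exp_ge1 D ltac:(lra).
(* [L0] makes D |b| times the diameter of a cylinder of scale [L0 / |b|] at most 1/8, so that even
   after a slight enlargement the relative phase turns by less than one radian. *)
pose Q := size v1; pose L0 := 1 / (8 * D * exp D).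
have L0P : 0 < L0 by apply: Rdiv_lt_0_compat; [lra | apply: Rmult_lt_0_compat; lra].
have L0E : D * (exp D * L0) = 1 / 8 by rewrite /L0; field; lra.
have L0le : exp D * L0 <= 1 / 8 by nra.
pose kk := exp (- (D + kap)); have kkP : 0 < kk by exact: exp_pos.
(* Lower bound for |b| times the distance between the two subcylinders inside a cylinder of scale
   about [L0 / |b|]. *)
pose al := exp (- D) * (kk * L0) * d.
have eND : 0 < exp (- D) <= 1.
  by split; [exact: exp_pos | rewrite -exp_0; apply: exp_le; lra].
have kk1 : kk <= 1 by rewrite /kk -exp_0; apply: exp_le; lra.
have alP : 0 < al by repeat apply: Rmult_lt_0_compat => //; lra.
have alle : al <= L0.
  rewrite /al; have -> : L0 = 1 * (1 * L0) * 1 by ring.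
  have := Rmult_lt_0_compat _ _ kkP L0P => h0.
  apply: Rmult_le_compat; try lra; first by nra.
  by apply: Rmult_le_compat; try lra; apply: Rmult_le_compat; lra.
have DL0 : D * L0 <= 1 / 8 by nra.
(* Moving both points by [rho / |b|] leaves |b| times their distance at least al / 2, so the
   relative phase turns by at least c1 al / 2. [cancels_or] is used with zeta = 2 lam, and 2 sg + 32
   lam <= 4 sg = c1 al / 8 is below half of that. *)
pose rho := al / 4; pose sg := c1 * al / 32.
have sgP : 0 < sg by rewrite /sg; have := Rmult_lt_0_compat _ _ c1_gt0 alP; lra.
(* The second entry turns 8 eta into the tolerance [sg] for directions; the third keeps the cutoff
   slope within e / 2 = 4 D |b|. *)
pose eta := Rmin (1 / 2) (Rmin (sg ^ 2 / 8) (2 * D * rho)).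
have etaP : 0 < eta.
  apply: Rmin_pos; first lra; apply: Rmin_pos.
    by have := pow_lt _ 2 sgP; lra.
  by apply: Rmult_lt_0_compat; [lra | rewrite /rho; lra].
have eta1 : eta <= 1 / 2 by exact: Rmin_l.
have eta2 : 8 * eta <= sg ^ 2.
  by have := Rle_trans _ _ _ (Rmin_r _ _) (Rmin_l _ _ ) : eta <= sg ^ 2 / 8; lra.
have eta3 : eta <= 2 * D * rho by exact: Rle_trans (Rmin_r _ _) (Rmin_r _ _ ).
have [n1 hn1] := contraction_small (Rmin (1 / 4) (sg / 16)) ltac:(
  by apply: Rmin_pos; lra).
pose N := maxn N0 n1.
have [u [v [del [su sv uv delP huni]]]] := uni N (leq_maxl _ _).
have NP : (0 < N)%nat.
  by rewrite lt0n; apply/eqP => N_0; move: uv; rewrite N_0 in su sv;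
    rewrite (size0nil su) (size0nil sv) eqxx.
pose lam := c * / gam ^ N.
have lam0 : 0 <= lam.
  by apply: Rmult_le_pos; [lra | left; apply: Rinv_0_lt_compat; apply: pow_lt; lra].
have lamle := hn1 N (leq_maxr _ _); rewrite -/lam in lamle.
have lam1 := Rle_trans _ _ _ lamle (Rmin_l _ _).
have lam2 := Rle_trans _ _ _ lamle (Rmin_r _ _).
have hlam w : size w = N -> forall x y : I01,
     Rabs (phiw w x - phiw w y) <= lam * Rabs (x - y).
  by move=> hw x y; have := phiw_contr w x y; rewrite hw.
have qN : 0 < q ^ N <= 1.
  split; first by apply: pow_lt; lra.
  by rewrite -(pow1 N); apply: pow_incr; lra.
have qQ : 0 < q ^ Q <= 1.
  split; first by apply: pow_lt; lra.
  by rewrite -(pow1 Q); apply: pow_incr; lra.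
pose Kc := exp 1; have Kc1 : 1 <= Kc by apply: exp_ge1; lra.
pose th' := q ^ Q / (Kc * Kc).
have thP : 0 < th' <= 1.
  have KK : 1 <= Kc * Kc by nra.
  split; first by apply: Rdiv_lt_0_compat; lra.
  by apply: (Rmult_le_reg_r (Kc * Kc)); [lra | rewrite /th'; field_simplify; lra].
(* For |b| > 1 / del, cylinders of scale about 1 / |b|, which all meet [K], lie in the neighbourhood
   where [uni] gives its lower bound. *)
exists N, Q, (q ^ N * eta * th'), L0, (1 / del + 1); split => //.
- have : q ^ N * eta <= 1 / 2 by nra.
  have : 0 < q ^ N * eta by apply: Rmult_lt_0_compat; lra.
  by nra.
- by have := Rdiv_lt_0_compat 1 del; lra.
move=> s r hr hs hB f h hd.
set B := Rabs (Im s) in hB hd *.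
have delI : 0 < 1 / del by apply: Rdiv_lt_0_compat; lra.
have BP : 1 <= B by lra.
have Bdel : 1 / B <= del.
  apply: (Rmult_le_reg_l B); first lra.
  have -> : B * (1 / B) = 1 by field; lra.
  have e1 : (1 / del) * del = 1 by field; lra.
  by nra.
pose e := 8 * D * B.
have rhoal : rho = al / 4 by [].
have rhoP : 0 < rho by lra.
have L0s : L0 <= 1 / 8.
  by have := Rmult_le_compat_r L0 1 D ltac:(lra) D_ge1; lra.
have LP : 0 < B / rho by apply: Rdiv_lt_0_compat; lra.
have etaL : 2 * eta * (B / rho) <= e / 2.
  apply: (Rmult_le_reg_r rho) => //.
  have -> : 2 * eta * (B / rho) * rho = 2 * B * eta by field; lra.
  have := Rmult_le_compat_l (2 * B) _ _ ltac:(lra) eta3; rewrite /e; lra.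
have [h' [hd' hsq hgain]] := dominated_step s r hr hs N u v lam eta (B / rho) e (q ^ N) f h
  su sv uv hlam (conj lam0 lam1) erefl hd (conj etaP eta1) LP etaL (Rlt_le _ _ (proj1 qN))
  ltac:(by rewrite -su; exact: hq) ltac:(by rewrite -sv; exact: hq).
exists h' => //.
pose H := iter N M (fun y => h y * h y).
have H0 x : 0 <= H x.
  by apply: (iter_markov_ge0 A phi p p_pos) => y; exact: Rle_0_sqr.
(* The exponent of [H] carries the factor [lam], so on a cylinder of scale at most [L0 / |b|] its
   values agree up to [Kc] = exp 1. *)
have HL (x y : I01) : H x <= exp (4 * lam * D * B * 4 * Rabs (x - y)) * H y.
  rewrite /H !iter_markov big_distrr /=; apply: sumR_le => w; rewrite mem_words => /eqP hw.
  set E := exp _.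
  have -> : E * (pw w * (h (phiw w y) * h (phiw w y)))
     = pw w * (E * (h (phiw w y) * h (phiw w y))) by ring.
  apply: Rmult_le_compat_l; first by left; exact: pword_gt0.
  have h1 := dom_log_lipschitz _ _ _ hd (phiw w x) (phiw w y).
  have h0 := dom_ge0 _ _ _ hd (phiw w x); have h2 := dom_ge0 _ _ _ hd (phiw w y).
  have -> : E * (h (phiw w y) * h (phiw w y)) =
     (exp (8 * D * B * (lam * Rabs (x - y))) * h (phiw w y))
     * (exp (8 * D * B * (lam * Rabs (x - y))) * h (phiw w y)).
    have -> : E = exp (8 * D * B * (lam * Rabs (x - y)))
         * exp (8 * D * B * (lam * Rabs (x - y))).
      by rewrite /E -exp_plus; congr exp; ring.
    ring.
  have h3 : h (phiw w x) <= exp (8 * D * B * (lam * Rabs (x - y))) * h (phiw w y).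
    apply: Rle_trans h1 _; apply: Rmult_le_compat_r => //; apply: exp_le.
    apply: Rmult_le_compat_l; last exact: hlam.
    by apply: Rmult_le_pos; lra.
  by apply: Rmult_le_compat.
pose good (x : I01) := forall y : I01, B / rho * Rabs (x - y) < 1 -> cancels s r f h eta u v y.
(* [H] restricted to the points around which cancellation holds on the whole cutoff radius, exactly
   where the full loss is guaranteed. *)
pose Hg x := if excluded_middle_informative (good x) then H x else 0.
have Hg0 x : 0 <= Hg x.
  by rewrite /Hg; case: excluded_middle_informative => hx /=; [exact: H0 | lra].
have hh' x : h' x * h' x <= (growth r ^ N) ^ 2 * (H x + - (q ^ N * eta) * Hg x).
  have -> : h' x * h' x = h' x ^ 2 by ring.
  rewrite /Hg; case: excluded_middle_informative => hx /=.
    have -> : H x + - (q ^ N * eta) * H x = (1 - q ^ N * eta) * H x by ring.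
    exact: hgain.
  have -> : H x + - (q ^ N * eta) * 0 = H x by ring.
  exact: hsq.
have loc w : kk * (L0 / B) <= scale w <= L0 / B ->
   (forall x y, H (phiw w x) <= Kc * H (phiw w y)) /\
   exists2 v', size v' = Q & forall x, H (phiw w (phiw v' x)) <= Hg (phiw w (phiw v' x)).
  move=> [hw1 hw2].
  have diam (x y : I01) : B * Rabs (phiw w x - phiw w y) <= exp D * L0.
    have [_ h1] := phiw_dist w x y; have h2 := I01_dist x y; have h3 := Rabs_pos (x - y).
    have h4 := scale_gt0 w.
    have h5 : exp D * scale w * Rabs (x - y) <= exp D * (L0 / B).
      rewrite Rmult_assoc; apply: Rmult_le_compat_l; first lra.
      rewrite -[L0 / B]Rmult_1_r; apply: Rmult_le_compat; lra.
    have := Rmult_le_compat_l B _ _ ltac:(lra) (Rle_trans _ _ _ h1 h5).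
    by have -> : B * (exp D * (L0 / B)) = exp D * L0 by field; lra.
  split.
    move=> x y; apply: Rle_trans (HL _ _) _; apply: Rmult_le_compat_r => //.
    rewrite /Kc; apply: exp_le; have := diam x y; set t := Rabs (phiw w x - phiw w y) => ht.
    have -> : 4 * lam * D * B * 4 * t = 16 * lam * (D * (B * t)) by ring.
    have : D * (B * t) <= 1 / 8 by rewrite -L0E; apply: Rmult_le_compat_l; lra.
    have d0 : 0 <= D * (B * t) by repeat apply: Rmult_le_pos; try lra; exact: Rabs_pos.
    move=> d8; have := Rmult_le_compat (16 * lam) 4 _ _ ltac:(lra) d0 ltac:(lra) d8; lra.
  have key (x1 x2 y1 y2 : I01) :
      B / rho * Rabs (phiw w (phiw v1 x1) - y1) < 1 ->
      B / rho * Rabs (phiw w (phiw v2 x2) - y2) < 1 ->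
      cancels s r f h eta u v y1 \/ cancels s r f h eta u v y2.
    set z1 := phiw w _; set z2 := phiw w _ => hy1 hy2.
    have near (z y : I01) : B / rho * Rabs (z - y) < 1 -> B * Rabs (z - y) <= rho.
      move=> hzy; have := Rmult_lt_compat_l rho _ _ rhoP hzy.
      have -> : rho * (B / rho * Rabs (z - y)) = B * Rabs (z - y) by field; lra.
      lra.
    have {}hy1 := near _ _ hy1; have {}hy2 := near _ _ hy2.
    have low : al <= B * Rabs (z1 - z2).
      have [h1 _] := phiw_dist w (phiw v1 x1) (phiw v2 x2).
      have h2 := sep x1 x2.
      have h3 : exp (- D) * (kk * (L0 / B)) * d <= Rabs (z1 - z2).
        apply: Rle_trans h1; apply: Rmult_le_compat => //; try lra.
          have LB : 0 < L0 / B by apply: Rdiv_lt_0_compat; lra.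
          by apply: Rmult_le_pos; [lra | apply: Rmult_le_pos; lra].
        by apply: Rmult_le_compat_l; lra.
      have := Rmult_le_compat_l B _ _ ltac:(lra) h3.
      by have -> : B * (exp (- D) * (kk * (L0 / B)) * d) = al by rewrite /al; field; lra.
    have up : B * Rabs (z1 - z2) <= exp D * L0 by exact: diam.
    have up2 : B * Rabs (y1 - y2) <= exp D * L0 + 2 * rho.
      have t1 := I01_triangle y1 z1 y2; have t2 := I01_triangle z1 z2 y2.
      rewrite (Rabs_minus_sym y1 z1) in t1.
      have := Rmult_le_compat_l B _ _ ltac:(lra) (Rle_trans _ _ _ t1 (Rplus_le_compat_l _ _ _ t2)).
      rewrite !Rmult_plus_distr_l; lra.
    have low2 : al - 2 * rho <= B * Rabs (y1 - y2).
      have t1 := I01_triangle z1 y1 z2; have t2 := I01_triangle y1 y2 z2.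
      rewrite (Rabs_minus_sym y2 z2) in t2.
      have := Rmult_le_compat_l B _ _ ltac:(lra) (Rle_trans _ _ _ t1 (Rplus_le_compat_l _ _ _ t2)).
      rewrite !Rmult_plus_distr_l; lra.
    have close (z y : I01) k : z = phiw w k -> B * Rabs (z - y) <= rho ->
       Rabs (y - phiw w k1) <= del.
      move=> -> hzy; apply: Rle_trans Bdel.
      have := I01_triangle y (phiw w k) (phiw w k1); have := diam k k1.
      rewrite (Rabs_minus_sym y (phiw w k)) => h2 h1.
      apply: (Rmult_le_reg_l B); first lra.
      have -> : B * (1 / B) = 1 by field; lra.
      have := Rmult_le_compat_l B _ _ ltac:(lra) h1.
      rewrite Rmult_plus_distr_l; lra.
    have hu := huni (phiw w k1) y1 y2 (K_maps w _ K_k1)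
       (close _ _ _ erefl hy1) (close _ _ _ erefl hy2).
    have hDel : Rabs ((thw u y1 - thw v y1) - (thw u y2 - thw v y2)) <= 2 * D * Rabs (y1 - y2).
      have -> : (thw u y1 - thw v y1) - (thw u y2 - thw v y2)
         = (thw u y1 - thw u y2) + - (thw v y1 - thw v y2) by ring.
      apply: Rle_trans (Rabs_triang _ _) _; rewrite Rabs_Ropp.
      by have := thw_lipschitz u y1 y2; have := thw_lipschitz v y1 y2; lra.
    have DB : D * (B * Rabs (y1 - y2)) <= 1 / 4.
      have : D * (B * Rabs (y1 - y2)) <= D * (exp D * L0 + 2 * rho).
        by apply: Rmult_le_compat_l; lra.
      have Dal := Rmult_le_compat_l D _ _ ltac:(lra) alle.
      by rewrite Rmult_plus_distr_l L0E rhoal; lra.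
    have yP := Rabs_pos (y1 - y2).
    apply: (cancels_or s r hr e eta sg (2 * lam) lam f h u v y1 y2 hd) => //; try lra.
    - by rewrite su sv.
    - by rewrite /e; repeat apply: Rmult_le_pos; lra.
    - by move=> z; rewrite !inE => /orP [/eqP -> | /eqP ->]; apply: hlam.
    - have -> : e * (lam * Rabs (y1 - y2)) = 8 * lam * (D * (B * Rabs (y1 - y2))).
        by rewrite /e; ring.
      have := Rmult_le_compat_l (8 * lam) _ _ ltac:(lra) DB; lra.
    - rewrite -/B; have := Rmult_le_compat_l B _ _ ltac:(lra) hDel; lra.
    - rewrite -/B.
      have h1 : c1 * (al / 2) <= B * Rabs ((thw u y1 - thw v y1) - (thw u y2 - thw v y2)).
        have := Rmult_le_compat_l B _ _ ltac:(lra) hu.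
        have := Rmult_le_compat_l c1 _ _ ltac:(lra) low2; rewrite rhoal; lra.
      by have := Rmult_lt_0_compat _ _ c1_gt0 alP; rewrite /sg in lam2 *; lra.
  (* A single failure near the subcylinder of [v1] suffices: by [key] it forces cancellation near
     every point of the subcylinder of [v2]. *)
  have [all1|nall] := classic (forall x, good (phiw w (phiw v1 x))).
    exists v1 => // x; rewrite /Hg.
    by case: excluded_middle_informative => [g|/(_ (all1 x)) //] /=; lra.
  exists v2; first by rewrite -v12.
  have [x1 hx1] := not_all_ex_not _ _ nall.
  have [y1 hy1] := not_all_ex_not _ _ hx1.
  have [hn nc] := imply_to_and _ _ hy1.
  move=> x; rewrite /Hg; case: excluded_middle_informative => [g|] /=; first lra.
  case=> y2 hy2.
  by have [|] := key _ _ _ _ hn hy2.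
move=> m j hm hj x.
have sc0 : kk * (L0 / B) <= scale [::].
  rewrite /scale /= exp_0; apply: (Rmult_le_reg_l B); first lra.
  have -> : B * (kk * (L0 / B)) = kk * L0 by field; lra.
  have := Rmult_le_compat kk 1 L0 1 ltac:(lra) ltac:(lra) kk1 ltac:(lra); lra.
have := markov_localize q Q m (L0 / B) Kc H Hg ltac:(lra) hq ltac:(lra) H0 Hg0 hm loc
   j [::] (leq0n _) sc0 hj x => /= hloc.
have {}hloc : th' * iter j M H x <= iter j M Hg x.
  apply: (Rmult_le_reg_l (Kc * Kc)); first by apply: Rmult_lt_0_compat; lra.
  by have -> : Kc * Kc * (th' * iter j M H x) = q ^ Q * iter j M H x
    by rewrite /th'; field; lra.
apply: (Rle_trans _ _ _ (iter_markov_le A phi p p_pos j _ _ x hh')).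
rewrite iter_markov_scal iter_markov_plus iter_markov_scal iterD -/H Rmult_assoc.
apply: Rmult_le_compat_l; first exact: pow2_ge_0.
have qe : 0 < q ^ N * eta by apply: Rmult_lt_0_compat; lra.
have := Rmult_le_compat_l _ _ _ (Rlt_le _ _ qe) hloc; lra.
Qed.

(** * Iteration and decay for all times *)

Lemma pow_between (Y : R) : 0 < Y -> exists m : nat, Y <= gam ^ m <= gam * (1 + Y).
Proof.
move=> Y0.
have [n hn] := Pow_x_infinity gam ltac:(by rewrite Rabs_pos_eq; lra) Y.
have := hn n (le_n n); rewrite Rabs_pos_eq => [/Rge_le|]; last by apply: pow_le; lra.
elim: n {hn} => [|n IH] /= h; first by exists 0%nat => /=; nra.
have [|lt] := Rle_dec Y (gam ^ n); first exact: IH.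
by exists n.+1 => /=; split => //; nra.
Qed.

(** Each use of [step] raises the averaging exponent by [N], so the condition [m + Q <= j], once
    true, holds for all earlier blocks. For k = 0 nothing is gained and j is free. *)
Lemma iterated_contraction (N Q m : nat) (theta rho L0 : R) (s : C) (r : R)
  (f : I01 -> C) (h : I01 -> R) :
  (forall f h, dominated (8 * D * Rabs (Im s)) f h ->
   exists2 h', dominated (8 * D * Rabs (Im s)) (iter N (T s) f) h' &
   forall m j : nat, (forall w, (m <= size w)%nat -> scale w <= L0 / Rabs (Im s)) ->
    (m + Q <= j)%nat -> forall x,
    iter j M (fun y => h' y * h' y) x
      <= (growth r ^ N) ^ 2 * (1 - theta) * iter (j + N) M (fun y => h y * h y) x) ->
  (forall w, (m <= size w)%nat -> scale w <= L0 / Rabs (Im s)) ->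
  0 <= rho -> (growth r ^ N) ^ 2 * (1 - theta) <= rho ->
  dominated (8 * D * Rabs (Im s)) f h ->
  forall k : nat, exists2 h', dominated (8 * D * Rabs (Im s)) (iter (k * N) (T s) f) h' &
  forall j : nat, k = 0%nat \/ (m + Q <= j)%nat -> forall x,
    iter j M (fun y => h' y * h' y) x
      <= rho ^ k * iter (j + k * N) M (fun y => h y * h y) x.
Proof.
move=> step hm rho0 hrho hd; elim=> [|k [h1 hd1 IH]].
  by exists h => // j _ x; rewrite mul0n addn0 /=; lra.
have [h2 hd2 H2] := step _ _ hd1.
exists h2; first by rewrite mulSn iterD.
move=> j [//|hj] x.
apply: Rle_trans (H2 m j hm hj x) _.
have pos : 0 <= iter (j + N) M (fun y => h1 y * h1 y) x.
  by apply: (iter_markov_ge0 A phi p p_pos) => y; exact: Rle_0_sqr.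
apply: Rle_trans (Rmult_le_compat_r _ _ _ pos hrho) _.
rewrite /= Rmult_assoc; apply: Rmult_le_compat_l => //.
have := IH (j + N)%nat (or_intror _) x.
by rewrite mulSn addnA; apply; lia.
Qed.

Lemma exp_mul_nat (x : R) (n : nat) : exp x ^ n = exp (INR n * x).
Proof.
elim: n => [|n IH]; first by rewrite /= Rmult_0_l exp_0.
by rewrite /= IH -exp_plus -/(INR n.+1) S_INR; congr exp; ring.
Qed.

Lemma bernoulli_pow (x : R) (n : nat) : 0 <= x <= 1 -> 1 - INR n * x <= (1 - x) ^ n.
Proof.
move=> hx; elim: n => [|n IH]; first by rewrite /= Rmult_0_l; lra.
rewrite S_INR /=; have := pos_INR n => n0.
have := Rmult_le_compat_l (1 - x) _ _ ltac:(lra) IH; nra.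
Qed.

Lemma weighted_decay :
  exists rho0 r0 b0 C0 : R, [/\ 0 < rho0 < 1, 0 < r0, 1 <= b0, 0 < C0 &
  forall s : C, Rabs (Re s) < r0 -> b0 < Rabs (Im s) -> forall (n : nat) (f : I01 -> C) (Nf : R),
    (forall x, Cmod (f x) <= Nf) ->
    (forall x y : I01, Cmod (f x - f y) <= Rabs (Im s) * Nf * Rabs (x - y)) ->
    let X := C0 * rho0 ^ n * sqrt (Rabs (Im s)) * Nf in
    (forall x, Cmod (iter n (T s) f x) <= X) /\
    (forall x y : I01, Cmod (iter n (T s) f x - iter n (T s) f y)
       <= X * (exp ((2 * D + 8 * D * c) * Rabs (Im s) * Rabs (x - y)) - 1))].
Proof.
have [N [Q [theta [L0 [B0 [NP th01 L0P B0P step]]]]]] := one_step_contraction.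
have NR : 0 < INR N by apply: lt_0_INR; lia.
(* Each of the roughly ln |b| / ln gam steps without gain costs one factor g for [growth] and one
   for 1 / rho0. With g = gam^(1/4) the total is of order |b|^(1/2). *)
pose g := sqrt (sqrt gam).
have sg1 : 1 < sqrt gam by rewrite -sqrt_1; apply: sqrt_lt_1; lra.
have g1 : 1 < g by rewrite /g -sqrt_1; apply: sqrt_lt_1; lra.
have gg : g * g = sqrt gam by rewrite /g sqrt_sqrt; lra.
have lng : 0 < ln g by rewrite -ln_1; apply: ln_increasing; lra.
(* The first entry gives [growth] <= g. The second gives growth^(2N) <= exp (theta / 2), which keeps
   half of the gain theta. *)
pose r0 := Rmin (ln g / kap) (theta / 2 / (2 * INR N * kap)).
have NK : 0 < 2 * INR N * kap by apply: Rmult_lt_0_compat; lra.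
have r0P : 0 < r0.
  by apply: Rmin_pos; apply: Rdiv_lt_0_compat; lra.
have growth_g : growth r0 <= g.
  rewrite -(exp_ln g); last lra.
  apply: exp_le; have := Rmult_le_compat_r kap _ _ ltac:(lra) (Rmin_l _ _ : r0 <= ln g / kap).
  by have -> : ln g / kap * kap = ln g by field; lra.
have growth1 : 1 <= growth r0 by apply: exp_ge1; nra.
pose rho := 1 - theta / 2.
have growth_rho : (growth r0 ^ N) ^ 2 * (1 - theta) <= rho.
  have h1 : (growth r0 ^ N) ^ 2 <= exp (theta / 2).
    rewrite /growth !exp_mul_nat; apply: exp_le.
    have := Rmult_le_compat_r _ _ _ (Rlt_le _ _ NK)
      (Rmin_r _ _ : r0 <= theta / 2 / (2 * INR N * kap)).
    have -> : theta / 2 / (2 * INR N * kap) * (2 * INR N * kap) = theta / 2 by field; lra.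
    rewrite /=; lra.
  have h2 : exp (theta / 2) * (1 - theta / 2) <= 1.
    have := exp_ineq1_le (- (theta / 2)); rewrite exp_Ropp => h2.
    have e0 := exp_pos (theta / 2).
    have := Rmult_le_compat_l _ _ _ (Rlt_le _ _ e0) h2; rewrite Rinv_r; lra.
  apply: Rle_trans (Rmult_le_compat_r _ _ _ _ h1) _; first lra.
  have h3 : 1 - theta <= (1 - theta / 2) * (1 - theta / 2) by nra.
  have := Rmult_le_compat_l _ _ _ (Rlt_le _ _ (exp_pos (theta / 2))) h3.
  have := Rmult_le_compat_r (1 - theta / 2) _ _ ltac:(lra) h2.
  rewrite /rho; lra.
(* By Bernoulli's inequality the first entry gives rho0^(2N) >= rho; the exponent 2N instead of N
   reflects the return from squares to first powers. *)
pose rho0 := Rmax (1 - theta / (4 * INR N)) (/ g).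
have ginv : 0 < / g < 1.
  by split; [apply: Rinv_0_lt_compat; lra | rewrite -Rinv_1; apply: Rinv_lt_contravar; lra].
have thN : 0 < theta / (4 * INR N) < 1.
  have N1 : 1 <= INR N by apply: (le_INR 1); lia.
  split; first by apply: Rdiv_lt_0_compat; lra.
  apply: (Rmult_lt_reg_r (4 * INR N)); first lra.
  by have -> : theta / (4 * INR N) * (4 * INR N) = theta by [field; lra]; lra.
have rho0P : 0 < rho0 < 1.
  split; last by apply: Rmax_lub_lt; lra.
  by have := Rmax_r (1 - theta / (4 * INR N)) (/ g); rewrite -/rho0; lra.
have rho0g : 1 <= rho0 * g.
  have := Rmult_le_compat_r g _ _ ltac:(lra) (Rmax_r _ _ : / g <= rho0).
  by rewrite Rinv_l; lra.
have rho_rho0 : rho <= (rho0 ^ N) ^ 2.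
  have -> : (rho0 ^ N) ^ 2 = rho0 ^ (N * 2) by rewrite pow_mult.
  have h1 : (1 - theta / (4 * INR N)) ^ (N * 2) <= rho0 ^ (N * 2).
    by apply: pow_incr; split; [lra | exact: Rmax_l].
  apply: Rle_trans h1; have h2 := bernoulli_pow _ (N * 2)
    (conj (Rlt_le _ _ (proj1 thN)) (Rlt_le _ _ (proj2 thN))).
  apply: Rle_trans h2; rewrite mult_INR /rho.
  have -> : INR N * INR 2 * (theta / (4 * INR N)) = theta / 2 by rewrite /=; field; lra.
  lra.
pose Cm := gam * (1 + c / L0).
have CmP : 0 < Cm by apply: Rmult_lt_0_compat; [lra | have := Rdiv_lt_0_compat _ _ c_gt0 L0P; lra].
pose C0 := sqrt gam ^ (Q + N) * sqrt Cm.
have C0P : 0 < C0.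
  by apply: Rmult_lt_0_compat; [apply: pow_lt; lra | exact: sqrt_lt_R0].
exists rho0, r0, (B0 + 1 + r0), C0; split => //; first lra.
move=> s hs hb n f Nf hf1 hf2 X.
set B := Rabs (Im s) in hb hf2 X *.
have BP : 0 < B by lra.
have Nf0 : 0 <= Nf by apply: Rle_trans (hf1 I01_0); exact: Cmod_ge_0.
have hd0 : dominated (8 * D * B) f (fun=> Nf).
  have DB : B <= 8 * D * B by nra.
  have big (x y : I01) : B * Rabs (x - y) <= exp (8 * D * B * Rabs (x - y)) - 1.
    have := exp_ineq1_le (8 * D * B * Rabs (x - y)).
    have := Rmult_le_compat_r _ _ _ (Rabs_pos (x - y)) DB; lra.
  have bt (x y : I01) : 0 <= B * Rabs (x - y) by apply: Rmult_le_pos; [lra | exact: Rabs_pos].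
  split => // x y.
    have := big x y; have := bt x y => h1 h2.
    by have := Rmult_le_compat_r Nf 1 (exp (8 * D * B * Rabs (x - y))) ltac:(lra) ltac:(lra); lra.
  apply: Rle_trans (hf2 x y) _.
  by have := Rmult_le_compat_l _ _ _ Nf0 (big x y); lra.
have Y0 : 0 < c * B / L0.
  by apply: Rdiv_lt_0_compat => //; exact: Rmult_lt_0_compat.
have [m [hm1 hm2]] := pow_between _ Y0.
have hmw w : (m <= size w)%nat -> scale w <= L0 / B.
  move=> hw; apply: Rle_trans (thw_contracting w I01_0) _.
  have h1 : gam ^ m <= gam ^ size w by apply: Rle_pow; [lra | lia].
  have h2 : 0 < gam ^ size w by apply: pow_lt; lra.
  apply: (Rmult_le_reg_r (gam ^ size w)) => //.
  rewrite Rmult_assoc Rinv_l ?Rmult_1_r; last lra.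
  have LB : 0 < L0 / B by apply: Rdiv_lt_0_compat.
  have := Rmult_le_compat_l _ _ _ (Rlt_le _ _ LB) (Rle_trans _ _ _ hm1 h1).
  by have -> : L0 / B * (c * B / L0) = c by field; lra.
have hgm : sqrt (gam ^ m) <= sqrt Cm * sqrt B.
  rewrite -sqrt_mult; [|lra|lra]; apply: sqrt_le_1_alt; apply: Rle_trans hm2 _.
  rewrite /Cm Rmult_assoc; apply: Rmult_le_compat_l; first lra.
  have -> : (1 + c / L0) * B = B + c * B / L0 by field; lra.
  lra.
have Re_Im : Rabs (Re s) <= Rabs (Im s) by rewrite -/B; lra.
(* Subtraction is truncated: for n < m + Q the number of blocks is 0 and the bound rests on [growth]
   alone. *)
have [h' hd' H'] := iterated_contraction N Q m theta rho L0 s r0 f (fun=> Nf)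
   (step s r0 (Rlt_le _ _ hs) Re_Im ltac:(by rewrite -/B; lra)) hmw
   ltac:(by rewrite /rho; lra) growth_rho hd0 ((n - (m + Q)) %/ N)%nat.
set k := ((n - (m + Q)) %/ N)%nat in hd' H'.
have kN : (k * N <= n - (m + Q))%nat by exact: leq_divM.
have kN2 : (n - (m + Q) < k.+1 * N)%nat by exact: ltn_ceil.
pose m' := (n - k * N)%nat.
have nE : n = (m' + k * N)%nat by rewrite /m'; lia.
have m'le : (m' <= m + (Q + N))%nat by rewrite /m'; lia.
have hm' : k = 0%nat \/ (m + Q <= m')%nat.
  by case: (k) kN => [|k'] kN'; [left | right; rewrite /m'; nia].
have avg x : iter m' M h' x <= rho0 ^ (k * N) * Nf.
  have h1 := iter_markov_sqr A phi p p_pos p_sum m' h' x.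
  have h2 := H' m' hm' x; rewrite (iter_markov_const A phi p p_sum) in h2.
  have h3 : rho ^ k <= (rho0 ^ (k * N)) ^ 2.
    have -> : (rho0 ^ (k * N)) ^ 2 = ((rho0 ^ N) ^ 2) ^ k.
      by rewrite -!pow_mult; congr pow; lia.
    by apply: pow_incr; rewrite /rho in rho_rho0 *; lra.
  have p0 : 0 <= rho0 ^ (k * N) * Nf by apply: Rmult_le_pos => //; apply: pow_le; lra.
  have NN : 0 <= Nf * Nf by nra.
  have h4 := Rmult_le_compat_r _ _ _ NN h3.
  apply: Rnot_lt_le => hlt.
  by have := Rmult_le_0_lt_compat _ _ _ _ p0 p0 hlt hlt; lra.
have main x : growth r0 ^ m' * iter m' M h' x <= X.
  have gm0 : 0 < growth r0 ^ m' by apply: pow_lt; lra.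
  have gm : growth r0 ^ m' <= g ^ m' by apply: pow_incr; lra.
  have g0 : 0 < g ^ m' by apply: pow_lt; lra.
  have r1 : 1 <= rho0 ^ m' * g ^ m'.
    by rewrite -Rpow_mult_distr; apply: pow_R1_Rle; lra.
  have k0 : 0 <= rho0 ^ (k * N) * Nf by apply: Rmult_le_pos => //; apply: pow_le; lra.
  have h1 : rho0 ^ (k * N) * Nf <= rho0 ^ n * Nf * g ^ m'.
    rewrite [in X in _ <= X]nE Rdef_pow_add.
    have := Rmult_le_compat_r _ _ _ k0 r1; lra.
  have n0 : 0 <= rho0 ^ n * Nf by apply: Rmult_le_pos => //; apply: pow_le; lra.
  have h2 : g ^ m' * g ^ m' <= C0 * sqrt B.
    rewrite -Rpow_mult_distr gg.
    have h3 : sqrt gam ^ m' <= sqrt gam ^ (m + (Q + N)) by apply: Rle_pow; [lra | lia].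
    apply: Rle_trans h3 _; rewrite Rdef_pow_add.
    have -> : sqrt gam ^ m = sqrt (gam ^ m).
      elim: (m) => [|i IH] /=; first by rewrite sqrt_1.
      by rewrite sqrt_mult ?IH; [|lra|apply: pow_le; lra].
    have pQ : 0 <= sqrt gam ^ (Q + N) by apply: pow_le; lra.
    have := Rmult_le_compat_l _ _ _ pQ hgm; rewrite /C0; lra.
  have hx := avg x.
  apply: (Rle_trans _ (g ^ m' * (rho0 ^ n * Nf * g ^ m'))).
    apply: Rmult_le_compat => //; [lra | | lra].
    by apply: (iter_markov_ge0 A phi p p_pos) => y; exact: dom_ge0 hd' y.
  have := Rmult_le_compat_l _ _ _ n0 h2; rewrite /X; lra.
have itE x : iter n (T s) f x = iter m' (T s) (iter (k * N) (T s) f) x.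
  by rewrite -iterD -nE.
split=> [x|x y]; rewrite !itE.
  apply: Rle_trans (main x).
  exact: (iter_weighted_le s r0 (Rlt_le _ _ hs) _ _ _ _ _ hd').
(* The number m' of final steps may be 0, so the contraction factor is bounded only by [c]; hence
   the term 8 D c in the modulus. *)
have := iter_weighted_sub s r0 (Rlt_le _ _ hs) Re_Im m' c (8 * D * B) _ h' x y _
  (Rlt_le _ _ c_gt0) _ hd'.
rewrite -/B => hsub.
apply: (Rle_trans _ _ _ (hsub _ _)).
- move=> w hw x1 y1; apply: Rle_trans (phiw_contr w x1 y1) _.
  apply: Rmult_le_compat_r; first exact: Rabs_pos.
  rewrite -[X in _ <= X]Rmult_1_r; apply: Rmult_le_compat_l; first lra.
  rewrite -[X in _ <= X]Rinv_1; apply: Rinv_le_contravar; first lra.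
  by apply: pow_R1_Rle; lra.
- by apply: Rmult_le_pos; lra.
have -> : (2 * D * B + 8 * D * B * c) * Rabs (x - y)
   = (2 * D + 8 * D * c) * B * Rabs (x - y) by ring.
apply: Rmult_le_compat_r; last exact: main.
have : 1 <= exp ((2 * D + 8 * D * c) * B * Rabs (x - y)); last lra.
apply: exp_ge1; have := Rabs_pos (x - y) => ?.
by repeat apply: Rmult_le_pos => //; nra.
Qed.

End System.

(** * Words of a contracting system *)

Lemma is_derive01_ival (x : I01) : is_derive01 (V := R_NormedModule) ival x 1.
Proof.
apply/is_derive01_carath; exists (fun=> 1); split => //; first exact: continuous_const.
by move=> y; rewrite /plus /scal /= /mult /=; ring.
Qed.

Section IFS.
Variables (A : finType) (Phi : contracting_ifs A).

Notation "'phiw'" := (word_map Phi).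

Definition log_deriv (a : A) (x : I01) : R := ln (Rabs (D1 (Phi a) x)).

Notation "'thw'" := (thword A Phi log_deriv).

Lemma word_C1 (w : seq A) : is_C1R (fun x => ival (phiw w x)).
Proof.
elim: w => [|a w IH].
  apply: (@is_C1_intro R_CompleteNormedModule _ (fun=> 1)) => x.
    exact: is_derive01_ival.
  exact: continuous_const.
exact: (is_C1_compI (V := R_CompleteNormedModule) (proj1 (ifs_C2 Phi a)) IH).
Qed.

Lemma is_derive_word (w : seq A) (x : I01) :
  is_derive01 (V := R_NormedModule) (fun y => ival (phiw w y)) x (D1 (phiw w) x).
Proof.
exact: (deriv01_correct (V := R_CompleteNormedModule)) (proj1 (word_C1 w) x).
Qed.

Lemma D1_nil (x : I01) : D1 (phiw [::]) x = 1.
Proof.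
exact: (is_derive01_unique (V := R_CompleteNormedModule)) (is_derive01_ival x).
Qed.

Lemma D1_cons (a : A) (w : seq A) (x : I01) :
  D1 (phiw (a :: w)) x = D1 (phiw w) x * D1 (Phi a) (phiw w x).
Proof.
apply: (is_derive01_unique (V := R_CompleteNormedModule)).
have da : is_derive01 (V := R_NormedModule) (fun y => ival (Phi a y)) (phiw w x)
    (D1 (Phi a) (phiw w x)).
  exact: (deriv01_correct (V := R_CompleteNormedModule)) (proj1 (proj1 (ifs_C2 Phi a)) _).
exact: (is_derive01_compI (V := R_NormedModule) da (is_derive_word w x)).
Qed.

Lemma D1_word_neq0 (w : seq A) (x : I01) : D1 (phiw w) x <> 0.
Proof.
elim: w x => [|a w IH] x; first by rewrite D1_nil; lra.
by rewrite D1_cons; apply: Rmult_integral_contrapositive; split => //; exact: ifs_D1_neq0.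
Qed.

Lemma thwE (w : seq A) (x : I01) : thw w x = ln (Rabs (D1 (phiw w) x)).
Proof.
elim: w => [|a w IH] /=; first by rewrite D1_nil Rabs_R1 ln_1.
rewrite D1_cons Rabs_mult ln_mult ?IH /log_deriv; first by ring.
  by apply: Rabs_pos_lt; exact: D1_word_neq0.
by apply: Rabs_pos_lt; exact: ifs_D1_neq0.
Qed.

Lemma exp_thw (w : seq A) (x : I01) : exp (thw w x) = Rabs (D1 (phiw w) x).
Proof. by rewrite thwE exp_ln //; apply: Rabs_pos_lt; exact: D1_word_neq0. Qed.

Lemma D1_word_C1 (w : seq A) : is_C1R (D1 (phiw w)).
Proof.
elim: w => [|a w IH].
  have -> : D1 (phiw [::]) = fun=> 1 by apply: functional_extensionality => x; exact: D1_nil.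
  exact: (is_C1_const (V := R_CompleteNormedModule)).
have -> : D1 (phiw (a :: w)) = fun x => D1 (phiw w) x * D1 (Phi a) (phiw w x).
  by apply: functional_extensionality => x; exact: D1_cons.
apply: is_C1R_mult => //.
exact: (is_C1_compI (V := R_CompleteNormedModule) (proj2 (ifs_C2 Phi a)) (word_C1 w)).
Qed.

(** The derivative of ln |phi_w'|; its difference between two words is the quantity in UNI. *)
Definition distortion (w : seq A) (x : I01) : R := D2 (phiw w) x / D1 (phiw w) x.

Lemma is_derive_thw (w : seq A) (x : I01) :
  is_derive01 (V := R_NormedModule) (thw w) x (distortion w x).
Proof.
have -> : thw w = fun y => ln (Rabs (D1 (phiw w) y)).
  by apply: functional_extensionality => y; exact: thwE.
apply: (is_derive01_compR (h := fun t => ln (Rabs t))).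
  exact: is_derive_ln_abs (D1_word_neq0 w x).
exact: (deriv01_correct (V := R_CompleteNormedModule)) (proj1 (D1_word_C1 w) x).
Qed.

Lemma continuous_distortion (w : seq A) (x : I01) : continuous (distortion w) x.
Proof.
apply: (continuous_mult (K := R_AbsRing)); first exact: (proj2 (D1_word_C1 w)).
apply: continuous_comp.
  exact: (is_C1_continuous (V := R_CompleteNormedModule)) (D1_word_C1 w).
exact: continuous_Rinv (D1_word_neq0 w x).
Qed.

Lemma word_mvt (w : seq A) (x y : I01) :
  exists z : I01, Rabs (phiw w x - phiw w y) = exp (thw w z) * Rabs (x - y).
Proof.
have [z e _] := MVT01 _ _ y x (is_derive_word w).
by exists z; rewrite exp_thw -Rabs_mult -e.
Qed.

Lemma ifs_word_contracting : exists gam c, [/\ 1 < gam, 0 < c &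
  forall w x, exp (thw w x) <= c * / gam ^ size w].
Proof.
have [gam [gam1 [c0 [c [h1 h2 _ c_gt0 h]]]]] := ifs_contracting Phi.
exists gam, c; split => // w x.
by rewrite exp_thw; have [_] := h (size w) (in_tuple w) x.
Qed.

Lemma log_deriv_bounded : exists2 kap, 0 < kap & forall a x, Rabs (log_deriv a x) <= kap.
Proof.
have [kap hk] : exists kap, forall a, forall x, Rabs (log_deriv a x) <= kap.
  apply: finite_bound; first by move=> a M M' hM h x; exact: Rle_trans (h x) hM.
  move=> a; apply: continuous01_bounded => x.
  have := is_derive01_continuous (is_derive_thw [:: a] x).
  by apply: continuous_ext => y; rewrite /= Rplus_0_r.
exists (Rmax 1 kap); first by have := Rmax_l 1 kap; lra.
by move=> a x; exact: Rle_trans (hk a x) (Rmax_r _ _).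
Qed.

(* The distortion of a word is a sum over its letters of single-map distortions damped
   by the contraction of the suffixes, hence bounded by a geometric series. *)
Lemma thw_uniformly_lipschitz :
  exists2 D, 1 <= D & forall w (x y : I01), Rabs (thw w x - thw w y) <= D * Rabs (x - y).
Proof.
have [gam [c [gam1 c0 hc]]] := ifs_word_contracting.
have [D0 hD0] : exists D0, forall a, forall x, Rabs (distortion [:: a] x) <= D0.
  apply: finite_bound; first by move=> a M M' hM h x; exact: Rle_trans (h x) hM.
  by move=> a; apply: continuous01_bounded; exact: continuous_distortion.
pose M := Rmax 0 D0; have M0 : 0 <= M by exact: Rmax_l.
have lip a (x y : I01) : Rabs (log_deriv a x - log_deriv a y) <= M * Rabs (x - y).
  have e z : log_deriv a z = thw [:: a] z by rewrite /= Rplus_0_r.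
  rewrite !e; have [z -> _] := MVT01 _ _ y x (is_derive_thw [:: a]).
  rewrite Rabs_mult; apply: Rmult_le_compat_r; first exact: Rabs_pos.
  exact: Rle_trans (hD0 a z) (Rmax_r _ _).
have gi : 0 < / gam < 1.
  by split; [apply: Rinv_0_lt_compat; lra | rewrite -Rinv_1; apply: Rinv_lt_contravar; lra].
have gm : 0 < 1 - / gam by lra.
pose S := M * c / (1 - / gam).
have bound w : forall x y : I01,
    Rabs (thw w x - thw w y) <= S * (1 - (/ gam) ^ size w) * Rabs (x - y).
  elim: w => [|a w IH] x y /=; first by rewrite Rminus_diag Rabs_R0; lra.
  have h1 := lip a (phiw w x) (phiw w y).
  have h2 : Rabs (phiw w x - phiw w y) <= c * (/ gam) ^ size w * Rabs (x - y).
    have [z ->] := word_mvt w x y; apply: Rmult_le_compat_r; first exact: Rabs_pos.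
    by rewrite pow_inv; exact: hc.
  have h3 := Rmult_le_compat_l _ _ _ M0 h2.
  have -> : log_deriv a (phiw w x) + thw w x - (log_deriv a (phiw w y) + thw w y)
    = (log_deriv a (phiw w x) - log_deriv a (phiw w y)) + (thw w x - thw w y) by ring.
  apply: Rle_trans (Rabs_triang _ _) _; have := IH x y.
  have -> : S * (1 - / gam * (/ gam) ^ size w) * Rabs (x - y)
    = M * (c * (/ gam) ^ size w * Rabs (x - y)) + S * (1 - (/ gam) ^ size w) * Rabs (x - y).
    by rewrite /S; field; lra.
  lra.
have S0 : 0 <= S by apply: Rmult_le_pos; [nra | left; exact: Rinv_0_lt_compat].
exists (S + 1); first lra.
move=> w x y; apply: Rle_trans (bound w x y) _; apply: Rmult_le_compat_r; first exact: Rabs_pos.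
have : 0 <= (/ gam) ^ size w by apply: pow_le; lra.
by nra.
Qed.

(** UNI bounds the derivative of the phase difference only on [K]. Uniform continuity carries half
    of the bound to a neighbourhood whose radius depends on the words, and the mean value theorem
    integrates it along the segment from x to y. The words differ because the quantity in UNI would
    vanish on equal ones. *)
Lemma uni_phase (K : I01 -> Prop) : (exists x, K x) -> UNI Phi K ->
  exists (c1 : R) (N0 : nat), 0 < c1 /\
  forall N, (N0 <= N)%nat -> exists u v delta,
  [/\ size u = N, size v = N, u != v, 0 < delta &
   forall k x y : I01, K k -> Rabs (x - k) <= delta -> Rabs (y - k) <= delta ->
     c1 * Rabs (x - y) <= Rabs ((thw u x - thw v x) - (thw u y - thw v y))].
Proof.
move=> [k0 Kk0] [c1 [c2 [c1P _ [N0 hN]]]].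
exists (c1 / 2), N0; split; first lra.
move=> N /hN [u [v huv]].
pose g x := distortion u x - distortion v x.
have cg x : continuous g x.
  by apply: (continuous_minus (V := R_NormedModule)); exact: continuous_distortion.
have [d d0 hd] := continuous01_uniform g (c1 / 2) ltac:(lra) cg.
exists u, v, (d / 2); split; try lra; try exact: size_tuple.
  apply/eqP => e; have [h _] := huv k0 Kk0; move: h.
  by rewrite e Rminus_diag Rabs_R0; lra.
move=> k x y Kk hx hy.
have dpsi z : is_derive01 (V := R_NormedModule) (fun z => thw u z + -1 * thw v z) z
   (distortion u z + -1 * distortion v z).
  apply: (is_derive01_plus (V := R_NormedModule)); first exact: is_derive_thw.
  exact: is_derive01_scalR (is_derive_thw _ _).
have [z e hz] := MVT01 _ _ y x dpsi.
have -> : (thw u x - thw v x) - (thw u y - thw v y)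
  = thw u x + -1 * thw v x - (thw u y + -1 * thw v y) by ring.
rewrite e Rabs_mult; apply: Rmult_le_compat_r; first exact: Rabs_pos.
have -> : distortion u z + -1 * distortion v z = g z by rewrite /g; ring.
have zk : Rabs (k - z) < d.
  move: hz hx hy => hz /Rabs_le_between hx /Rabs_le_between hy.
  by apply: Rabs_def1; move: hz; rewrite /Rmin /Rmax; case: Rle_dec; lra.
have [h1 _] := huv k Kk; have h2 := hd _ _ zk.
have {}h1 : c1 <= Rabs (g k) by exact: h1.
have := Rabs_triang (g k - g z) (g z); have -> : g k - g z + g z = g k by ring.
lra.
Qed.

Lemma iter_transfer (p : A -> R) (s : C) (n : nat) (f : C1fun) (x : I01) :
  iter n (transfer Phi p s) f x = iter n (weighted A Phi p log_deriv s) f x.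
Proof.
elim: n x => [//|n IH] x /=.
by rewrite /transfer_fun /weighted; apply: eq_bigr => a _; rewrite IH.
Qed.

Lemma ifs_norm_decay (K : I01 -> Prop) (p : A -> R) :
  is_attractor Phi K -> (~ exists x : I01, forall y : I01, K y <-> y = x) -> UNI Phi K ->
  (forall a : A, 0 < p a) -> \big[Rplus/0]_(a : A) p a = 1 ->
  exists rho0 : R, 0 < rho0 < 1 /\
     exists r0 b0 c : R, 0 < r0 /\ 1 <= b0 /\ 0 < c /\
       forall s : C, Rabs (Re s) < r0 -> b0 < Rabs (Im s) ->
       forall (n : nat) (f : C1fun),
         norm_b (Im s) (iter n (transfer Phi p s) f)
         <= c * rho0 ^ n * sqrt (Rabs (Im s)) * norm_b (Im s) f.
Proof.
move=> [[k1 Kk1] _ hK] ntriv hU p_pos p_sum.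
have K_code x : K x -> exists a y, K y /\ Phi a y = x by move/hK.
have K_maps w x : K x -> K (phiw w x).
  by elim: w => //= a w IH /IH h; apply/hK; exists a, (phiw w x).
have [k2 Kk2 k12] : exists2 k2, K k2 & k1 <> k2.
  apply: NNPP => h; apply: ntriv; exists k1 => y; split => [Ky|-> //].
  by apply: NNPP => ne; apply: h; exists y => // e; apply: ne.
have [D D1 hD] := thw_uniformly_lipschitz.
have [gam [c [gam1 c0 hc]]] := ifs_word_contracting.
have [kap kap0 hkap] := log_deriv_bounded.
have [c1 [N0 [c1P uni]]] := uni_phase K (ex_intro _ k1 Kk1) hU.
have [rho0 [r0 [b0 [C0 [h1 h2 h3 h4 main]]]]] := weighted_decay A Phi p log_deriv p_pos p_sum
  D kap c gam D1 kap0 c0 gam1 hkap hD word_mvt hc K K_code K_maps k1 k2 Kk1 Kk2 k12 c1 N0 c1P uni.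
pose mu := 2 * D + 8 * D * c.
have muP : 0 < mu by have := Rmult_lt_0_compat D c; rewrite /mu; lra.
exists rho0; split => //; exists r0, b0, (C0 * (1 + 2 * mu)); split => //; split => //; split.
  by apply: Rmult_lt_0_compat; lra.
move=> s hs hb n f.
set B := Rabs (Im s) in hb *; set F := iter n _ f; set Nf := norm_b _ f.
have BP : 0 < B by lra.
have s0 : 0 <= sup_norm f.
  by apply: Rle_trans (sup_norm_ub I01_0 (c1fun_continuous f)); exact: Cmod_ge_0.
have d0 : 0 <= sup_norm (derivC f).
  by apply: Rle_trans (sup_norm_ub I01_0 (c1fun_deriv_continuous f)); exact: Cmod_ge_0.
have Bd0 : 0 <= / B * sup_norm (derivC f).
  by apply: Rmult_le_pos => //; left; exact: Rinv_0_lt_compat.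
have f1 x : Cmod (f x) <= Nf.
  apply: Rle_trans (sup_norm_ub x (c1fun_continuous f)) _.
  by rewrite /Nf /norm_b -/B; lra.
have f2 (x y : I01) : Cmod (f x - f y) <= B * Nf * Rabs (x - y).
  apply: lipschitz_of_derivC => z.
  apply: Rle_trans (sup_norm_ub z (c1fun_deriv_continuous f)) _.
  rewrite /Nf /norm_b -/B Rmult_plus_distr_l -Rmult_assoc Rinv_r ?Rmult_1_l; last lra.
  have := Rmult_le_pos _ _ (Rlt_le _ _ BP) s0; lra.
have [m1 m2] := main s hs hb n f Nf f1 f2.
rewrite -/B -/mu in m1 m2; set X := C0 * rho0 ^ n * sqrt B * Nf in m1 m2.
have X0 : 0 <= X by apply: Rle_trans (m1 I01_0); exact: Cmod_ge_0.
have sF : sup_norm F <= X.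
  by apply: sup_norm_le => [|x]; [exact: c1fun_continuous | rewrite iter_transfer].
have sdF : sup_norm (derivC F) <= 2 * mu * B * X.
  apply: sup_norm_le => [|x]; first exact: c1fun_deriv_continuous.
  have mB : 0 < mu * B by exact: Rmult_lt_0_compat.
  (* Below distance 1 / (2 mu B) the exponential modulus is linear up to a factor 2; the factor B
     this produces is cancelled by the weight 1/|b| of the norm. *)
  apply: (derivC_le_of_local_lipschitz F _ (1 / 2 / (mu * B))).
    by apply: Rdiv_lt_0_compat; lra.
  move=> y hy; rewrite !iter_transfer; apply: Rle_trans (m2 y x) _.
  have h5 : 0 <= mu * B * Rabs (y - x) <= 1 / 2.
    split; first by apply: Rmult_le_pos; [lra | exact: Rabs_pos].
    have := Rmult_le_compat_l _ _ _ (Rlt_le _ _ mB) (Rlt_le _ _ hy).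
    by have -> : mu * B * (1 / 2 / (mu * B)) = 1 / 2 by [field; lra].
  have := Rmult_le_compat_l _ _ _ X0 (expm1_le2 _ h5); lra.
rewrite {1}/norm_b -/B.
have := Rmult_le_compat_l (/ B) _ _ (Rlt_le _ _ (Rinv_0_lt_compat _ BP)) sdF.
have -> : / B * (2 * mu * B * X) = 2 * mu * X by field; lra.
have -> : C0 * (1 + 2 * mu) * rho0 ^ n * sqrt B * Nf = X + 2 * mu * X by rewrite /X; ring.
lra.
Qed.

End IFS.

(** * Completeness of the space of continuously differentiable functions *)

Lemma le_of_geometric (a b t q : R) : 0 <= q < 1 -> (forall k : nat, a <= b + t * q ^ k) -> a <= b.
Proof.
move=> hq h.
have h1 : is_lim_seq (fun k => b + t * q ^ k) (b + t * 0).
  apply: is_lim_seq_plus'; first exact: is_lim_seq_const.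
  apply: is_lim_seq_mult'; first exact: is_lim_seq_const.
  by apply: is_lim_seq_geom; rewrite Rabs_pos_eq; lra.
have := is_lim_seq_le _ _ a _ h (is_lim_seq_const a) h1.
by rewrite /= Rmult_0_r Rplus_0_r.
Qed.

Lemma geometric_cauchy_lim (u : nat -> R) (t q : R) : 0 <= q < 1 ->
  (forall n k : nat, Rabs (u (n + k)%nat - u n) <= t * q ^ n) ->
  forall n, Rabs (u n - real (Lim_seq u)) <= t * q ^ n.
Proof.
move=> hq hu.
have t0 : 0 <= t.
  by have := hu 0%nat 0%nat; have := Rabs_pos (u (0 + 0)%nat - u 0%nat); rewrite /=; lra.
have [l hl] : ex_finite_lim_seq u.
  apply/ex_lim_seq_cauchy_corr => e.
  have e0 : 0 < e / (2 * (t + 1)).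
    by apply: Rdiv_lt_0_compat; [exact: cond_pos | lra].
  have [N hN] := pow_lt_1_zero q ltac:(by rewrite Rabs_pos_eq; lra) _ e0.
  have tq : 2 * (t * q ^ N) < e.
    have := hN N (le_n N); rewrite Rabs_pos_eq; last by apply: pow_le; lra.
    move=> h1; have p := pow_le q N (proj1 hq).
    have := Rmult_lt_compat_l (2 * (t + 1)) _ _ ltac:(lra) h1.
    have -> : 2 * (t + 1) * (e / (2 * (t + 1))) = e by field; lra.
    lra.
  exists N => n m hn hm.
  have := hu N (n - N)%nat; have := hu N (m - N)%nat.
  have -> : (N + (n - N))%nat = n by lia.
  have -> : (N + (m - N))%nat = m by lia.
  move=> h1 h2; have := Rabs_triang (u n - u N) (- (u m - u N)); rewrite Rabs_Ropp.
  have -> : u n - u N + - (u m - u N) = u n - u m by ring.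
  lra.
rewrite (is_lim_seq_unique _ _ hl) /= => n.
rewrite Rabs_minus_sym.
have h1 : is_lim_seq (fun k => Rabs (u (n + k)%nat - u n)) (Rabs (l - u n)).
  apply: (is_lim_seq_abs _ (l - u n)); apply: is_lim_seq_minus'; last exact: is_lim_seq_const.
  apply: (is_lim_seq_ext (fun k => u (k + n)%nat)); first by move=> k; rewrite addnC.
  by apply/(is_lim_seq_incr_n u).
exact: (is_lim_seq_le _ _ _ (t * q ^ n) (hu n) h1 (is_lim_seq_const _)).
Qed.

Definition Clim (u : nat -> C) : C :=
  (real (Lim_seq (fun n => Re (u n))), real (Lim_seq (fun n => Im (u n)))).

Lemma Rabs_Im_le (z : C) : Rabs (Im z) <= Cmod z.
Proof. exact: Rle_trans (Rmax_r _ _) (Rmax_Cmod z). Qed.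

Lemma Cmod_le_Re_Im (z : C) : Cmod z <= Rabs (Re z) + Rabs (Im z).
Proof.
case: z => x y.
have -> : ((x, y) : C) = (RtoC x + RtoC y * Ci)%C by apply: injective_projections => /=; ring.
apply: Rle_trans (Cmod_triangle _ _) _; rewrite Cmod_mult !Cmod_R.
have -> : Cmod Ci = 1.
  by rewrite /Cmod /=; have -> : 0 * (0 * 1) + 1 * (1 * 1) = 1 by [ring]; exact: sqrt_1.
by rewrite Rmult_1_r; right; congr (_ + _); congr Rabs; rewrite /=; ring.
Qed.

Lemma geometric_cauchy_Clim (u : nat -> C) (t q : R) : 0 <= q < 1 ->
  (forall n k : nat, Cmod (u (n + k)%nat - u n) <= t * q ^ n) ->
  forall n, Cmod (u n - Clim u) <= 2 * t * q ^ n.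
Proof.
move=> hq hu n; apply: Rle_trans (Cmod_le_Re_Im _) _.
have h1 : forall n k : nat, Rabs (Re (u (n + k)%nat) - Re (u n)) <= t * q ^ n.
  by move=> i k; apply: Rle_trans (hu i k); exact: (re_le_Cmod (u (i + k)%nat - u i)%C).
have h2 : forall n k : nat, Rabs (Im (u (n + k)%nat) - Im (u n)) <= t * q ^ n.
  by move=> i k; apply: Rle_trans (hu i k); exact: (Rabs_Im_le (u (i + k)%nat - u i)%C).
have := geometric_cauchy_lim _ _ _ hq h1 n; have := geometric_cauchy_lim _ _ _ hq h2 n => h3 h4.
have -> : 2 * t * q ^ n = t * q ^ n + t * q ^ n by ring.
exact: Rplus_le_compat h4 h3.
Qed.

Definition C1sub (f g : C1fun) : C1fun := C1plus f (C1opp g).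

Lemma C1subE (f g : C1fun) (x : I01) : C1sub f g x = (f x - g x)%C.
Proof. by change (f x + RtoC (-1) * g x = f x - g x)%C; ring. Qed.

Lemma C1plusE (f g : C1fun) (x : I01) : C1plus f g x = (f x + g x)%C.
Proof. by []. Qed.

Lemma C1scalE (z : C) (f : C1fun) (x : I01) : C1scal z f x = (z * f x)%C.
Proof. by []. Qed.

Lemma derivC_sub (f g : C1fun) (x : I01) : derivC (C1sub f g) x = (derivC f x - derivC g x)%C.
Proof.
rewrite derivC_plus derivC_scal.
by change (derivC f x + RtoC (-1) * derivC g x = derivC f x - derivC g x)%C; ring.
Qed.

Section Complete.
Variable b : R.
Hypothesis b_neq0 : b <> 0.

Lemma norm_b_ge0 (f : C1fun) : 0 <= norm_b b f.
Proof.
apply: Rplus_le_le_0_compat.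
  by apply: Rle_trans (sup_norm_ub I01_0 (c1fun_continuous f)); exact: Cmod_ge_0.
apply: Rmult_le_pos; first exact: Rinv_abs_ge0.
by apply: Rle_trans (sup_norm_ub I01_0 (c1fun_deriv_continuous f)); exact: Cmod_ge_0.
Qed.

Lemma Cmod_le_norm_b (f : C1fun) (x : I01) : Cmod (f x) <= norm_b b f.
Proof.
apply: Rle_trans (sup_norm_ub x (c1fun_continuous f)) _; rewrite /norm_b.
have h : 0 <= sup_norm (derivC f).
  by apply: Rle_trans (sup_norm_ub I01_0 (c1fun_deriv_continuous f)); exact: Cmod_ge_0.
have := Rmult_le_pos _ _ (Rinv_abs_ge0 b) h; lra.
Qed.

Lemma Cmod_derivC_le_norm_b (f : C1fun) (x : I01) : Cmod (derivC f x) <= Rabs b * norm_b b f.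
Proof.
apply: Rle_trans (sup_norm_ub x (c1fun_deriv_continuous f)) _; rewrite /norm_b.
have B0 : 0 < Rabs b by exact: Rabs_pos_lt.
rewrite Rmult_plus_distr_l -Rmult_assoc Rinv_r ?Rmult_1_l; last lra.
have h : 0 <= sup_norm f.
  by apply: Rle_trans (sup_norm_ub I01_0 (c1fun_continuous f)); exact: Cmod_ge_0.
have := Rmult_le_pos _ _ (Rlt_le _ _ B0) h; lra.
Qed.

Lemma norm_b_sub_triangle (f g h : C1fun) :
  norm_b b (C1sub f h) <= norm_b b (C1sub f g) + norm_b b (C1sub g h).
Proof.
have -> : C1sub f h = C1plus (C1sub f g) (C1sub g h).
  by apply: c1fun_eq => x; rewrite C1plusE !C1subE; ring.
exact: norm_b_triangle.
Qed.

Lemma norm_b_sub_sym (f g : C1fun) : norm_b b (C1sub f g) <= norm_b b (C1sub g f).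
Proof.
have -> : C1sub f g = C1scal (RtoC (-1)) (C1sub g f).
  by apply: c1fun_eq => x; rewrite C1scalE !C1subE; ring.
apply: Rle_trans (norm_b_scal _ _ _) _; rewrite Cmod_R Rabs_Ropp Rabs_R1; lra.
Qed.

(** Functions and derivatives converge uniformly. The explicit rate is kept because the identities
    for the resolvent are later derived from geometric bounds. *)
Lemma C1_geometric_complete (F : nat -> C1fun) (t q : R) : 0 <= q < 1 ->
  (forall n, norm_b b (C1sub (F n.+1) (F n)) <= t * q ^ n) ->
  exists G : C1fun, forall n, norm_b b (C1sub (F n) G) <= 4 * t / (1 - q) * q ^ n.
Proof.
move=> hq hF.
pose t' := t / (1 - q).
have t0 : 0 <= t.
  by have := hF 0%nat; have := norm_b_ge0 (C1sub (F 1%nat) (F 0%nat)); rewrite /=; lra.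
have t'0 : 0 <= t' by apply: Rdiv_le_0_compat; lra.
have cauchy n k : norm_b b (C1sub (F (n + k)%nat) (F n)) <= t' * q ^ n.
  suff : norm_b b (C1sub (F (n + k)%nat) (F n)) <= t' * q ^ n * (1 - q ^ k).
    have p1 := pow_le q n (proj1 hq); have p2 := pow_le q k (proj1 hq).
    have := Rmult_le_pos _ _ (Rmult_le_pos _ _ t'0 p1) p2; lra.
  elim: k => [|k IH].
    rewrite addn0; have -> : C1sub (F n) (F n) = C1zero.
      by apply: c1fun_eq => x; rewrite C1subE; change (F n x - F n x = RtoC 0)%C; ring.
    by rewrite norm_b_zero /=; lra.
  rewrite addnS; apply: Rle_trans (norm_b_sub_triangle _ (F (n + k)%nat) _) _.
  have := hF (n + k)%nat; rewrite Rdef_pow_add /=.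
  have -> : t' * q ^ n * (1 - q * q ^ k) = t * (q ^ n * q ^ k) + t' * q ^ n * (1 - q ^ k).
    by rewrite /t'; field; lra.
  lra.
pose f x := Clim (fun n => F n x); pose g x := Clim (fun n => derivC (F n) x).
have B0 : 0 < Rabs b by exact: Rabs_pos_lt.
have hf x n : Cmod (F n x - f x) <= 2 * t' * q ^ n.
  apply: (geometric_cauchy_Clim (fun n => F n x)) => // i k.
  by rewrite -C1subE; exact: Rle_trans (Cmod_le_norm_b _ x) (cauchy i k).
have hg x n : Cmod (derivC (F n) x - g x) <= 2 * (Rabs b * t') * q ^ n.
  apply: (geometric_cauchy_Clim (fun n => derivC (F n) x)) => // i k.
  rewrite -derivC_sub Rmult_assoc; apply: Rle_trans (Cmod_derivC_le_norm_b _ x) _.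
  by apply: Rmult_le_compat_l; [lra | exact: cauchy].
have small (e : posreal) : exists n, 2 * (Rabs b * t') * q ^ n < e / 4.
  have D0 : 0 < 2 * (Rabs b * t') + 1 by have := Rmult_le_pos _ _ (Rlt_le _ _ B0) t'0; lra.
  have [n hn] := pow_lt_1_zero q ltac:(by rewrite Rabs_pos_eq; lra)
    (e / 4 / (2 * (Rabs b * t') + 1))
    ltac:(by apply: Rdiv_lt_0_compat => //; have := cond_pos e; lra).
  exists n; have := hn n (le_n n); have p1 := pow_le q n (proj1 hq).
  rewrite Rabs_pos_eq // => h; have := Rmult_lt_compat_l _ _ _ D0 h.
  have -> : (2 * (Rabs b * t') + 1) * (e / 4 / (2 * (Rabs b * t') + 1)) = e / 4 by field; lra.
  lra.
have cg x : continuous (U := C_UniformSpace) g x.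
  have key (e : posreal) : locally x (fun y => Cmod (g y - g x) < e).
    have [n hn] := small e.
    have := c1fun_deriv_continuous (F n) x.
    move=> /continuous_C [/filterlim_locally h1 /filterlim_locally h2].
    have e8 : 0 < e / 8 by have := cond_pos e; lra.
    apply: filter_imp (filter_and _ _ (h1 (mkposreal _ e8)) (h2 (mkposreal _ e8))) => y [].
    change (Rabs (Re (derivC (F n) y) - Re (derivC (F n) x)) < e / 8 ->
            Rabs (Im (derivC (F n) y) - Im (derivC (F n) x)) < e / 8 -> Cmod (g y - g x) < e).
    move=> a1 a2.
    have a3 : Cmod (derivC (F n) y - derivC (F n) x) < e / 4.
      apply: Rle_lt_trans (Cmod_le_Re_Im _) _.
      have -> : e / 4 = e / 8 + e / 8 by field.
      exact: Rplus_lt_compat a1 a2.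
    have -> : (g y - g x)%C = (Copp (derivC (F n) y - g y) + (derivC (F n) y - derivC (F n) x)
        + (derivC (F n) x - g x))%C by ring.
    apply: Rle_lt_trans (Cmod_triangle _ _) _.
    have := Cmod_triangle (Copp (derivC (F n) y - g y)) (derivC (F n) y - derivC (F n) x).
    rewrite Cmod_opp; have := hg y n; have := hg x n; have := cond_pos e; lra.
  apply/continuous_C; split; apply/filterlim_locally => e; apply: filter_imp (key e) => y.
    by apply: Rle_lt_trans; exact: (re_le_Cmod (g y - g x)%C).
  by apply: Rle_lt_trans; exact: (Rabs_Im_le (g y - g x)%C).
(* The mean value inequality for [F (n + k)] minus [F n], with k tending to infinity. The bound is
   proportional to |y - x|, which lets limit and derivative be exchanged. *)
have flip n (x y : I01) :
    Cmod ((f y - f x) - (F n y - F n x)) <= Rabs b * t' * q ^ n * Rabs (y - x).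
  apply: (le_of_geometric _ _ (4 * t' * q ^ n) q hq) => k.
  have h1 := lipschitz_of_derivC (C1sub (F (n + k)%nat) (F n)) (Rabs b * t' * q ^ n) y x.
  rewrite !C1subE in h1.
  have {}h1 : Cmod (F (n + k)%nat y - F n y - (F (n + k)%nat x - F n x))
      <= Rabs b * t' * q ^ n * Rabs (y - x).
    apply: h1 => z; apply: Rle_trans (Cmod_derivC_le_norm_b _ z) _.
    by rewrite Rmult_assoc; apply: Rmult_le_compat_l; [lra | exact: cauchy].
  have -> : ((f y - f x) - (F n y - F n x) = (F (n + k)%nat y - F n y - (F (n + k)%nat x - F n x))
    + (Copp (F (n + k)%nat y - f y) + (F (n + k)%nat x - f x)))%C by ring.
  apply: Rle_trans (Cmod_triangle _ _) _.
  have := Cmod_triangle (Copp (F (n + k)%nat y - f y)) (F (n + k)%nat x - f x).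
  rewrite Cmod_opp; have := hf y (n + k)%nat; have := hf x (n + k)%nat.
  rewrite Rdef_pow_add; lra.
have df x : is_derive01 (V := C_R_NormedModule) f x (g x).
  have key (e : posreal) : locally' x (fun y => Cmod (RtoC (/ (y - x)) * (f y - f x) - g x) < e).
    have [n hn] := small e.
    have := c1fun_deriv (F n) x => /is_derive01_C [/filterlim_locally h1 /filterlim_locally h2].
    have e8 : 0 < e / 8 by have := cond_pos e; lra.
    have h3 : locally' x (fun y => y <> x) by exists e.
    apply: filter_imp (filter_and _ _ (filter_and _ _ (h1 (mkposreal _ e8))
      (h2 (mkposreal _ e8))) h3) => y [[]].
    change (Rabs (/ (y - x) * (Re (F n y) - Re (F n x)) - Re (derivC (F n) x)) < e / 8 ->
            Rabs (/ (y - x) * (Im (F n y) - Im (F n x)) - Im (derivC (F n) x)) < e / 8 -> y <> x ->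
            Cmod (RtoC (/ (y - x)) * (f y - f x) - g x) < e).
    move=> a1 a2 nyx.
    have nz : y - x <> 0 by move=> e1; apply: nyx; apply: ival_inj; lra.
    have p := Rabs_pos_lt _ nz.
    have a3 : Cmod (RtoC (/ (y - x)) * (F n y - F n x) - derivC (F n) x) < e / 4.
      apply: Rle_lt_trans (Cmod_le_Re_Im _) _.
      set z := (_ - derivC (F n) x)%C.
      have -> : Re z = / (y - x) * (Re (F n y) - Re (F n x)) - Re (derivC (F n) x).
        by rewrite /z /Re /=; ring.
      have -> : Im z = / (y - x) * (Im (F n y) - Im (F n x)) - Im (derivC (F n) x).
        by rewrite /z /Re /Im /=; ring.
      lra.
    have a4 : Cmod (RtoC (/ (y - x)) * ((f y - f x) - (F n y - F n x))) <= Rabs b * t' * q ^ n.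
      rewrite Cmod_mult Cmod_R Rabs_inv.
      apply: (Rmult_le_reg_l (Rabs (y - x))) => //.
      rewrite -Rmult_assoc Rinv_r ?Rmult_1_l; last lra.
      by rewrite Rmult_comm; exact: flip.
    have -> : (RtoC (/ (y - x)) * (f y - f x) - g x)%C =
       (RtoC (/ (y - x)) * ((f y - f x) - (F n y - F n x))
       + (RtoC (/ (y - x)) * (F n y - F n x) - derivC (F n) x) + (derivC (F n) x - g x))%C by ring.
    apply: Rle_lt_trans (Cmod_triangle _ _) _.
    have := Cmod_triangle (RtoC (/ (y - x)) * ((f y - f x) - (F n y - F n x)))
       (RtoC (/ (y - x)) * (F n y - F n x) - derivC (F n) x).
    have := hg x n; have := cond_pos e; lra.
  apply/is_derive01_C; split; apply/filterlim_locally => e; apply: filter_imp (key e) => y.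
    apply: Rle_lt_trans; apply: Rle_trans (re_le_Cmod _); right.
    by rewrite /minus /plus /opp /scal /= /mult /abs /=; congr Rabs; rewrite /Re /=; ring.
  apply: Rle_lt_trans; apply: Rle_trans (Rabs_Im_le _); right.
  by rewrite /minus /plus /opp /scal /= /mult /abs /=; congr Rabs; rewrite /Re /Im /=; ring.
have fC1 : is_C1C f by exact: (@is_C1_intro C_R_CompleteNormedModule f g df cg).
exists (mkC1fun fC1) => n.
have e1 : sup_norm (C1sub (F n) (mkC1fun fC1)) <= 2 * t' * q ^ n.
  apply: sup_norm_le => [|x]; first exact: c1fun_continuous.
  by rewrite C1subE; exact: hf.
have e2 : sup_norm (derivC (C1sub (F n) (mkC1fun fC1))) <= 2 * (Rabs b * t') * q ^ n.
  apply: sup_norm_le => [|x]; first exact: c1fun_deriv_continuous.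
  rewrite derivC_sub.
  have -> : derivC (mkC1fun fC1) x = g x.
    exact: (is_derive01_unique (V := C_R_CompleteNormedModule)) (df x).
  exact: hg.
rewrite /norm_b.
have := Rmult_le_compat_l _ _ _ (Rinv_abs_ge0 b) e2.
have -> : / Rabs b * (2 * (Rabs b * t') * q ^ n) = 2 * t' * q ^ n by field; lra.
have -> : 4 * t / (1 - q) * q ^ n = 2 * t' * q ^ n + 2 * t' * q ^ n by rewrite /t'; field; lra.
lra.
Qed.

End Complete.

(** * The resolvent *)

Section Resolvent.
Variables (b : R) (T : C1fun -> C1fun) (Cst rho : R) (z : C).
Hypothesis b_neq0 : b <> 0.
Hypothesis T_plus : forall f g, T (C1plus f g) = C1plus (T f) (T g).
Hypothesis T_scal : forall k f, T (C1scal k f) = C1scal k (T f).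
Hypothesis rho_gt0 : 0 < rho.
Hypothesis T_iter : forall n f, norm_b b (iter n T f) <= Cst * rho ^ n * norm_b b f.
Hypothesis rho_lt : rho < Cmod z.

(** The sum over j < n of z^-(j+1) T^j f. *)
Fixpoint neumann (n : nat) (f : C1fun) : C1fun :=
  if n is n'.+1 then C1plus (neumann n' f) (C1scal (Cpow (/ z) n) (iter n' T f)) else C1zero.

Lemma z_neq0 : z <> 0.
Proof. by move=> e; move: rho_lt; rewrite e Cmod_0; lra. Qed.

Lemma Cst_ge0 (f : C1fun) : 0 <= Cst * norm_b b f.
Proof.
have := T_iter 0%nat f; have := norm_b_ge0 b f; rewrite /=; lra.
Qed.

Lemma T_sub (f g : C1fun) : T (C1sub f g) = C1sub (T f) (T g).
Proof. by rewrite /C1sub /C1opp T_plus T_scal. Qed.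

Lemma iter_T_plus (n : nat) (f g : C1fun) :
  iter n T (C1plus f g) = C1plus (iter n T f) (iter n T g).
Proof. by elim: n => //= n ->. Qed.

Lemma iter_T_scal (n : nat) (k : C) (f : C1fun) :
  iter n T (C1scal k f) = C1scal k (iter n T f).
Proof. by elim: n => //= n ->. Qed.

Lemma neumann_plus (n : nat) (f g : C1fun) :
  neumann n (C1plus f g) = C1plus (neumann n f) (neumann n g).
Proof.
elim: n => [|n IH] /=.
  by apply: c1fun_eq => x; change (RtoC 0 = RtoC 0 + RtoC 0)%C; ring.
rewrite IH iter_T_plus; apply: c1fun_eq => x.
by rewrite !C1plusE !C1scalE !C1plusE; ring.
Qed.

Lemma neumann_scal (n : nat) (k : C) (f : C1fun) :
  neumann n (C1scal k f) = C1scal k (neumann n f).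
Proof.
elim: n => [|n IH] /=.
  by apply: c1fun_eq => x; change (RtoC 0 = k * RtoC 0)%C; ring.
rewrite IH iter_T_scal; apply: c1fun_eq => x.
by rewrite !C1plusE !C1scalE !C1plusE !C1scalE; ring.
Qed.

Lemma neumann_T (n : nat) (f : C1fun) : neumann n (T f) = T (neumann n f).
Proof.
elim: n => [|n IH] /=.
  have e : C1zero = C1scal 0 C1zero.
    by apply: c1fun_eq => x; change (RtoC 0 = RtoC 0 * RtoC 0)%C; ring.
  rewrite {2}e T_scal; apply: c1fun_eq => x.
  by rewrite C1scalE; change (RtoC 0 = RtoC 0 * T C1zero x)%C; ring.
by rewrite IH T_plus T_scal -iterSr.
Qed.

Lemma neumann_telescope (n : nat) (f : C1fun) :
  C1sub (C1scal z (neumann n f)) (T (neumann n f))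
    = C1sub f (C1scal (Cpow (/ z) n) (iter n T f)).
Proof.
elim: n => [|n IH].
  rewrite -neumann_T; apply: c1fun_eq => x; rewrite !C1subE !C1scalE.
  by change (z * RtoC 0 - RtoC 0 = f x - RtoC 1 * f x)%C; ring.
have zz : (z * / z)%C = 1 by apply: Cinv_r; exact: z_neq0.
have h x : (z * neumann n f x - T (neumann n f) x = f x - Cpow (/ z) n * iter n T f x)%C.
  by have := f_equal (fun g : C1fun => g x) IH; rewrite !C1subE !C1scalE.
rewrite /= T_plus T_scal; apply: c1fun_eq => x; rewrite !C1subE !C1scalE !C1plusE !C1scalE.
transitivity ((z * neumann n f x - T (neumann n f) x) + (z * / z) * (Cpow (/ z) n) * iter n T f x
   - / z * Cpow (/ z) n * T (iter n T f) x)%C; first by rewrite /=; ring.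
by rewrite h zz /=; ring.
Qed.

(** The identities for the resolvent hold for partial sums up to a geometrically small error, and
    this lemma passes them to the limit. *)
Lemma C1fun_eq_of_geometric (f g : C1fun) (t q : R) : 0 <= q < 1 ->
  (forall n, norm_b b (C1sub f g) <= t * q ^ n) -> f = g.
Proof.
move=> hq h; apply: c1fun_eq => x.
have h0 : norm_b b (C1sub f g) <= 0.
  by apply: (le_of_geometric _ 0 t q) => // k; rewrite Rplus_0_l.
have h1 : norm_b b (C1sub f g) = 0 by have := norm_b_ge0 b (C1sub f g); lra.
have := f_equal (fun g : C1fun => g x) (norm_b_eq0 h1).
rewrite /= -/(C1sub f g x) => h2.
have : (f x - g x)%C = RtoC 0 by rewrite -C1subE.
move=> h3; have -> : f x = ((f x - g x) + g x)%C by ring.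
by rewrite h3; ring.
Qed.

Lemma not_in_spectrum : ~ @in_spectrum (C1_NormedModule b) T z.
Proof.
apply; have z0 := z_neq0.
have zP : 0 < Cmod z by lra.
have Cz : Cmod (/ z) = / Cmod z by exact: Cmod_inv.
have ziP : 0 < / Cmod z by exact: Rinv_0_lt_compat.
pose q := / Cmod z * rho.
have hq : 0 <= q < 1.
  split; first by rewrite /q; apply: Rmult_le_pos; lra.
  by rewrite /q; apply: (Rmult_lt_reg_l (Cmod z)) => //; rewrite -Rmult_assoc Rinv_r; lra.
have term n f : norm_b b (C1scal (Cpow (/ z) n) (iter n T f)) <= Cst * norm_b b f * q ^ n.
  apply: Rle_trans (norm_b_scal _ _ _) _; rewrite Cmod_pow Cz.
  have := Rmult_le_compat_l _ _ _ (pow_le _ n (Rlt_le _ _ ziP)) (T_iter n f).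
  by rewrite /q Rpow_mult_distr; lra.
pose k := 4 * Cst * / Cmod z / (1 - q).
have lim f : exists g, forall n, norm_b b (C1sub (neumann n f) g) <= k * norm_b b f * q ^ n.
  have [n|g hg] := C1_geometric_complete b b_neq0 (fun n => neumann n f)
    (/ Cmod z * (Cst * norm_b b f)) q hq.
    have -> : C1sub (neumann n.+1 f) (neumann n f)
      = C1scal (/ z)%C (C1scal (Cpow (/ z) n) (iter n T f)).
      apply: c1fun_eq => x; rewrite C1subE !C1scalE.
      change (neumann n f x + (/ z * Cpow (/ z) n) * iter n T f x - neumann n f x
        = / z * (Cpow (/ z) n * iter n T f x))%C; ring.
    apply: Rle_trans (norm_b_scal _ _ _) _; rewrite Cz Rmult_assoc.
    by apply: Rmult_le_compat_l; [lra | exact: term].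
  exists g => n; apply: Rle_trans (hg n) _; right; rewrite /k; field; lra.
pose S f := proj1_sig (constructive_indefinite_description _ (lim f)).
have hS f : forall n, norm_b b (C1sub (neumann n f) (S f)) <= k * norm_b b f * q ^ n.
  exact: (proj2_sig (constructive_indefinite_description _ (lim f))).
have k0 f : 0 <= k * norm_b b f.
  have := hS f 0%nat; have := norm_b_ge0 b (C1sub (neumann 0 f) (S f)); rewrite /=; lra.
have S_plus f g : S (C1plus f g) = C1plus (S f) (S g).
  apply: (C1fun_eq_of_geometric _ _
    (k * norm_b b (C1plus f g) + k * norm_b b f + k * norm_b b g) q hq) => n.
  apply: Rle_trans (norm_b_sub_triangle b _ (neumann n (C1plus f g)) _) _.
  have h1 := Rle_trans _ _ _ (norm_b_sub_sym b (S (C1plus f g)) _) (hS (C1plus f g) n).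
  have -> : C1sub (neumann n (C1plus f g)) (C1plus (S f) (S g))
    = C1plus (C1sub (neumann n f) (S f)) (C1sub (neumann n g) (S g)).
    by rewrite neumann_plus; apply: c1fun_eq => x; rewrite !(C1subE, C1plusE); ring.
  have := norm_b_triangle b (C1sub (neumann n f) (S f)) (C1sub (neumann n g) (S g)).
  have := hS f n; have := hS g n; lra.
have S_scal a f : S (C1scal a f) = C1scal a (S f).
  apply: (C1fun_eq_of_geometric _ _
    (k * norm_b b (C1scal a f) + Cmod a * (k * norm_b b f)) q hq) => n.
  apply: Rle_trans (norm_b_sub_triangle b _ (neumann n (C1scal a f)) _) _.
  have h1 := Rle_trans _ _ _ (norm_b_sub_sym b (S (C1scal a f)) _) (hS (C1scal a f) n).
  have -> : C1sub (neumann n (C1scal a f)) (C1scal a (S f))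
    = C1scal a (C1sub (neumann n f) (S f)).
    by rewrite neumann_scal; apply: c1fun_eq => x; rewrite !(C1subE, C1scalE); ring.
  have := norm_b_scal b a (C1sub (neumann n f) (S f)).
  have := Rmult_le_compat_l _ _ _ (Cmod_ge_0 a) (hS f n); lra.
have right_inv f : C1sub (C1scal z (S f)) (T (S f)) = f.
  apply: (C1fun_eq_of_geometric _ _
    ((Cmod z + Cst * rho) * (k * norm_b b f) + Cst * norm_b b f) q hq) => n.
  set d := C1sub (neumann n f) (S f).
  have hd : norm_b b d <= k * norm_b b f * q ^ n by exact: hS.
  have -> : C1sub (C1sub (C1scal z (S f)) (T (S f))) f
     = C1plus (C1plus (C1scal (- z)%C d) (T d))
         (C1scal (RtoC (-1)) (C1scal (Cpow (/ z) n) (iter n T f))).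
    have := neumann_telescope n f => tel.
    apply: c1fun_eq => x; have := f_equal (fun g : C1fun => g x) tel.
    rewrite /d T_sub !(C1subE, C1scalE, C1plusE) => h.
    have -> : f x = ((f x - Cpow (/ z) n * iter n T f x) + Cpow (/ z) n * iter n T f x)%C by ring.
    by rewrite -h; ring.
  apply: Rle_trans (norm_b_triangle _ _ _) _.
  have h1 := norm_b_triangle b (C1scal (- z)%C d) (T d).
  have h2 := norm_b_scal b (- z)%C d; rewrite Cmod_opp in h2.
  have h3 := T_iter 1 d; rewrite /= Rmult_1_r in h3.
  have h4 := norm_b_scal b (RtoC (-1)) (C1scal (Cpow (/ z) n) (iter n T f)).
  rewrite Cmod_R Rabs_Ropp Rabs_R1 Rmult_1_l in h4.
  have h5 := term n f.
  have h6 := Rmult_le_compat_l _ _ _ (Rlt_le _ _ zP) hd.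
  have h7 : Cst * rho * norm_b b d <= Cst * rho * (k * norm_b b f * q ^ n).
    (* No sign is assumed for [Cst]; a negative one would, by [Cst_ge0], force every norm to
       vanish. *)
    have [c0|c0] := Rle_dec 0 Cst.
      by apply: Rmult_le_compat_l => //; apply: Rmult_le_pos; lra.
    have nz g : norm_b b g = 0.
      by have := Cst_ge0 g; have := norm_b_ge0 b g => ? ?; nra.
    by rewrite !nz; lra.
  lra.
have S_T f : S (T f) = T (S f).
  apply: (C1fun_eq_of_geometric _ _
    (k * norm_b b (T f) + Rabs Cst * rho * (k * norm_b b f)) q hq) => n.
  apply: Rle_trans (norm_b_sub_triangle b _ (neumann n (T f)) _) _.
  have h1 := Rle_trans _ _ _ (norm_b_sub_sym b (S (T f)) _) (hS (T f) n).
  have h2 := T_iter 1 (C1sub (neumann n f) (S f)).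
  rewrite /= Rmult_1_r T_sub -neumann_T in h2.
  have n0 := norm_b_ge0 b (C1sub (neumann n f) (S f)).
  have h3 : Cst * rho * norm_b b (C1sub (neumann n f) (S f))
      <= Rabs Cst * rho * norm_b b (C1sub (neumann n f) (S f)).
    apply: Rmult_le_compat_r => //; apply: Rmult_le_compat_r; first lra; exact: Rle_abs.
  have h4 : 0 <= Rabs Cst * rho by apply: Rmult_le_pos; [exact: Rabs_pos | lra].
  have := Rmult_le_compat_l _ _ _ h4 (hS f n); lra.
exists S; split.
- split; [exact: S_plus | exact: S_scal |].
  (* The partial sum at n = 0 is zero, so [hS f 0] already bounds [S f]; the other terms make the
     constant positive without knowing the sign of [k]. *)
  exists (k * norm_b b (S C1zero) + Rabs k + 1).
  have := k0 (S C1zero); have := Rabs_pos k; split; first lra.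
  move=> f; change (norm_b b (S f) <= (k * norm_b b (S C1zero) + Rabs k + 1) * norm_b b f).
  have h1 := Rle_trans _ _ _ (norm_b_sub_sym b (S f) _) (hS f 0%nat).
  have e : C1sub (S f) (neumann 0 f) = S f.
    by apply: c1fun_eq => x; rewrite C1subE; change (S f x - RtoC 0 = S f x)%C; ring.
  rewrite e /= Rmult_1_r in h1; have n0 := norm_b_ge0 b f.
  have := Rmult_le_compat_r _ _ _ n0 (Rle_abs k).
  have := Rmult_le_pos _ _ (k0 (S C1zero)) n0; lra.
- move=> f; change (S (C1sub (C1scal z f) (T f)) = f).
  rewrite /C1sub /C1opp S_plus !S_scal S_T -[RHS]right_inv; reflexivity.
- exact: right_inv.
Qed.

End Resolvent.

Lemma transfer_plus (A : finType) (Phi : contracting_ifs A) (p : A -> R) (s : C) (f g : C1fun) :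
  transfer Phi p s (C1plus f g) = C1plus (transfer Phi p s f) (transfer Phi p s g).
Proof.
apply: c1fun_eq => x; rewrite C1plusE /= /transfer_fun -big_split /=.
by apply: eq_bigr => a _; exact: Cmult_plus_distr_l.
Qed.

Lemma transfer_scal (A : finType) (Phi : contracting_ifs A) (p : A -> R) (s k : C) (f : C1fun) :
  transfer Phi p s (C1scal k f) = C1scal k (transfer Phi p s f).
Proof.
apply: c1fun_eq => x; rewrite C1scalE /= /transfer_fun big_distrr /=.
by apply: eq_bigr => a _; rewrite !Cmult_assoc; congr Cmult; ring.
Qed.

Theorem theorem1p1 (A : finType) (Phi : contracting_ifs A) (K : I01 -> Prop) (p : A -> R)
    (K_attractor : is_attractor Phi K)
    (K_nontrivial : ~ exists x : I01, forall y : I01, K y <-> y = x)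
    (Phi_UNI : UNI Phi K)
    (p_bounds : forall a : A, 0 < p a < 1)
    (p_sum : \big[Rplus/0]_(a : A) p a = 1) :
  (exists rho0 : R, 0 < rho0 < 1 /\
     exists r0 b0 c : R, 0 < r0 /\ 0 < b0 /\ 0 < c /\
       forall s : C, Rabs (Re s) < r0 -> b0 < Rabs (Im s) ->
       forall (n : nat) (f : C1fun),
         norm_b (Im s) (iter n (transfer Phi p s) f)
         <= c * rho0 ^ n * sqrt (Rabs (Im s)) * norm_b (Im s) f)
  /\
  (exists delta : R, 0 < delta < 1 /\
     exists r0 b0 : R, 0 < r0 /\ 0 < b0 /\
       forall s : C, Rabs (Re s) < r0 -> b0 < Rabs (Im s) ->
         Rbar_le (@spectral_radius (C1_NormedModule (Im s)) (transfer Phi p s))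
                 (Finite (1 - delta))).
Proof.
have [rho0 [rho01 [r0 [b0 [c [r0P [b0P [cP decay]]]]]]]] :=
  ifs_norm_decay A Phi K p K_attractor K_nontrivial Phi_UNI (fun a => proj1 (p_bounds a)) p_sum.
split.
  by exists rho0; split => //; exists r0, b0, c; split => //; split; first lra.
(* The factor |b|^(1/2) affects the size of the resolvent but not the region |z| > rho0 where it
   exists, so one delta serves all s. *)
exists (1 - rho0); split; first lra.
exists r0, b0; split => //; split; first lra.
move=> s hr hb; have -> : 1 - (1 - rho0) = rho0 by ring.
have [_] := Lub_Rbar_correct (fun t =>
  exists2 z, @in_spectrum (C1_NormedModule (Im s)) (transfer Phi p s) z & t = Cmod z).
apply=> t [z hz ->] /=; apply: Rnot_lt_le => lt; move: hz.
apply: (not_in_spectrum (Im s) _ (c * sqrt (Rabs (Im s))) rho0) => //; try lra.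
- by move=> e; move: hb; rewrite e Rabs_R0; lra.
- exact: transfer_plus.
- exact: transfer_scal.
- by move=> n f; have := decay s hr hb n f; lra.
Qed.
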